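(* Let $Y\sim \mathrm{PH}(\boldsymbol{\pi},\boldsymbol{T})$ be a phase-type random variable, let $\Theta$ be a positive real-valued random variable independent of $Y$, and set $X := \frac{1}{\Theta}\,Y$. Let $\boldsymbol{e}$ be the column vector of ones and $\boldsymbol{t}=-\boldsymbol{T}\boldsymbol{e}$. Let $F_X$, $f_X$ and $\mathcal{L}_X(s)=\mathbb{E}[e^{-sX}]$ denote the distribution function, density and Laplace transform of $X$, let $\mathcal{L}_\Theta(s)=\mathbb{E}[e^{-s\Theta}]$, $s>0$, be the Laplace transform of $\Theta$, and let $\mathcal{L}_\Theta'$ be the derivative of $\mathcal{L}_\Theta$. Then: \begin{enumerate} \item $F_X(x)= 1 - \boldsymbol{\pi}\, \mathcal{L}_{\Theta}(-\boldsymbol{T} x)\,\boldsymbol{e}$ for $x>0$. \item $f_X(x)= -\boldsymbol{\pi}\, \mathcal{L}'_{\Theta}(-\boldsymbol{T} x)\,\boldsymbol{t}$ for $x>0$. \item $\mathcal{L}_X(s)=\boldsymbol{\pi}\,\mathbb{E}\left[\left(\frac{s}{\Theta}\boldsymbol{I}-\boldsymbol{T}\right)^{-1}\right]\boldsymbol{t}$ for $s>0$. \item $\mathbb{E}(X^\nu)= \mathbb{E}(1/\Theta^\nu)\,\Gamma(\nu + 1)\,\boldsymbol{\pi}(-\boldsymbol{T})^{-\nu}\boldsymbol{e}$ for $\nu\ge 0$, provided that it is well-defined. \end{enumerate}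
   Context: Phase-type distributions: let $(J_t)_{t\ge 0}$ be a time-homogeneous Markov jump process on $\{1,\dots,p,p+1\}$ in which states $1,\dots,p$ are transient and $p+1$ is absorbing, with intensity matrix $\begin{pmatrix}\boldsymbol{T} & \boldsymbol{t}\\ \boldsymbol{0} & 0\end{pmatrix}$, where $\boldsymbol{T}$ is a $p\times p$ sub-intensity matrix, $\boldsymbol{t}=-\boldsymbol{T}\boldsymbol{e}$ and $\boldsymbol{e}$ is the $p$-dimensional column vector of ones. Let $\boldsymbol{\pi}=(\pi_1,\dots,\pi_p)$ with $\pi_k=\mathbb{P}(J_0=k)$ and $\mathbb{P}(J_0=p+1)=0$. Then $Y=\inf\{t\ge 0: J_t=p+1\}$ is said to be phase-type distributed, $Y\sim\mathrm{PH}(\boldsymbol{\pi},\boldsymbol{T})$; it has density $\boldsymbol{\pi}e^{\boldsymbol{T}y}\boldsymbol{t}$ and distribution function $1-\boldsymbol{\pi}e^{\boldsymbol{T}y}\boldsymbol{e}$, $y>0$. Since the states $1,\dots,p$ are transient, all eigenvalues of $\boldsymbol{T}$ have strictly negative real part. Functions of matrices: for a function $g$ analytic on a region containing the eigenvalues of a matrix $\boldsymbol{M}$, $g(\boldsymbol{M})=\frac{1}{2\pi i}\oint_\Gamma g(z)(z\boldsymbol{I}-\boldsymbol{M})^{-1}\,dz$, where $\Gamma$ is a simple closed path (within the region of analyticity) enclosing the eigenvalues of $\boldsymbol{M}$. The functions $\mathcal{L}_\Theta$, $\mathcal{L}_\Theta'$ (extended analytically to $\{\mathrm{Re}\,s>0\}$)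 and $z\mapsto z^{-\nu}$ (principal branch) are applied to matrices in this sense; $\boldsymbol{I}$ is the identity matrix, and $\Gamma(\nu+1)$ in item 4 is the Gamma function. The expectation of a random matrix is taken entrywise. *)

(* Defs.v *)
From HB Require Import structures.
From mathcomp Require Import all_boot all_order all_algebra.
From mathcomp Require Import all_classical all_reals all_analysis.
From mathcomp Require Import complex.

Set Implicit Arguments.
Unset Strict Implicit.
Unset Printing Implicit Defensive.

Import Order.TTheory GRing.Theory Num.Theory.
Import numFieldNormedType.Exports.

Local Open Scope classical_set_scope.
Local Open Scope ring_scope.

Local Notation Re := complex.Re.
Local Notation Im := complex.Im.

Section markov.
Context {R : realType}.

Definition transition_semigroup m (Pt : R -> 'M[R]_m) : Prop :=
  [/\ Pt 0 = 1%:M,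
      forall s t, 0 <= s -> 0 <= t -> Pt (s + t) = Pt s *m Pt t,
      forall t i j, 0 <= t -> 0 <= Pt t i j
    & forall t i, 0 <= t -> \sum_j Pt t i j = 1].

(* Pt h = I + h Q + o(h) as h decreases to 0. *)
Definition has_intensity m (Pt : R -> 'M[R]_m) (Q : 'M[R]_m) : Prop :=
  forall i j, (fun h : R => h^-1 * (Pt h i j - (i == j)%:R)) @ 0^'+ --> Q i j.

(* The event {J_{t 0} = i 0, ..., J_{t (n-1)} = i (n-1)}. *)
Definition cylinder m (Omega : Type) (J : R -> Omega -> 'I_m)
    (t : nat -> R) (i : nat -> 'I_m) (n : nat) : set Omega :=
  \bigcap_(k in `I_n) [set w | J (t k) w = i k].

(* The Markov property is stated without division: for times
   0 <= t 0 <= ... <= t n.+1, the probability of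
   {J_{t 0} = i 0, ..., J_{t n.+1} = i n.+1} is that of
   {J_{t 0} = i 0, ..., J_{t n} = i n} times the transition probability from
   i n to i n.+1 over the last time step.  In a finite (discrete) state
   space, right-continuity with left limits says that the paths are step
   functions with finitely many jumps in bounded time.  The values of J at
   negative times are irrelevant. *)
Definition markov_jump_process d (Omega : measurableType d)
    (P : probability Omega R) m (J : R -> Omega -> 'I_m)
    (alpha : 'rV[R]_m) (Q : 'M[R]_m) : Prop :=
  (forall t i, 0 <= t -> measurable [set w | J t w = i]) /\
  (forall w t, 0 <= t -> \forall s \near t^'+, J s w = J t w) /\
  (forall w t, 0 < t -> exists i, \forall s \near t^'-, J s w = i) /\
  (forall i, P [set w | J 0 w = i] = (alpha 0 i)%:E) /\
  exists Pt : R -> 'M[R]_m,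
    [/\ transition_semigroup Pt,
        has_intensity Pt Q
      & forall (n : nat) (t : nat -> R) (i : nat -> 'I_m),
          0 <= t 0%N -> (forall k, t k <= t k.+1) ->
          P (cylinder J t i n.+2) =
          (P (cylinder J t i n.+1)
             * (Pt (t n.+1 - t n) (i n) (i n.+1))%:E)%E].

(* Under the law of the process started at i, the set of times spent in i is
   almost surely bounded.  This law is determined by Q, so that the choice of
   the probability space and of the version J is immaterial. *)
Definition transient m (Q : 'M[R]_m) (i : 'I_m) : Prop :=
  exists (d : measure_display) (Omega : measurableType d)
         (P : probability Omega R) (J : R -> Omega -> 'I_m),
    markov_jump_process P J (delta_mx 0 i) Q /\
    {ae P, forall w, exists M : R, forall t, 0 <= t -> J t w = i -> t <= M}.

End markov.

Section phase_type.
Context {R : realType}.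

Definition ones p : 'cV[R]_p := const_mx 1.

Definition sub_intensity p (T : 'M[R]_p) : Prop :=
  (forall i j, i != j -> 0 <= T i j) /\ (forall i, \sum_j T i j <= 0).

Definition exit_vector p (T : 'M[R]_p) : 'cV[R]_p := - T *m ones p.

(* The states are 'I_(p + 1): lshift 1 k for the transient ones, and
   absorbing p for the last one. *)
Definition absorbing p : 'I_(p + 1) := rshift p ord0.

Definition ph_intensity p (T : 'M[R]_p) : 'M[R]_(p + 1) :=
  block_mx T (exit_vector T) 0 0.

(* The infimum is taken in the extended reals, where it is +oo if there is no
   absorption; absorption is almost sure when the other states are
   transient. *)
Definition absorption_time d (Omega : measurableType d)
    (P : probability Omega R) p (J : R -> Omega -> 'I_(p + 1))
    (tau : Omega -> R) : Prop :=
  {ae P, forall w,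
    (tau w)%:E = ereal_inf [set t%:E | t in [set t : R |
                              0 <= t /\ J t w = absorbing p]]}.

(* Y ~ PH(alpha, T): Y has the law of an absorption time, which may live on
   another probability space. *)
Definition phase_type d (Omega : measurableType d) (P : probability Omega R)
    (Y : {RV P >-> R}) p (alpha : 'rV[R]_p) (T : 'M[R]_p) : Prop :=
  [/\ sub_intensity T,
      forall k : 'I_p, transient (ph_intensity T) (lshift 1 k)
    & exists (d' : measure_display) (Omega' : measurableType d')
             (P' : probability Omega' R) (J : R -> Omega' -> 'I_(p + 1))
             (tau : {RV P' >-> R}),
        [/\ markov_jump_process P' J (row_mx alpha 0) (ph_intensity T),
            absorption_time P' J tau
          & forall A : set R, measurable A ->
              distribution P Y A = distribution P' tau A]].

End phase_type.

Section random_variables.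
Context {R : realType} d (Omega : measurableType d) (P : probability Omega R).

Definition independent_RV (X Y : {RV P >-> R}) : Prop :=
  forall A B : set R, measurable A -> measurable B ->
    P (X @^-1` A `&` Y @^-1` B) = (P (X @^-1` A) * P (Y @^-1` B))%E.

Definition has_density (X : {RV P >-> R}) (f : R -> R) : Prop :=
  [/\ measurable_fun setT f,
      forall x, 0 <= f x
    & forall A : set R, measurable A ->
        distribution P X A = (\int[lebesgue_measure]_(x in A) (f x)%:E)%E].

Definition expectation_mx m n (M : Omega -> 'M[R]_(m, n)) : 'M[R]_(m, n) :=
  \matrix_(i, j) fine ('E_P[fun w => M w i j])%E.

Definition laplace (X : Omega -> R) (s : R) : \bar R :=
  ('E_P[fun w => (expR (- (s * X w)))%R])%E.

End random_variables.

Definition Gamma {R : realType} (a : R) : R :=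
  \int[lebesgue_measure]_(u in `]0, +oo[) (u `^ (a - 1) * expR (- u)).

Section complex_functions.
Context {R : realType}.
Local Open Scope complex_scope.

Definition cexp (z : R[i]) : R[i] :=
  (expR (Re z) * cos (Im z)) +i* (expR (Re z) * sin (Im z)).

(* Principal argument, in ]-pi, pi]. *)
Definition carg (z : R[i]) : R :=
  let a := acos (Re z / Normc.normc z) in if 0 <= Im z then a else - a.

Definition cLog (z : R[i]) : R[i] := ln (Normc.normc z) +i* carg z.

Definition cpow (a : R) (z : R[i]) : R[i] := cexp (a%:C * cLog z).

Definition cexpectation d (Omega : measurableType d) (P : probability Omega R)
    (Z : Omega -> R[i]) : R[i] :=
  fine ('E_P[fun w => Re (Z w)])%E +i* fine ('E_P[fun w => Im (Z w)])%E.

(* z |-> E[e^{-zX}]; for X > 0 this is the analytic extension to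
   {Re z > 0} of the Laplace transform of X. *)
Definition claplace d (Omega : measurableType d) (P : probability Omega R)
    (X : Omega -> R) (z : R[i]) : R[i] :=
  cexpectation P (fun w => cexp (- z * (X w)%:C)).

Definition cderive (f : R[i] -> R[i]) (z : R[i]) : R[i] :=
  derive1 (f : R[i] -> R[i]^o) z.

Definition right_half_plane : set R[i] := [set z | 0 < Re z].

Definition slit_plane : set R[i] := [set z | ~ (Re z <= 0 /\ Im z = 0)].

End complex_functions.

Section contours.
Context {R : realType}.
Local Open Scope complex_scope.

Definition C1_on (a b : R) (f : R -> R) : Prop :=
  exists g : R -> R, [/\ forall x : R, derivable g x 1, continuous (derive1 g)
                       & forall x : R, a <= x <= b -> f x = g x].

Definition piecewise_C1 (gamma : R -> R[i]) : Prop :=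
  exists (n : nat) (t : nat -> R),
    [/\ t 0%N = 0, t n = 1
      & forall k, (k < n)%N ->
          [/\ t k < t k.+1, C1_on (t k) (t k.+1) (fun u => Re (gamma u))
            & C1_on (t k) (t k.+1) (fun u => Im (gamma u))]].

Definition simple_closed (gamma : R -> R[i]) : Prop :=
  gamma 0 = gamma 1 /\
  forall s t : R, 0 <= s < 1 -> 0 <= t < 1 -> gamma s = gamma t -> s = t.

(* At the finitely many break points the value of the derivative is
   irrelevant for the integral. *)
Definition path_derive (gamma : R -> R[i]) (u : R) : R[i] :=
  derive1 (fun v => Re (gamma v)) u +i* derive1 (fun v => Im (gamma v)) u.

Definition contour_integral (gamma : R -> R[i]) (f : R[i] -> R[i]) : R[i] :=
  let h u := f (gamma u) * path_derive gamma u in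
  (\int[lebesgue_measure]_(u in `[0, 1]) Re (h u))
  +i* (\int[lebesgue_measure]_(u in `[0, 1]) Im (h u)).

Definition two_pi_i : R[i] := 0 +i* (2 * pi).

Definition winding_number (gamma : R -> R[i]) (a : R[i]) : R[i] :=
  two_pi_i^-1 * contour_integral gamma (fun z => (z - a)^-1).

(* gamma is a simple closed path lying, with its interior, in the region D,
   and going once counterclockwise around each eigenvalue of M.  A point off
   the path is inside or outside it according to whether the winding number
   is 1 or 0. *)
Definition admissible_contour (D : set R[i]) p (M : 'M[R[i]]_p)
    (gamma : R -> R[i]) : Prop :=
  [/\ piecewise_C1 gamma, simple_closed gamma,
      forall u : R, 0 <= u <= 1 -> D (gamma u) /\ ~~ eigenvalue M (gamma u),
      forall a, ~ D a -> winding_number gamma a = 0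
    & forall a, eigenvalue M a -> winding_number gamma a = 1].

Definition cauchy_integral (gamma : R -> R[i]) (g : R[i] -> R[i]) p
    (M : 'M[R[i]]_p) : 'M[R[i]]_p :=
  \matrix_(i, j)
    (two_pi_i^-1 *
     contour_integral gamma (fun z => g z * invmx (z%:M - M) i j)).

(* g(M) exists and is A: there is an admissible contour, and the Cauchy
   integral over every admissible contour is A. *)
Definition is_matrix_function (D : set R[i]) (g : R[i] -> R[i]) p
    (M A : 'M[R[i]]_p) : Prop :=
  (exists gamma, admissible_contour D M gamma) /\
  (forall gamma, admissible_contour D M gamma -> cauchy_integral gamma g M = A).

(* g(M), for g analytic on the region D containing the eigenvalues of M. *)
Definition matrix_function (D : set R[i]) (g : R[i] -> R[i]) p
    (M : 'M[R[i]]_p) : 'M[R[i]]_p :=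
  xget 0 [set A | is_matrix_function D g M A].

Definition cmx m n (A : 'M[R]_(m, n)) : 'M[R[i]]_(m, n) :=
  map_mx (real_complex R) A.

End contours.

(* Main.v *)
Require Import Defs.
From HB Require Import structures.
From mathcomp Require Import all_boot all_order all_algebra.
From mathcomp Require Import all_classical all_reals all_analysis.
From mathcomp Require Import measurable_realfun.
From mathcomp Require Import complex ring lra.

Set Implicit Arguments.
Unset Strict Implicit.
Unset Printing Implicit Defensive.

Import Order.TTheory GRing.Theory Num.Theory.
Import numFieldNormedType.Exports.

Local Open Scope classical_set_scope.
Local Open Scope complex_scope.
Local Open Scope ring_scope.

Local Notation Re := complex.Re.
Local Notation Im := complex.Im.

(* Let S(t) be the transient block of the transition semigroup of J.  Then
   S' = S T, P(Y > y) = alpha S(y) e, and transience makes every eigenvalue of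
   T have negative real part (an eigenvector on the imaginary axis would give a
   recurrent class), so that S decays exponentially.  On a contour around the
   spectrum of - x T, the derivative of v |-> e^{- z v} S (x (th - v)) and the
   vanishing of the integrals of e^{- z v} show that e^{- z th} (z + x T)^-1
   integrates to 2 pi i S (x th); integrating over th = Theta with Fubini
   evaluates the Laplace transform of Theta and its derivative at - x T, while
   independence gives P(X > x) = E[alpha S (x Theta) e].  The resolvent
   (u - T)^-1 is the Laplace transform of S, which gives the third item.  For
   the moments, the layer cake formula turns E[Y^nu] into
   nu * int y^(nu - 1) alpha S(y) e dy.  This integral is computed against the
   contour by writing nu = n + a with 0 <= a < 1 and
   z^(- a) = (Gamma a Gamma (1 - a))^-1 int s^(- a) / (z + s) ds on the slit
   plane: the contour integrals of z^(- n) (z + s)^-1 (z + T)^-1 are rational,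
   and the poles 0 and - s are outside the contour. *)

(** * Complex exponentials and curves *)

(** [is_matrix_function] asks for one value shared by all admissible contours, and of such a contour
    only the winding numbers around the eigenvalues and around the points outside the region are
    known. Contours are therefore never deformed: integrals are evaluated by a primitive along the
    path, by Fubini or by partial fractions, and come down to the integral of the resolvent alone.
    That one is obtained from the Cayley-Hamilton theorem: multiplying the resolvent by [M - l] for
    the successive eigenvalues [l] trades each factor for a scalar integral of a rational function,
    and only the one with a single simple pole is nonzero. The existence of some contour is a
    separate matter, settled by a circle centred far out on the positive real axis. The exponential
    of [T] is never formed: the transient block [S] stands for it, through its differential
    equation, its value at 0 and the bounds 0 and 1 on its entries. *)

Section complex_basics.
Context {R : realType}.
Implicit Types z w : R[i].

(** The norm of [R[i]] takes its values in [R[i]]. This l1 norm is real-valued, subadditive and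
    submultiplicative, dominates both components, and its estimates are within reach of linear
    arithmetic; the price is a factor 2 here and there. *)
Definition n1 z : R := `|Re z| + `|Im z|.

Lemma n1_ge0 z : 0 <= n1 z.
Proof. exact: addr_ge0. Qed.

Lemma ReD z w : Re (z + w) = Re z + Re w. Proof. by case: z w => [a b] []. Qed.
Lemma ImD z w : Im (z + w) = Im z + Im w. Proof. by case: z w => [a b] []. Qed.
Lemma ReN z : Re (- z) = - Re z. Proof. by case: z. Qed.
Lemma ImN z : Im (- z) = - Im z. Proof. by case: z. Qed.
Lemma ReM z w : Re (z * w) = Re z * Re w - Im z * Im w.
Proof. by case: z w => [a b] []. Qed.
Lemma ImM z w : Im (z * w) = Re z * Im w + Im z * Re w.
Proof. by case: z w => [a b] []. Qed.
Lemma ReV z : Re z^-1 = Re z / (Re z ^+ 2 + Im z ^+ 2).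
Proof. by case: z. Qed.
Lemma ImV z : Im z^-1 = - (Im z / (Re z ^+ 2 + Im z ^+ 2)).
Proof. by case: z. Qed.

Definition ReImE := (ReD, ImD, ReN, ImN, ReM, ImM).

Lemma eqC z w : Re z = Re w -> Im z = Im w -> z = w.
Proof. by case: z w => [a b] [c d] /= -> ->. Qed.

Lemma Re_sum I (r : seq I) (p : pred I) (F : I -> R[i]) :
  Re (\sum_(i <- r | p i) F i) = \sum_(i <- r | p i) Re (F i).
Proof. by elim/big_rec2: _ => // i x y _ <-; rewrite ReD. Qed.

Lemma Im_sum I (r : seq I) (p : pred I) (F : I -> R[i]) :
  Im (\sum_(i <- r | p i) F i) = \sum_(i <- r | p i) Im (F i).
Proof. by elim/big_rec2: _ => // i x y _ <-; rewrite ImD. Qed.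

Lemma n1D z w : n1 (z + w) <= n1 z + n1 w.
Proof.
rewrite /n1 !ReImE.
have := ler_normD (Re z) (Re w); have := ler_normD (Im z) (Im w).
set a := `|_ + _|; set b := `|Re _ + _|; lra.
Qed.

Lemma n1N z : n1 (- z) = n1 z.
Proof. by rewrite /n1 !ReImE !normrN. Qed.

Lemma n1M z w : n1 (z * w) <= n1 z * n1 w.
Proof.
rewrite /n1 !ReImE.
have := ler_normB (Re z * Re w) (Im z * Im w).
have := ler_normD (Re z * Im w) (Im z * Re w).
rewrite !normrM mulrDr !mulrDl; set a := `|_ + _|; set b := `|_ - _|; lra.
Qed.

Lemma n1_real (x : R) : n1 x%:C = `|x|.
Proof. by rewrite /n1 /= normr0 addr0. Qed.

Lemma Re_le_n1 z : `|Re z| <= n1 z. Proof. by rewrite lerDl. Qed.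
Lemma Im_le_n1 z : `|Im z| <= n1 z. Proof. by rewrite lerDr. Qed.

Lemma n1_eq0 z : n1 z = 0 -> z = 0.
Proof.
move=> h; have := Re_le_n1 z; have := Im_le_n1 z; rewrite h !normr_le0.
by move=> /eqP hi /eqP hr; apply: eqC.
Qed.

Lemma sqn_gt0 z : z != 0 -> 0 < Re z ^+ 2 + Im z ^+ 2.
Proof.
move=> z0; rewrite lt_neqAle addr_ge0 ?sqr_ge0// andbT eq_sym.
rewrite paddr_eq0 ?sqr_ge0// !sqrf_eq0; apply: contra z0 => /andP[/eqP h /eqP k].
by apply/eqP; apply: eqC.
Qed.

(** With [q] the squared modulus, each component of the inverse is at most [1 / e], because
    [|Re z| * e] and [|Im z| * e] are at most [q]. The lower bound on the modulus is kept squared to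
    avoid square roots. *)
Lemma n1V_le z (e : R) : 0 < e -> e ^+ 2 <= Re z ^+ 2 + Im z ^+ 2 ->
  n1 z^-1 <= 2 / e.
Proof.
move=> e0 he; rewrite /n1 ReV ImV normrN !normrM.
set q := Re z ^+ 2 + _ in he *.
have q0 : 0 < q by apply: lt_le_trans he; rewrite exprn_gt0.
have qE : `|q^-1| = q^-1 by rewrite gtr0_norm// invr_gt0.
rewrite qE -mulrDl ler_pdivrMr// mulrAC ler_pdivlMr//.
have hab : q = `|Re z| ^+ 2 + `|Im z| ^+ 2 by rewrite !real_normK ?num_real.
have := normr_ge0 (Re z); have := normr_ge0 (Im z); move: he; rewrite hab.
set a := `|Re z|; set b := `|Im z| => he b0 a0.
have ha : a * e <= a ^+ 2 + b ^+ 2 by nra.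
have hb : b * e <= a ^+ 2 + b ^+ 2 by nra.
by rewrite mulrDl; lra.
Qed.

Lemma cexpD z w : cexp (z + w) = cexp z * cexp w.
Proof.
rewrite /cexp !ReImE expRD cosD sinD; apply: eqC; rewrite !ReImE /=; ring.
Qed.

Lemma cexp0 : cexp (0 : R[i]) = 1.
Proof. by rewrite /cexp /= expR0 cos0 sin0 mulr1 mulr0. Qed.

Lemma n1_cexp z : n1 (cexp z) <= 2 * expR (Re z).
Proof.
rewrite /n1 /= !normrM (gtr0_norm (expR_gt0 _)) -mulrDr mulrC.
rewrite ler_pM2r ?expR_gt0//.
have hc : `|cos (Im z)| <= 1 by rewrite ler_norml cos_geN1 cos_le1.
have hs : `|sin (Im z)| <= 1 by rewrite ler_norml sin_geN1 sin_le1.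
lra.
Qed.

Lemma cexp_neq0 z : cexp z != 0.
Proof.
apply/eqP => h; have : cexp (z - z) = 0 by rewrite cexpD h mul0r.
by rewrite subrr cexp0; exact/eqP/oner_neq0.
Qed.

Lemma cexpN z : cexp (- z) = (cexp z)^-1.
Proof.
apply: (mulfI (cexp_neq0 z)); rewrite -cexpD subrr cexp0 mulfV//.
exact: cexp_neq0.
Qed.

End complex_basics.

(** * Differentiation of real and complex functions of a real variable *)

Section real_derivatives.
Context {R : realType}.
Implicit Types (f g : R -> R).

Definition der f (x l : R) := is_derive x (1 : R) f l.

(** The differentiation rules return values in a fixed syntactic form; a derivative is found by
    composing rules, and this lemma leaves the comparison with the wanted value to [ring] or
    [field]. *)
Lemma der_eq f x l l' : der f x l -> l = l' -> der f x l'.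
Proof. by move=> + <-. Qed.

Lemma der_cst c x : der (fun=> c) x 0.
Proof. exact: is_derive_cst. Qed.

Lemma der_id x : der (fun t => t) x 1.
Proof. exact: is_derive_id. Qed.

Lemma derD f g x a b : der f x a -> der g x b ->
  der (fun t => f t + g t) x (a + b).
Proof. exact: is_deriveD. Qed.

Lemma derN f x a : der f x a -> der (fun t => - f t) x (- a).
Proof. exact: is_deriveN. Qed.

Lemma derB f g x a b : der f x a -> der g x b ->
  der (fun t => f t - g t) x (a - b).
Proof. exact: is_deriveB. Qed.

Lemma derM f g x a b : der f x a -> der g x b ->
  der (fun t => f t * g t) x (a * g x + f x * b).
Proof.
move=> fa gb; have := is_deriveM fa gb; rewrite /GRing.scale/= => h.
by apply: der_eq h _; rewrite addrC mulrC.
Qed.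

Lemma der_comp f g x a b : der g x b -> der f (g x) a ->
  der (fun t => f (g t)) x (a * b).
Proof. by move=> gb fa; apply: is_derive1_comp. Qed.

Lemma derV f x a : f x != 0 -> der f x a ->
  der (fun t => (f t)^-1) x (- a / f x ^+ 2).
Proof.
move=> f0 [d e]; apply: DeriveDef; first exact: derivableV.
by rewrite deriveV// e /GRing.scale/= mulNr mulrC mulNr.
Qed.

Lemma der_exp x : der expR x (expR x). Proof. exact: is_derive_expR. Qed.
Lemma der_sin x : der sin x (cos x). Proof. exact: is_derive_sin. Qed.
Lemma der_cos x : der cos x (- sin x). Proof. exact: is_derive_cos. Qed.

Lemma der_sum n (F : 'I_n -> R -> R) x (a : 'I_n -> R) :
  (forall i, der (F i) x (a i)) -> der (fun t => \sum_i F i t) x (\sum_i a i).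
Proof.
move=> h; have := is_derive_sum h; congr (is_derive _ _ _ _).
by apply/funext => t; rewrite fct_sumE.
Qed.

Lemma der_cont f x l : der f x l -> {for x, continuous f}.
Proof. by case=> d _; apply: differentiable_continuous; apply/derivable1_diffP. Qed.

Lemma der_near f g x l : (\forall t \near x, f t = g t) -> der f x l -> der g x l.
Proof.
exact: near_eq_is_derive. Qed.

End real_derivatives.

Section complex_derivatives.
Context {R : realType}.
Implicit Types (f g : R -> R[i]).

(* Complex-valued functions of a real variable are differentiated
   componentwise. *)
Definition cder (f : R -> R[i]) (x : R) (l : R[i]) :=
  der (fun t => Re (f t)) x (Re l) /\ der (fun t => Im (f t)) x (Im l).

Lemma cder_eq f x l l' : cder f x l -> l = l' -> cder f x l'.
Proof. by move=> + <-. Qed.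

Lemma cder_real (f : R -> R) x l : der f x l -> cder (fun t => (f t)%:C) x l%:C.
Proof. by move=> h; split => //=; exact: der_cst. Qed.

Lemma cder_cst c x : cder (fun=> c) x 0.
Proof. by split; exact: der_cst. Qed.

Lemma cderD f g x a b : cder f x a -> cder g x b ->
  cder (fun t => f t + g t) x (a + b).
Proof.
move=> [fr fi] [gr gi]; split; rewrite !ReImE.
  by under [X in der X]eq_fun do rewrite ReD; exact: derD.
by under [X in der X]eq_fun do rewrite ImD; exact: derD.
Qed.

Lemma cderN f x a : cder f x a -> cder (fun t => - f t) x (- a).
Proof.
move=> [fr fi]; split; rewrite !ReImE.
  by under [X in der X]eq_fun do rewrite ReN; exact: derN.
by under [X in der X]eq_fun do rewrite ImN; exact: derN.
Qed.

Lemma cderM f g x a b : cder f x a -> cder g x b ->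
  cder (fun t => f t * g t) x (a * g x + f x * b).
Proof.
move=> [fr fi] [gr gi]; split.
  under [X in der X]eq_fun do rewrite ReM.
  apply: der_eq (derB (derM fr gr) (derM fi gi)) _; rewrite !ReImE; ring.
under [X in der X]eq_fun do rewrite ImM.
apply: der_eq (derD (derM fr gi) (derM fi gr)) _; rewrite !ReImE; ring.
Qed.

Lemma cderV f x a : f x != 0 -> cder f x a ->
  cder (fun t => (f t)^-1) x (- a / f x ^+ 2).
Proof.
move=> f0 [fr fi].
have q0 := sqn_gt0 f0.
have qn : Re (f x) ^+ 2 + Im (f x) ^+ 2 != 0 by rewrite gt_eqF.
have hq : der (fun t => Re (f t) ^+ 2 + Im (f t) ^+ 2) x
    (2 * (Re (f x) * Re a + Im (f x) * Im a)).
  under [X in der X]eq_fun do rewrite !expr2.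
  apply: der_eq (derD (derM fr fr) (derM fi fi)) _; ring.
have hv := @derV _ (fun t => Re (f t) ^+ 2 + Im (f t) ^+ 2) _ _ qn hq.
have key : - a / f x ^+ 2 = - a * ((f x)^-1 * (f x)^-1).
  by rewrite -invfM expr2.
rewrite key; split.
  under [X in der X]eq_fun do rewrite ReV.
  apply: der_eq (derM fr hv) _; rewrite !ReImE ReV ImV; field; exact: qn.
under [X in der X _ _]eq_fun do rewrite ImV.
apply: der_eq (derN (derM fi hv)) _; rewrite !ReImE ReV ImV; field; exact: qn.
Qed.

Lemma cder_exp f x a : cder f x a -> cder (fun t => cexp (f t)) x (a * cexp (f x)).
Proof.
move=> [fr fi]; split => /=.
  apply: der_eq (derM (der_comp fr (der_exp _)) (der_comp fi (der_cos _))) _.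
  by rewrite !ReImE /=; ring.
apply: der_eq (derM (der_comp fr (der_exp _)) (der_comp fi (der_sin _))) _.
by rewrite !ReImE /=; ring.
Qed.

End complex_derivatives.

(** * Measurability, domination and Fubini for real and complex integrands *)

Section real_integrals.
Context {R : realType}.

Lemma measurable_inv : measurable_fun [set: R] (fun x : R => x^-1).
Proof.
(* Inversion is not continuous at 0, but it is [x] times a real power of the nonnegative number
   [x * x]; both sides are 0 at 0. *)
have -> : (fun x : R => x^-1) = (fun x => x * (x * x) `^ (-1)).
  apply/funext => x; rewrite powR_inv1; last by rewrite -expr2 sqr_ge0.
  have [->|x0] := eqVneq x 0; first by rewrite invr0 mul0r.
  by field.
apply: measurable_funM => //.
apply: (measurableT_comp (measurable_powR (-1))).
exact: measurable_funM.
Qed.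

Lemma measurable_funV d (T : measurableType d) (f : T -> R) :
  measurable_fun setT f -> measurable_fun setT (fun x => (f x)^-1).
Proof. exact: (measurableT_comp measurable_inv). Qed.

Lemma measurable_cosT d (T : measurableType d) (f : T -> R) :
  measurable_fun setT f -> measurable_fun setT (fun x => cos (f x)).
Proof.
apply: (@measurableT_comp _ _ _ _ _ _ (@cos R)).
by apply: continuous_measurable_fun; exact: continuous_cos.
Qed.

Lemma measurable_sinT d (T : measurableType d) (f : T -> R) :
  measurable_fun setT f -> measurable_fun setT (fun x => sin (f x)).
Proof.
apply: (@measurableT_comp _ _ _ _ _ _ (@sin R)).
by apply: continuous_measurable_fun; exact: continuous_sin.
Qed.

Section one_measure.
Context d (T : measurableType d) (mu : {measure set T -> \bar R}).

Lemma integrable_dom (D : set T) (f b : T -> R) : measurable D ->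
  measurable_fun setT f -> mu.-integrable D (EFin \o b) ->
  (forall x, D x -> `|f x| <= b x) -> mu.-integrable D (EFin \o f).
Proof.
move=> mD mf ib fb; apply: le_integrable ib => //.
  by apply/measurable_EFinP; exact: measurable_funTS.
by move=> x Dx /=; rewrite lee_fin (le_trans (fb _ Dx))// ler_norm.
Qed.

Lemma integrable_cst (D : set T) (c : R) : measurable D -> (mu D < +oo)%E ->
  mu.-integrable D (EFin \o (fun=> c)).
Proof.
move=> mD fD; apply: measurable_bounded_integrable => //.
exists `|c|; split; rewrite ?num_real// => x cx y _ /=; exact: ltW.
Qed.

Lemma integrable_bounded (D : set T) (f : T -> R) (c : R) : measurable D ->
  (mu D < +oo)%E -> measurable_fun setT f ->
  (forall x, D x -> `|f x| <= c) -> mu.-integrable D (EFin \o f).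
Proof.
move=> mD fD mf fc; apply: (@integrable_dom _ _ (fun=> c)) => //.
exact: integrable_cst.
Qed.

Lemma Rintegral_norm_le (D : set T) (f b : T -> R) : measurable D ->
  measurable_fun setT f -> mu.-integrable D (EFin \o b) ->
  (forall x, D x -> `|f x| <= b x) ->
  `|\int[mu]_(x in D) f x| <= \int[mu]_(x in D) b x.
Proof.
move=> mD mf ib fb; have ifn := integrable_dom mD mf ib fb.
apply: le_trans (le_normr_Rintegral mD ifn) _.
apply: le_Rintegral => //.
have := integrable_abse ifn; exact.
Qed.

Lemma RintegralN (D : set T) (f : T -> R) : measurable D ->
  mu.-integrable D (EFin \o f) ->
  \int[mu]_(x in D) (- f x) = - \int[mu]_(x in D) f x.
Proof.
move=> mD fi; rewrite -mulN1r -RintegralZl//.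
by apply: eq_Rintegral => x _; rewrite mulN1r.
Qed.

Lemma Rintegral_sum (D : set T) n (f : 'I_n -> T -> R) : measurable D ->
  (forall i, mu.-integrable D (EFin \o f i)) ->
  \int[mu]_(x in D) (\sum_i f i x) = \sum_i \int[mu]_(x in D) f i x.
Proof.
move=> mD; elim: n f => [|n ih] f fi.
  rewrite big_ord0 /Rintegral; under eq_integral do rewrite big_ord0.
  by rewrite integral0.
rewrite big_ord_recr/= -ih//.
rewrite -RintegralD//; first by apply: eq_Rintegral => x _; rewrite big_ord_recr.
rewrite [X in mu.-integrable D X](_ : _ = (fun x =>
  \sum_(i < n) (f (widen_ord (leqnSn n) i) x)%:E)%E); last first.
  by apply/funext => x /=; rewrite sumEFin.
by apply: integrable_sum => // i _; exact: (fi (widen_ord (leqnSn n) i)).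
Qed.

End one_measure.

Section product.
Context d1 d2 (T1 : measurableType d1) (T2 : measurableType d2).
Variables (m1 : {sigma_finite_measure set T1 -> \bar R}).
Variables (m2 : {sigma_finite_measure set T2 -> \bar R}).
Variables (D1 : set T1) (D2 : set T2) (f : T1 * T2 -> R).
Variables (b1 : T1 -> R) (b2 : T2 -> R).
Hypotheses (mD1 : measurable D1) (mD2 : measurable D2).
Hypotheses (mf : measurable_fun setT f).
Hypotheses (ib1 : m1.-integrable D1 (EFin \o b1)).
Hypotheses (ib2 : m2.-integrable D2 (EFin \o b2)).
Hypotheses (fb : forall x y, D1 x -> D2 y -> `|f (x, y)| <= b1 x * b2 y).

(** Extension by zero, which turns integrals over [D1] and [D2] into integrals over the whole
    spaces, where Fubini is available. *)
Let g (z : T1 * T2) : R := f z * (\1_D1 z.1 * \1_D2 z.2).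

Let mg : measurable_fun setT g.
Proof.
apply: measurable_funM => //; apply: measurable_funM.
  exact: measurableT_comp (measurable_indic mD1) measurable_fst.
exact: measurableT_comp (measurable_indic mD2) measurable_snd.
Qed.

Let gE x y : g (x, y) = ((fun y => (fun x => f (x, y)) \_ D1 x) \_ D2) y.
Proof.
rewrite /g /= /patch !indicE; case: (y \in D2); case: (x \in D1);
  by rewrite ?(mulr0, mulr1, mul0r).
Qed.

(** Absolute values are taken because [fb] makes the product [b1 x * b2 y] nonnegative on the two
    domains without making its factors nonnegative. *)
Let integrable_restr d (T : measurableType d) (mu : {measure set T -> \bar R})
  (D : set T) (b : T -> R) : measurable D -> mu.-integrable D (EFin \o b) ->
  mu.-integrable setT (EFin \o (fun x => `|(b \_ D) x|)).
Proof.
move=> mD ib.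
have h : mu.-integrable setT ((EFin \o b) \_ D).
  by apply/integrable_restrict => //; rewrite setTI.
apply: (le_integrable measurableT _ _ h).
  apply/measurable_EFinP; apply: measurableT_comp => //.
  have /measurable_int := h.
  by rewrite restrict_EFin => /measurable_EFinP.
by move=> x _; rewrite restrict_EFin /= normr_id.
Qed.

Let ig : (m1 \x m2)%E.-integrable setT (EFin \o g).
Proof.
apply/integrable12ltyP; first exact/measurable_EFinP.
pose B1 x := `|(b1 \_ D1) x|; pose B2 x := `|(b2 \_ D2) x|.
have iB1 : m1.-integrable setT (EFin \o B1) by exact: integrable_restr.
have iB2 : m2.-integrable setT (EFin \o B2) by exact: integrable_restr.
have gB x y : `|g (x, y)| <= B1 x * B2 y.
  rewrite gE /B1 /B2 /patch.
  case: ifPn => [yD|]; last by rewrite !normr0 mulr0.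
  case: ifPn => [xD|]; last by rewrite !normr0 mul0r.
  rewrite -normrM (le_trans (fb _ _))//; [exact: set_mem..|exact: ler_norm].
have mB2 : measurable_fun setT B2 by exact/measurable_EFinP/(measurable_int _ iB2).
have mB1 : measurable_fun setT B1 by exact/measurable_EFinP/(measurable_int _ iB1).
apply: (@le_lt_trans _ _ (\int[m1]_x ((B1 x)%:E * \int[m2]_y (B2 y)%:E))%E).
  apply: ge0_le_integral => //.
  - by move=> x _; exact: integral_ge0.
  - apply: (measurable_fun_fubini_tonelli_F (fun z => `|(EFin \o g) z|%E)) => //.
    by apply: measurableT_comp => //; exact/measurable_EFinP.
  - by apply: emeasurable_funM => //; exact/measurable_EFinP.
  move=> x _; rewrite -ge0_integralZl//; last 3 first.
  - exact/measurable_EFinP.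
  - by move=> y _; rewrite lee_fin normr_ge0.
  - by rewrite lee_fin normr_ge0.
  apply: ge0_le_integral => //.
  - apply: measurableT_comp => //; apply/measurable_EFinP.
    exact: measurableT_comp mg (measurable_pair1 x).
  - by apply: emeasurable_funM => //; exact/measurable_EFinP.
  by move=> y _; rewrite -EFinM lee_fin.
rewrite ge0_integralZr//; last 3 first.
- exact/measurable_EFinP.
- by move=> x _; rewrite lee_fin normr_ge0.
- by apply: integral_ge0 => y _; rewrite lee_fin normr_ge0.
have h1 := integrable_fin_num measurableT iB1.
have h2 := integrable_fin_num measurableT iB2.
rewrite /comp in h1 h2.
by rewrite -(fineK h1) -(fineK h2) -EFinM ltry.
Qed.

Let int2E x : D1 x -> (\int[m2]_y (g (x, y))%:E = \int[m2]_(y in D2) (f (x, y))%:E)%E.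
Proof.
move=> D1x; rewrite [RHS]integral_mkcond; apply: eq_integral => y _.
by rewrite gE /patch (mem_set D1x); case: ifP.
Qed.

Let int1E y : D2 y -> (\int[m1]_x (g (x, y))%:E = \int[m1]_(x in D1) (f (x, y))%:E)%E.
Proof.
move=> D2y; rewrite [RHS]integral_mkcond; apply: eq_integral => x _.
by rewrite gE /patch (mem_set D2y); case: ifP.
Qed.

Lemma fubini_integrable1 x : D1 x -> m2.-integrable D2 (EFin \o (fun y => f (x, y))).
Proof.
move=> D1x; apply: (@integrable_dom _ _ _ _ _ (fun y => b1 x * b2 y)) => //.
- exact: measurableT_comp mf (measurable_pair1 x).
- have := integrableZl mD2 (b1 x) ib2.
  by apply: eq_integrable => // y _ /=; rewrite EFinM.
- by move=> y; exact: fb.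
Qed.

Lemma fubini_integrable2 y : D2 y -> m1.-integrable D1 (EFin \o (fun x => f (x, y))).
Proof.
move=> D2y; apply: (@integrable_dom _ _ _ _ _ (fun x => b2 y * b1 x)) => //.
- exact: measurableT_comp mf (measurable_pair2 y).
- have := integrableZl mD1 (b2 y) ib1.
  by apply: eq_integrable => // x _ /=; rewrite EFinM.
- by move=> x D1x; rewrite mulrC; exact: fb.
Qed.

Lemma fubini_integrable_outer1 :
  m1.-integrable D1 (EFin \o (fun x => \int[m2]_(y in D2) f (x, y))).
Proof.
have h : m1.-integrable D1 (fubini_F m2 (EFin \o g)).
  apply: (integrableS measurableT) => //; exact: integrable_fubini_F.
apply: eq_integrable h => // x /set_mem D1x /=.
rewrite /fubini_F /= int2E// /Rintegral fineK//.
by apply: integrable_fin_num => //; exact: fubini_integrable1.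
Qed.

Lemma Rfubini : \int[m1]_(x in D1) (\int[m2]_(y in D2) f (x, y)) =
  \int[m2]_(y in D2) (\int[m1]_(x in D1) f (x, y)).
Proof.
have /= F := Fubini ig.
rewrite [LHS]/Rintegral [RHS]/Rintegral; congr fine.
have -> : (\int[m1]_(x in D1) (\int[m2]_(y in D2) f (x, y))%:E =
   \int[m1]_x \int[m2]_y (g (x, y))%:E)%E.
  rewrite integral_mkcond; apply: eq_integral => x _; rewrite /patch.
  case: ifPn => [xD|xD].
    rewrite int2E; last exact: set_mem.
    rewrite /Rintegral fineK// integrable_fin_num//.
    by apply: fubini_integrable1; exact: set_mem.
  by under eq_integral do rewrite /g /= indicE (negbTE xD) mul0r mulr0; rewrite integral0.
rewrite F integral_mkcond; apply: eq_integral => x _; rewrite /patch.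
case: ifPn => [xD|xD].
  rewrite int1E; last exact: set_mem.
  rewrite /Rintegral fineK// integrable_fin_num//.
  by apply: fubini_integrable2; exact: set_mem.
by under eq_integral do rewrite /g /= (indicE _ D2) (negbTE xD) mulr0 mulr0; rewrite integral0.
Qed.

End product.
End real_integrals.

Section complex_integral.
Context {R : realType}.

Definition cmeas d (T : measurableType d) (f : T -> R[i]) :=
  measurable_fun setT (fun x => Re (f x)) /\
  measurable_fun setT (fun x => Im (f x)).

Section cmeas_theory.
Context d (T : measurableType d).
Implicit Types f g : T -> R[i].

Lemma cmeas_cst c : cmeas (fun _ : T => c).
Proof. by split; exact: measurable_cst. Qed.

Lemma cmeas_real (f : T -> R) : measurable_fun setT f -> cmeas (fun x => (f x)%:C).
Proof. by move=> mf; split => //=; exact: measurable_cst. Qed.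

Lemma cmeasD f g : cmeas f -> cmeas g -> cmeas (fun x => f x + g x).
Proof.
move=> [fr fi] [gr gi]; split.
  by under eq_fun do rewrite ReD; exact: measurable_funD.
by under eq_fun do rewrite ImD; exact: measurable_funD.
Qed.

Lemma cmeasN f : cmeas f -> cmeas (fun x => - f x).
Proof.
move=> [fr fi]; split.
  by under eq_fun do rewrite ReN; exact: measurableT_comp.
by under eq_fun do rewrite ImN; exact: measurableT_comp.
Qed.

Lemma cmeasB f g : cmeas f -> cmeas g -> cmeas (fun x => f x - g x).
Proof. by move=> mf mg; apply: cmeasD => //; exact: cmeasN. Qed.

Lemma cmeasM f g : cmeas f -> cmeas g -> cmeas (fun x => f x * g x).
Proof.
move=> [fr fi] [gr gi]; split.
  by under eq_fun do rewrite ReM; apply: measurable_funB; exact: measurable_funM.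
by under eq_fun do rewrite ImM; apply: measurable_funD; exact: measurable_funM.
Qed.

Lemma cmeasV f : cmeas f -> cmeas (fun x => (f x)^-1).
Proof.
move=> [fr fi].
have mq : measurable_fun setT (fun x => (Re (f x) ^+ 2 + Im (f x) ^+ 2)^-1).
  by apply: measurable_funV; apply: measurable_funD; exact: measurable_funX.
split.
  by under eq_fun do rewrite ReV; exact: measurable_funM.
by under eq_fun do rewrite ImV; apply: measurableT_comp => //; exact: measurable_funM.
Qed.

Lemma cmeas_exp f : cmeas f -> cmeas (fun x => cexp (f x)).
Proof.
move=> [fr fi].
have mexp : measurable_fun setT (fun x => expR (Re (f x))).
  exact: (measurableT_comp (@measurable_expR R) fr).
split => /=; apply: measurable_funM => //.
- exact: measurable_cosT.
- exact: measurable_sinT.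
Qed.

End cmeas_theory.

Lemma cmeas_comp d d' (T : measurableType d) (T' : measurableType d')
  (f : T' -> R[i]) (g : T -> T') : measurable_fun setT g -> cmeas f ->
  cmeas (fun x => f (g x)).
Proof. by move=> mg [fr fi]; split; [exact: measurableT_comp fr mg|exact: measurableT_comp fi mg]. Qed.

Section one_measure.
Context d (T : measurableType d) (mu : {measure set T -> \bar R}).
Implicit Types (D : set T) (f g : T -> R[i]).

Definition cintegrable D f :=
  mu.-integrable D (EFin \o (fun x => Re (f x))) /\
  mu.-integrable D (EFin \o (fun x => Im (f x))).

Definition cint D f : R[i] :=
  (\int[mu]_(x in D) Re (f x)) +i* (\int[mu]_(x in D) Im (f x)).

Lemma cintegrable_dom D f (b : T -> R) : measurable D -> cmeas f ->
  mu.-integrable D (EFin \o b) -> (forall x, D x -> n1 (f x) <= b x) ->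
  cintegrable D f.
Proof.
move=> mD [fr fi] ib fb; split; apply: (integrable_dom mD _ ib) => // x Dx;
  apply: le_trans (fb _ Dx); [exact: Re_le_n1|exact: Im_le_n1].
Qed.

Lemma cint_real D (f : T -> R) : cint D (fun x => (f x)%:C) = (\int[mu]_(x in D) f x)%:C.
Proof.
rewrite /cint /=; congr (_ +i* _); rewrite /Rintegral.
by under eq_integral do [rewrite (_ : 0%R%:E = 0%E)//]; rewrite integral0.
Qed.

Lemma eq_cint D f g : (forall x, D x -> f x = g x) -> cint D f = cint D g.
Proof.
by move=> fg; rewrite /cint; congr (_ +i* _); apply: eq_Rintegral => x /set_mem Dx;
  rewrite fg.
Qed.

Lemma eq_cintegrable D f g : measurable D ->
  (forall x, D x -> f x = g x) -> cintegrable D f -> cintegrable D g.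
Proof.
move=> mD fg [fr fi]; split; [apply: eq_integrable fr|apply: eq_integrable fi] => //;
by move=> x /set_mem Dx /=; rewrite fg.
Qed.

Lemma cintegrableD D f g : measurable D -> cintegrable D f -> cintegrable D g ->
  cintegrable D (fun x => f x + g x).
Proof.
move=> mD [fr fi] [gr gi]; split.
  have := integrableD mD fr gr; apply: eq_integrable => // x _ /=.
  by rewrite ReD.
have := integrableD mD fi gi; apply: eq_integrable => // x _ /=.
by rewrite ImD.
Qed.

Lemma cintD D f g : measurable D -> cintegrable D f -> cintegrable D g ->
  cint D (fun x => f x + g x) = cint D f + cint D g.
Proof.
move=> mD [fr fi] [gr gi]; apply: eqC; rewrite ?ReD ?ImD /= -RintegralD//.
  by apply: eq_Rintegral => x _; rewrite ReD.
by apply: eq_Rintegral => x _; rewrite ImD.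
Qed.

Lemma Rintegrable_lin D (a b : R) (f g : T -> R) : measurable D ->
  mu.-integrable D (EFin \o f) -> mu.-integrable D (EFin \o g) ->
  mu.-integrable D (EFin \o (fun x => a * f x + b * g x)).
Proof.
move=> mD fi gi; have := integrableD mD (integrableZl mD a fi) (integrableZl mD b gi).
by apply: eq_integrable.
Qed.

Lemma Rintegral_lin D (a b : R) (f g : T -> R) : measurable D ->
  mu.-integrable D (EFin \o f) -> mu.-integrable D (EFin \o g) ->
  \int[mu]_(x in D) (a * f x + b * g x) =
  a * \int[mu]_(x in D) f x + b * \int[mu]_(x in D) g x.
Proof.
move=> mD fi gi; rewrite -!RintegralZl// -RintegralD//.
  by have := integrableZl mD a fi; apply: eq_integrable.
by have := integrableZl mD b gi; apply: eq_integrable.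
Qed.

Lemma cintegrableZ D (c : R[i]) f : measurable D -> cintegrable D f ->
  cintegrable D (fun x => c * f x).
Proof.
move=> mD [fr fi]; split.
  apply: eq_integrable (Rintegrable_lin (Re c) (- Im c) mD fr fi) => //.
  by move=> x _ /=; rewrite ReM mulNr.
apply: eq_integrable (Rintegrable_lin (Re c) (Im c) mD fi fr) => //.
by move=> x _ /=; rewrite ImM.
Qed.

Lemma cintZ D (c : R[i]) f : measurable D -> cintegrable D f ->
  cint D (fun x => c * f x) = c * cint D f.
Proof.
move=> mD [fr fi]; apply: eqC; rewrite ?ReM ?ImM /=.
  rewrite -mulNr -Rintegral_lin//.
  by apply: eq_Rintegral => x _; rewrite ReM mulNr.
rewrite -Rintegral_lin//.
by apply: eq_Rintegral => x _; rewrite ImM.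
Qed.

Lemma cintegrableN D f : measurable D -> cintegrable D f ->
  cintegrable D (fun x => - f x).
Proof.
move=> mD fi; apply: eq_cintegrable (cintegrableZ (-1) mD fi) => // x _.
by rewrite mulN1r.
Qed.

Lemma cintN D f : measurable D -> cintegrable D f ->
  cint D (fun x => - f x) = - cint D f.
Proof.
move=> mD fi; rewrite -mulN1r -cintZ//; apply: eq_cint => x _.
by rewrite mulN1r.
Qed.

Lemma cintB D f g : measurable D -> cintegrable D f -> cintegrable D g ->
  cint D (fun x => f x - g x) = cint D f - cint D g.
Proof.
by move=> mD fi gi; rewrite -cintN// -cintD//; exact: cintegrableN.
Qed.

Lemma cint_sum D n (f : 'I_n -> T -> R[i]) : measurable D ->
  (forall i, cintegrable D (f i)) ->
  cint D (fun x => \sum_i f i x) = \sum_i cint D (f i).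
Proof.
move=> mD fi; apply: eqC; rewrite ?Re_sum ?Im_sum /= -Rintegral_sum//.
- by apply: eq_Rintegral => x _; rewrite Re_sum.
- by move=> i; exact: (fi i).1.
- by apply: eq_Rintegral => x _; rewrite Im_sum.
- by move=> i; exact: (fi i).2.
Qed.

Lemma n1_cint_le D f (b : T -> R) : measurable D -> cmeas f ->
  mu.-integrable D (EFin \o b) -> (forall x, D x -> n1 (f x) <= b x) ->
  n1 (cint D f) <= 2 * \int[mu]_(x in D) b x.
Proof.
move=> mD [fr fi] ib fb; rewrite /n1 /= mulr_natl mulr2n.
apply: lerD; apply: Rintegral_norm_le => // x Dx; apply: le_trans (fb _ Dx).
  exact: Re_le_n1.
exact: Im_le_n1.
Qed.

End one_measure.

Section product.
Context d1 d2 (T1 : measurableType d1) (T2 : measurableType d2).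
Variables (m1 : {sigma_finite_measure set T1 -> \bar R}).
Variables (m2 : {sigma_finite_measure set T2 -> \bar R}).
Variables (D1 : set T1) (D2 : set T2) (f : T1 * T2 -> R[i]).
Variables (b1 : T1 -> R) (b2 : T2 -> R).
Hypotheses (mD1 : measurable D1) (mD2 : measurable D2).
Hypotheses (mf : cmeas f).
Hypotheses (ib1 : m1.-integrable D1 (EFin \o b1)).
Hypotheses (ib2 : m2.-integrable D2 (EFin \o b2)).
Hypotheses (fb : forall x y, D1 x -> D2 y -> n1 (f (x, y)) <= b1 x * b2 y).

Let br x y : D1 x -> D2 y -> `|Re (f (x, y))| <= b1 x * b2 y.
Proof. by move=> h k; apply: le_trans (fb h k); exact: Re_le_n1. Qed.
Let bi x y : D1 x -> D2 y -> `|Im (f (x, y))| <= b1 x * b2 y.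
Proof. by move=> h k; apply: le_trans (fb h k); exact: Im_le_n1. Qed.

Lemma cfubini : cint m1 D1 (fun x => cint m2 D2 (fun y => f (x, y))) =
  cint m2 D2 (fun y => cint m1 D1 (fun x => f (x, y))).
Proof.
rewrite /cint /=; congr (_ +i* _).
  exact: (Rfubini mD1 mD2 mf.1 ib1 ib2 br).
exact: (Rfubini mD1 mD2 mf.2 ib1 ib2 bi).
Qed.

Lemma cfubini_integrable :
  cintegrable m1 D1 (fun x => cint m2 D2 (fun y => f (x, y))).
Proof.
split; rewrite /cint /=.
  exact: (fubini_integrable_outer1 mD1 mD2 mf.1 ib1 ib2 br).
exact: (fubini_integrable_outer1 mD1 mD2 mf.2 ib1 ib2 bi).
Qed.

End product.
End complex_integral.

(** * The fundamental theorem of calculus for piecewise C1 functions *)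

Section piecewise_real.
Context {R : realType}.
Notation mu := (@lebesgue_measure R).

Section C1_piece.
Variables (a b : R) (f g : R -> R).
Hypotheses (ab : a < b) (dg : forall x : R, derivable g x 1).
Hypotheses (cg : continuous (derive1 g)) (fg : forall x : R, a <= x <= b -> f x = g x).

Lemma C1_der x : der g x (derive1 g x).
Proof. by apply: DeriveDef; rewrite ?derive1E. Qed.

Lemma C1_near x : x \in `]a, b[ -> \forall t \near x, f t = g t.
Proof.
move=> xab; have := near_in_itvoo xab; apply: filterS => t.
by rewrite in_itv/= => /andP[/ltW at_ /ltW tb]; apply: fg; rewrite at_.
Qed.

Lemma C1_piece_der x : x \in `]a, b[ -> der f x (derive1 g x).
Proof.
move=> xab; apply: (@der_near _ g); last exact: C1_der.
by apply: filterS (C1_near xab) => t ->.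
Qed.

Lemma C1_piece_derE x : x \in `]a, b[ -> derive1 f x = derive1 g x.
Proof.
by move=> /C1_piece_der[_ h]; rewrite derive1E h.
Qed.

Lemma C1_piece_cont : {within `[a, b], continuous f}.
Proof.
apply: (@subspace_eq_continuous _ _ _ g).
  by move=> x /set_mem /=; rewrite in_itv/= => /fg; first [exact|move=> ->].
apply: continuous_subspaceT => x; exact: der_cont (C1_der x).
Qed.

Lemma C1_piece_meas : measurable_fun `]a, b[ (derive1 f).
Proof.
apply: (@eq_measurable_fun _ _ _ _ _ (derive1 g)).
  by move=> x /set_mem xab; rewrite C1_piece_derE.
by apply: measurable_funTS; exact: continuous_measurable_fun.
Qed.

Lemma C1_piece_bounded : exists M, forall x, x \in `]a, b[ -> `|derive1 f x| <= M.
Proof.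
have ch : {within `[a, b], continuous (fun x => `|derive1 g x|)}.
  apply: continuous_subspaceT => x; apply: continuous_comp; first exact: cg.
  exact: norm_continuous.
have [c _ cmax] := EVT_max (ltW ab) ch.
exists `|derive1 g c| => x xab; rewrite C1_piece_derE//; apply: cmax.
exact: subset_itv_oo_cc.
Qed.

End C1_piece.

(** One component of [piecewise_C1], with a free right end [t n] in place of 1: this is what permits
    induction on the number of pieces. *)
Definition pieces (f : R -> R) (t : nat -> R) (n : nat) :=
  t 0%N = 0 /\ forall k, (k < n)%N -> t k < t k.+1 /\ C1_on (t k) (t k.+1) f.

Lemma pieces_le f t n : pieces f t n -> 0 <= t n.
Proof.
elim: n => [[-> _]//|n ih] [t0 h]; have [h1 _] := h n (ltnSn n).
apply: le_trans (ltW h1); apply: ih; split => // k kn; apply: h.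
exact: ltnW.
Qed.

Lemma pieces_prev f t n : pieces f t n.+1 -> pieces f t n.
Proof. by move=> [t0 h]; split => // k kn; apply: h; exact: ltnW. Qed.

Lemma itvcc_split (a b c : R) : a <= b -> b <= c ->
  `[a, c]%classic = `[a, b]%classic `|` `[b, c]%classic.
Proof.
move=> ab bc; apply/seteqP; split => x /=; rewrite !in_itv/=.
  by move=> /andP[ax xc]; case: (leP x b) => h; [left|right];
     rewrite ?ax ?h ?xc// (ltW h).
by case => /andP[h k]; rewrite ?h ?k ?andbT//; [exact: le_trans bc|exact: le_trans h].
Qed.

Lemma pieces_cont f t n : pieces f t n -> {within `[0, t n], continuous f}.
Proof.
elim: n => [|n ih] h; first by rewrite h.1 set_itv1; exact: continuous_subspace1.
have h' := pieces_prev h; have [tn [g [dg cg fg]]] := h.2 n (ltnSn n).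
rewrite (itvcc_split (pieces_le h') (ltW tn)).
apply: withinU_continuous; [exact: interval_closed|exact: interval_closed|exact: ih|].
exact: C1_piece_cont dg fg.
Qed.

(** The point [c] is isolated because the derivative of a piecewise C1 function is arbitrary at a
    break point; the break point [b] already belongs to the previous pieces. *)
Lemma itvcc_split_oo (a b c : R) : a <= b -> b < c ->
  `[a, c]%classic = `[a, b]%classic `|` (`]b, c[%classic `|` [set c]).
Proof.
move=> ab bc; apply/seteqP; split => x /=; rewrite !in_itv/=.
  move=> /andP[ax xc]; case: (leP x b) => h; first by left; rewrite ax.
  by right; move: xc; rewrite le_eqVlt => /predU1P[->|->]; [right|left].
case => [/andP[h k]|[/andP[h k]|->]].
- by rewrite h (le_trans k (ltW bc)).
- by rewrite (ltW k) andbT (le_trans ab (ltW h)).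
- by rewrite lexx andbT (le_trans ab (ltW bc)).
Qed.

Lemma pieces_meas f t n : pieces f t n -> measurable_fun `[0, t n] (derive1 f).
Proof.
elim: n => [|n ih] h; first by rewrite h.1 set_itv1; exact: measurable_fun_set1.
have h' := pieces_prev h; have [tn [g [dg cg fg]]] := h.2 n (ltnSn n).
rewrite (itvcc_split_oo (pieces_le h') tn).
apply/measurable_funU => //; first exact: measurableU.
split; first exact: ih.
apply/measurable_funU => //; split; first exact: C1_piece_meas dg cg fg.
exact: measurable_fun_set1.
Qed.

Lemma pieces_bounded f t n : pieces f t n ->
  exists M, forall x, x \in `[0, t n] -> `|derive1 f x| <= M.
Proof.
elim: n => [|n ih] h.
  exists `|derive1 f 0| => x; rewrite h.1 in_itv/= => /andP[x0 x1].
  by have -> : x = 0 by apply/le_anti; rewrite x0 x1.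
have h' := pieces_prev h; have [tn [g [dg cg fg]]] := h.2 n (ltnSn n).
have [M1 hM1] := ih h'; have [M2 hM2] := C1_piece_bounded tn dg cg fg.
exists (`|M1| + `|M2| + `|derive1 f (t n.+1)|) => x xin.
have : `[0, t n.+1]%classic x by exact: xin.
rewrite (itvcc_split_oo (pieces_le h') tn) => -[|[|]] /= hx.
- apply: le_trans (hM1 x hx) _; apply: le_trans (ler_norm _) _.
  by rewrite -addrA lerDl addr_ge0.
- apply: le_trans (hM2 x hx) _; apply: le_trans (ler_norm _) _.
  by rewrite addrAC lerDr addr_ge0.
- by rewrite hx lerDr addr_ge0.
Qed.

(** On each open piece [psi] agrees with a function [p] continuous up to the ends, so the classical
    theorem applies to [p], and the break points form a null set. Continuity of [phi] on the whole
    interval makes the increments telescope. *)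
Lemma FTC_pieces (phi psi : R -> R) t n :
  t 0%N = 0 -> (forall k, (k < n)%N -> t k < t k.+1) ->
  {within `[0, t n], continuous phi} ->
  mu.-integrable `[0, t n] (EFin \o psi) ->
  (forall k, (k < n)%N -> exists2 p,
     {within `[t k, t k.+1], continuous p} &
     forall u, u \in `]t k, t k.+1[ -> der phi u (p u) /\ psi u = p u) ->
  \int[mu]_(u in `[0, t n]) psi u = phi (t n) - phi 0.
Proof.
move=> t0; elim: n => [|n ih] ht cphi ipsi hp.
  by rewrite t0 set_itv1 Rintegral_set1 subrr.
have tn := ht n (ltnSn n).
have tn0 : 0 <= t n.
  suff : forall m, (m <= n)%N -> 0 <= t m by apply.
  elim => [|m ihm] mn; first by rewrite t0.
  by apply: le_trans (ihm (ltnW mn)) _; apply/ltW/ht; exact: ltnW.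
have s1 : `[0, t n]%classic `<=` `[0, t n.+1]%classic.
  by rewrite (itvcc_split tn0 (ltW tn)); left.
have s2 : `[t n, t n.+1]%classic `<=` `[0, t n.+1]%classic.
  by rewrite (itvcc_split tn0 (ltW tn)); right.
have := Rintegral_itvB (x := t n) ipsi.
rewrite !bnd_simp => /(_ tn0 (ltW tn)).
rewrite ih; last 4 first.
- by move=> k kn; apply: ht; exact: ltnW.
- exact: continuous_subspaceW cphi.
- exact: integrableS ipsi.
- by move=> k kn; apply: hp; exact: ltnW.
have {hp} [p cp hp] := hp n (ltnSn n).
suff -> : \int[mu]_(u in `]t n, t n.+1]) psi u = phi (t n.+1) - phi (t n).
  by move=> e; apply: (addIr (- (phi (t n) - phi 0))); rewrite e; ring.
have i1 : mu.-integrable `]t n, t n.+1] (EFin \o psi).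
  by apply: integrableS ipsi => //; apply: subset_trans s2; exact: subset_itv_oc_cc.
rewrite Rintegral_itv_obnd_cbnd//.
have F := @continuous_FTC2 R p phi (t n) (t n.+1) tn cp.
have i2 : mu.-integrable `[t n, t n.+1] (EFin \o p).
  by apply: continuous_compact_integrable => //; exact: segment_compact.
transitivity (\int[mu]_(u in `[t n, t n.+1]) p u); last first.
  rewrite /Rintegral F//; last first.
    move=> u ut; have [[_ h] _] := hp u ut; by rewrite derive1E h.
  have := continuous_subspaceW s2 cphi.
  move/(continuous_within_itvP _ tn) => [_ c1 c2]; split => // u ut.
  by have [[]] := hp u ut.
have i3 : mu.-integrable `[t n, t n.+1] (EFin \o psi) by exact: integrableS ipsi.
rewrite -!(Rintegral_itv_bndo_bndc) -?Rintegral_itv_obnd_cbnd.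
- by apply: eq_Rintegral => u /set_mem ut; have [] := hp u ut.
- by apply: integrableS i2 => //; exact: subset_itv_oo_cc.
- by apply: integrableS i3 => //; exact: subset_itv_oo_cc.
- by apply: integrableS i2 => //; exact: subset_itv_co_cc.
- by apply: integrableS i3 => //; exact: subset_itv_co_cc.
Qed.

End piecewise_real.

(** * Integrals along piecewise smooth paths *)

Section complex_continuity.
Context {R : realType}.
Implicit Types (A : set R) (f g : R -> R[i]).

Definition ccont A f :=
  {within A, continuous (fun u => Re (f u))} /\
  {within A, continuous (fun u => Im (f u))}.

Lemma ccont_cst A c : ccont A (fun=> c).
Proof. by split; move=> x; exact: cvg_cst. Qed.

Lemma within_continuousD A (f g : R -> R) : {within A, continuous f} ->
  {within A, continuous g} -> {within A, continuous (fun x => f x + g x)}.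
Proof. by move=> cf cg x; apply: cvgD; [exact: cf|exact: cg]. Qed.

Lemma within_continuousM A (f g : R -> R) : {within A, continuous f} ->
  {within A, continuous g} -> {within A, continuous (fun x => f x * g x)}.
Proof. by move=> cf cg x; apply: cvgM; [exact: cf|exact: cg]. Qed.

Lemma within_continuousN A (f : R -> R) : {within A, continuous f} ->
  {within A, continuous (fun x => - f x)}.
Proof. by move=> cf x; apply: cvgN; exact: cf. Qed.

Lemma within_continuousB A (f g : R -> R) : {within A, continuous f} ->
  {within A, continuous g} -> {within A, continuous (fun x => f x - g x)}.
Proof. by move=> cf cg; apply: within_continuousD => //; exact: within_continuousN. Qed.

Lemma within_continuous_comp A (f h : R -> R) : {within A, continuous f} ->
  (forall x, A x -> {for f x, continuous h}) ->
  {within A, continuous (fun x => h (f x))}.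
Proof.
move=> cf ch; apply/subspace_continuousP => x Ax.
move/subspace_continuousP : cf => /(_ x Ax) cf.
apply: (cvg_comp _ _ cf); exact: ch.
Qed.

Lemma ccontD A f g : ccont A f -> ccont A g -> ccont A (fun u => f u + g u).
Proof.
move=> [fr fi] [gr gi]; split.
  by under [X in {within _, continuous X}]eq_fun do rewrite ReD; exact: within_continuousD.
by under [X in {within _, continuous X}]eq_fun do rewrite ImD; exact: within_continuousD.
Qed.

Lemma ccontN A f : ccont A f -> ccont A (fun u => - f u).
Proof.
move=> [fr fi]; split.
  by under [X in {within _, continuous X}]eq_fun do rewrite ReN; exact: within_continuousN.
by under [X in {within _, continuous X}]eq_fun do rewrite ImN; exact: within_continuousN.
Qed.

Lemma ccontB A f g : ccont A f -> ccont A g -> ccont A (fun u => f u - g u).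
Proof. by move=> cf cg; apply: ccontD => //; exact: ccontN. Qed.

Lemma ccontM A f g : ccont A f -> ccont A g -> ccont A (fun u => f u * g u).
Proof.
move=> [fr fi] [gr gi]; split.
  by under [X in {within _, continuous X}]eq_fun do rewrite ReM;
     apply: within_continuousB; exact: within_continuousM.
by under [X in {within _, continuous X}]eq_fun do rewrite ImM;
   apply: within_continuousD; exact: within_continuousM.
Qed.

Lemma ccontV A f : (forall u, A u -> f u != 0) -> ccont A f ->
  ccont A (fun u => (f u)^-1).
Proof.
move=> f0 [fr fi].
have cq : {within A, continuous (fun u => (Re (f u) * Re (f u) + Im (f u) * Im (f u))^-1)}.
  apply: (@within_continuous_comp A _ (fun x => x^-1)).
    by apply: within_continuousD; exact: within_continuousM.
  move=> x Ax; apply: inv_continuous; rewrite -!expr2 gt_eqF//.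
  exact: sqn_gt0 (f0 x Ax).
split.
  under [X in {within _, continuous X}]eq_fun do rewrite ReV !expr2.
  exact: within_continuousM.
under [X in {within _, continuous X}]eq_fun do rewrite ImV !expr2.
by apply: within_continuousN; exact: within_continuousM.
Qed.

Lemma ccont_exp A f : ccont A f -> ccont A (fun u => cexp (f u)).
Proof.
move=> [fr fi]; split => /=; apply: within_continuousM;
  apply: within_continuous_comp => // x _.
- exact: continuous_expR.
- exact: continuous_cos.
- exact: continuous_expR.
- exact: continuous_sin.
Qed.

Lemma ccont_prod A (s : seq R[i]) (F : R[i] -> R -> R[i]) :
  (forall l, l \in s -> ccont A (F l)) -> ccont A (fun u => \prod_(l <- s) F l u).
Proof.
elim: s => [|a s ih] h.
  by under eq_fun do rewrite big_nil; exact: ccont_cst.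
under eq_fun do rewrite big_cons/=.
apply: ccontM; first by apply: h; rewrite mem_head.
by apply: ih => l ls; apply: h; rewrite in_cons ls orbT.
Qed.

Lemma ccont_bounded a b f : a <= b -> ccont `[a, b] f ->
  exists2 M, 0 <= M & forall u, a <= u <= b -> n1 (f u) <= M.
Proof.
move=> ab [fr fi].
have ch : {within `[a, b], continuous (fun u => n1 (f u))}.
  apply: within_continuousD; apply: (@within_continuous_comp _ _ (@Num.norm R R)) => // x _;
  exact: norm_continuous.
have [c _ cmax] := EVT_max ab ch.
by exists (n1 (f c)) => [|u uab]; [exact: n1_ge0|apply: cmax; rewrite in_itv/=].
Qed.

End complex_continuity.

Section paths.
Context {R : realType}.
Notation mu := (@lebesgue_measure R).
Notation I01 := (`[0, 1]%classic : set R).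
Variable gamma : R -> R[i].
Hypothesis hg : piecewise_C1 gamma.

(** Outside the unit interval the path is continued by one of its own points, so that a function
    defined only on the path can be composed with it on the whole line; [path_derive0] vanishes
    there. Both are measurable on the whole line, as product measures require. *)
Definition path_ext (u : R) : R[i] := if 0 <= u <= 1 then gamma u else gamma 0.
Definition path_derive0 (u : R) : R[i] := if 0 <= u <= 1 then path_derive gamma u else 0.

Lemma path_extE u : 0 <= u <= 1 -> path_ext u = gamma u.
Proof. by rewrite /path_ext => ->. Qed.

Lemma contourE f : contour_integral gamma f =
  cint mu I01 (fun u => f (path_ext u) * path_derive0 u).
Proof.
rewrite /contour_integral /cint /=; congr (_ +i* _); apply: eq_Rintegral => u /set_mem /=;
by rewrite in_itv /= /path_ext /path_derive0 => ->.
Qed.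

Lemma ccont_path : ccont I01 gamma.
Proof.
have [n [t [t0 t1 h]]] := hg; rewrite -t1; split.
  by apply: pieces_cont; split => // k kn; have [h1 h2 h3] := h k kn.
by apply: pieces_cont; split => // k kn; have [h1 h2 h3] := h k kn.
Qed.

Lemma measurable_on01 (f : R -> R) (a : R) : measurable_fun I01 f ->
  measurable_fun setT (fun u : R => if 0 <= u <= 1 then f u else a).
Proof.
move=> mf.
have -> : (fun u : R => if 0 <= u <= 1 then f u else a) =
    (fun u => ((fun u => f u) \_ I01) u + ((fun=> a) \_ (~` I01)) u).
  apply/funext => u; rewrite /patch.
  have [h|h] := boolP (0 <= u <= 1).
    by rewrite ifT ?inE/= ?in_itv//= ifF ?addr0//; apply/negP => /set_mem; apply; rewrite /= in_itv.
  rewrite ifF ?add0r; last by apply/negP => /set_mem; rewrite /= in_itv/=; exact/negP.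
  by rewrite ifT// inE /= in_itv/=; exact/negP.
apply: measurable_funD.
  by apply/(measurable_restrict _ _ _) => //; rewrite setTI.
apply/(measurable_restrict _ _ _) => //; exact: measurableC.
Qed.

Lemma cmeas_path_ext : cmeas path_ext.
Proof.
have [cr ci] := ccont_path.
have mr : measurable_fun I01 (fun u => Re (gamma u)).
  by apply: subspace_continuous_measurable_fun.
have mi : measurable_fun I01 (fun u => Im (gamma u)).
  by apply: subspace_continuous_measurable_fun.
split.
  have := measurable_on01 (Re (gamma 0)) mr; congr measurable_fun.
  by apply/funext => u; rewrite /path_ext; case: ifP.
have := measurable_on01 (Im (gamma 0)) mi; congr measurable_fun.
by apply/funext => u; rewrite /path_ext; case: ifP.
Qed.

Lemma cmeas_path_derive0 : cmeas path_derive0.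
Proof.
have [n [t [t0 t1 h]]] := hg.
have mr : measurable_fun I01 (fun u => Re (path_derive gamma u)).
  rewrite -t1; apply: pieces_meas; split => // k kn; by have [h1 h2 h3] := h k kn.
have mi : measurable_fun I01 (fun u => Im (path_derive gamma u)).
  rewrite -t1; apply: pieces_meas; split => // k kn; by have [h1 h2 h3] := h k kn.
split.
  have := measurable_on01 0 mr; congr measurable_fun.
  by apply/funext => u; rewrite /path_derive0; case: ifP.
have := measurable_on01 0 mi; congr measurable_fun.
by apply/funext => u; rewrite /path_derive0; case: ifP.
Qed.

Lemma path_derive0_bounded : exists2 L, 0 <= L & forall u, n1 (path_derive0 u) <= L.
Proof.
have [n [t [t0 t1 h]]] := hg.
have [M1 h1] : exists M, forall x, x \in `[0, t n] -> `|derive1 (fun u => Re (gamma u)) x| <= M.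
  by apply: pieces_bounded; split => // k kn; have [? ? ?] := h k kn.
have [M2 h2] : exists M, forall x, x \in `[0, t n] -> `|derive1 (fun u => Im (gamma u)) x| <= M.
  by apply: pieces_bounded; split => // k kn; have [? ? ?] := h k kn.
rewrite t1 in h1 h2.
have M10 : 0 <= M1.
  by apply: le_trans (h1 0 _); rewrite ?normr_ge0// in_itv/= lexx ler01.
have M20 : 0 <= M2.
  by apply: le_trans (h2 0 _); rewrite ?normr_ge0// in_itv/= lexx ler01.
exists (M1 + M2) => [|u]; first exact: addr_ge0.
rewrite /path_derive0; case: ifPn => [u01|_]; last by rewrite /n1 /= normr0 addr0 addr_ge0.
by apply: lerD; [apply: h1|apply: h2]; rewrite in_itv.
Qed.

Lemma mu01 : mu I01 = 1%E.
Proof. by rewrite lebesgue_measure_itv/= lte_fin ltr01 oppr0 adde0. Qed.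

Lemma mu01_fin : (mu I01 < +oo)%E.
Proof. by rewrite mu01 ltry. Qed.

Let integrable_cst01 c : mu.-integrable I01 (EFin \o (fun=> c)).
Proof. by apply: integrable_cst => //; exact: mu01_fin. Qed.

Lemma cmeas_ccont f : ccont I01 (fun u => f (gamma u)) -> cmeas (fun u => f (path_ext u)).
Proof.
move=> [cr ci].
have mr : measurable_fun I01 (fun u => Re (f (gamma u))).
  by apply: subspace_continuous_measurable_fun.
have mi : measurable_fun I01 (fun u => Im (f (gamma u))).
  by apply: subspace_continuous_measurable_fun.
split.
  have := measurable_on01 (Re (f (gamma 0))) mr; congr measurable_fun.
  by apply/funext => u; rewrite /path_ext; case: ifP.
have := measurable_on01 (Im (f (gamma 0))) mi; congr measurable_fun.
by apply/funext => u; rewrite /path_ext; case: ifP.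
Qed.

Lemma contour_integrable_bounded f B : cmeas (fun u => f (path_ext u)) ->
  (forall u, 0 <= u <= 1 -> n1 (f (gamma u)) <= B) ->
  cintegrable mu I01 (fun u => f (path_ext u) * path_derive0 u).
Proof.
move=> mf fB; have [L L0 hL] := path_derive0_bounded.
apply: (@cintegrable_dom _ _ _ _ _ _ (fun=> B * L)) => //.
- exact: cmeasM mf cmeas_path_derive0.
- move=> u /=; rewrite in_itv/= => u01; apply: le_trans (n1M _ _) _.
  by apply: ler_pM; rewrite ?n1_ge0// path_extE// fB.
Qed.

Lemma contour_integrable f : ccont I01 (fun u => f (gamma u)) ->
  cintegrable mu I01 (fun u => f (path_ext u) * path_derive0 u).
Proof.
move=> cf; have [M _ hM] := ccont_bounded ler01 cf.
by apply: contour_integrable_bounded hM; exact: cmeas_ccont.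
Qed.

(** The usual estimate of a contour integral. The constant depends on the path alone, which allows
    families of integrands on one contour to be compared. *)
Lemma contour_le : exists2 C, 0 <= C & forall f B, cmeas (fun u => f (path_ext u)) ->
  (forall u, 0 <= u <= 1 -> n1 (f (gamma u)) <= B) ->
  n1 (contour_integral gamma f) <= C * B.
Proof.
have [L L0 hL] := path_derive0_bounded.
exists (2 * L); first exact: mulr_ge0.
move=> f B mf fB; rewrite contourE.
apply: le_trans (n1_cint_le (b := fun=> B * L) _ _ _ _) _ => //.
- exact: cmeasM mf cmeas_path_derive0.
- move=> u /=; rewrite in_itv/= => u01; apply: le_trans (n1M _ _) _.
  by apply: ler_pM; rewrite ?n1_ge0// path_extE// fB.
rewrite Rintegral_cst// (_ : fine _ = 1); last exact: (congr1 fine mu01).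
rewrite mulr1.
by rewrite -mulrA (mulrC L).
Qed.

Lemma eq_contour f g : (forall u, 0 <= u <= 1 -> f (gamma u) = g (gamma u)) ->
  contour_integral gamma f = contour_integral gamma g.
Proof.
move=> fg; rewrite !contourE; apply: eq_cint => u /=; rewrite in_itv/= => u01.
by rewrite path_extE// fg.
Qed.

Lemma contourZ c f : ccont I01 (fun u => f (gamma u)) ->
  contour_integral gamma (fun z => c * f z) = c * contour_integral gamma f.
Proof.
move=> cf; rewrite !contourE -cintZ//; last exact: contour_integrable.
by apply: eq_cint => u _; rewrite mulrA.
Qed.

Lemma contourB f g : ccont I01 (fun u => f (gamma u)) ->
  ccont I01 (fun u => g (gamma u)) ->
  contour_integral gamma (fun z => f z - g z) =
  contour_integral gamma f - contour_integral gamma g.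
Proof.
move=> cf cg; rewrite !contourE -cintB//; [|exact: contour_integrable..].
by apply: eq_cint => u _; rewrite mulrBl.
Qed.

Lemma contour_sum n (f : 'I_n -> R[i] -> R[i]) :
  (forall i, ccont I01 (fun u => f i (gamma u))) ->
  contour_integral gamma (fun z => \sum_i f i z) =
  \sum_i contour_integral gamma (f i).
Proof.
move=> cf; rewrite contourE; under [RHS]eq_bigr do rewrite contourE.
rewrite -cint_sum//; last by move=> i; exact: contour_integrable.
by apply: eq_cint => u _; rewrite mulr_suml.
Qed.

(** Holomorphy of the primitive is replaced by the chain rule along [gamma], asked at the points
    where [gamma] has a derivative [l]; at the break points continuity of [F] along the path does
    the gluing. *)
Lemma contour_deriv (F f : R[i] -> R[i]) :
  ccont I01 (fun u => F (gamma u)) -> ccont I01 (fun u => f (gamma u)) ->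
  (forall u l, 0 < u < 1 -> cder gamma u l ->
    cder (fun v => F (gamma v)) u (f (gamma u) * l)) ->
  contour_integral gamma f = F (gamma 1) - F (gamma 0).
Proof.
move=> [cFr cFi] cf hF.
have [ir ii] := contour_integrable cf.
have [n [t [t0 t1 h]]] := hg.
have tmono : forall k, (k <= n)%N -> 0 <= t k.
  elim => [|k ih] kn; first by rewrite t0.
  by apply: le_trans (ih (ltnW kn)) _; apply: ltW; have [] := h k kn.
have tmono1 : forall k, (k <= n)%N -> t k <= 1.
  move=> k kn; rewrite -t1 -(subnK kn); move: (n - k)%N (subnK kn) => m mkn.
  have : (m + k <= n)%N by rewrite mkn.
  elim: m {mkn} => [//|m ih] mn; rewrite addSn.
  by apply: le_trans (ih _) _; [exact: ltnW|apply: ltW; have [] := h (m + k)%N mn].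
(* On the piece [k] the components of [gamma] coincide with C1 functions [g1], [g2] of the whole
   line; using their derivatives gives an integrand continuous up to both ends. *)
have key k : (k < n)%N -> exists2 p : R -> R[i], ccont `[t k, t k.+1] p &
    forall u, u \in `]t k, t k.+1[ ->
      cder (fun v => F (gamma v)) u (p u) /\ f (path_ext u) * path_derive0 u = p u.
  move=> kn; have [tk [g1 [dg1 cg1 fg1]] [g2 [dg2 cg2 fg2]]] := h k kn.
  have u01 u : u \in `]t k, t k.+1[ -> 0 < u < 1.
    rewrite in_itv/= => /andP[a b]; rewrite (le_lt_trans _ a)/=; last exact/tmono/ltnW.
    exact: lt_le_trans b (tmono1 _ kn).
  exists (fun u => f (gamma u) * (derive1 g1 u +i* derive1 g2 u)).
    apply: ccontM.
      case: cf => a b; split; [apply: continuous_subspaceW a|apply: continuous_subspaceW b];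
      by move=> u /=; rewrite !in_itv/= => /andP[a1 b1];
        rewrite (le_trans _ a1) ?(le_trans b1)//; [exact: tmono1|apply/tmono/ltnW].
    by split; apply: continuous_subspaceT.
  move=> u ut; split.
    apply: hF; first exact: u01.
    split => /=; [exact: C1_piece_der dg1 fg1 u ut|exact: C1_piece_der dg2 fg2 u ut].
  have /andP[/ltW u0 /ltW u1] := u01 u ut.
  rewrite path_extE ?u0 ?u1// /path_derive0 u0 u1/= /path_derive.
  by rewrite (C1_piece_derE dg1 fg1 ut) (C1_piece_derE dg2 fg2 ut).
rewrite contourE; apply: eqC; rewrite ?ReD ?ImD ?ReN ?ImN /=.
  have := @FTC_pieces R (fun u => Re (F (gamma u)))
    (fun u => Re (f (path_ext u) * path_derive0 u)) t n t0; rewrite t1; apply => //.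
    by move=> k kn; have [] := h k kn.
  move=> k kn; have [p [pr pi] hp] := key k kn; exists (fun u => Re (p u)) => // u ut.
  by have [[h1 h2] h3] := hp u ut; rewrite h3.
have := @FTC_pieces R (fun u => Im (F (gamma u)))
  (fun u => Im (f (path_ext u) * path_derive0 u)) t n t0; rewrite t1; apply => //.
  by move=> k kn; have [] := h k kn.
move=> k kn; have [p [pr pi] hp] := key k kn; exists (fun u => Im (p u)) => // u ut.
by have [[h1 h2] h3] := hp u ut; rewrite h3.
Qed.

Section contour_fubini.
Context d (T : measurableType d) (m : {sigma_finite_measure set T -> \bar R}).
Variables (D : set T) (f : T -> R[i] -> R[i]) (b : T -> R).
Hypotheses (mD : measurable D) (mf : cmeas (fun z : T * R => f z.1 (path_ext z.2))).
Hypotheses (ib : m.-integrable D (EFin \o b)).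
Hypothesis fb : forall x u, D x -> 0 <= u <= 1 -> n1 (f x (gamma u)) <= b x.

Let g (z : T * R) := f z.1 (path_ext z.2) * path_derive0 z.2.

Let mg : cmeas g.
Proof.
apply: cmeasM => //; apply: (cmeas_comp (g := snd)); first exact: measurable_snd.
exact: cmeas_path_derive0.
Qed.

Let gb : exists2 L, 0 <= L &
  forall x u, D x -> I01 u -> n1 (g (x, u)) <= b x * L.
Proof.
have [L L0 hL] := path_derive0_bounded; exists L => // x u Dx /=.
rewrite in_itv/= => u01; apply: le_trans (n1M _ _) _.
by apply: ler_pM; rewrite ?n1_ge0//= path_extE// fb.
Qed.

Lemma contour_fubini : contour_integral gamma (fun z => cint m D (fun x => f x z)) =
  cint m D (fun x => contour_integral gamma (f x)).
Proof.
have [L L0 gbL] := gb.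
have := cfubini (m2 := mu) mD (measurable_itv _) mg ib (integrable_cst01 L) gbL.
have -> : cint m D (fun x => cint mu I01 (fun u => g (x, u))) =
   cint m D (fun x => contour_integral gamma (f x)).
  by apply: eq_cint => x Dx; rewrite contourE.
move=> ->; rewrite contourE; apply: eq_cint => u /=; rewrite in_itv/= => u01.
rewrite mulrC -cintZ//; first by apply: eq_cint => x Dx; rewrite mulrC.
apply: (@cintegrable_dom _ _ _ _ _ _ b) => //; last by move=> x Dx; rewrite path_extE// fb.
exact: (cmeas_comp (g := fun x : T => (x, u)) (measurable_pair2 u) mf).
Qed.

Lemma contour_fubini_integrable :
  cintegrable m D (fun x => contour_integral gamma (f x)).
Proof.
have [L L0 gbL] := gb.
have := cfubini_integrable (m2 := mu) mD (measurable_itv _) mg ib (integrable_cst01 L) gbL.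
by apply: eq_cintegrable => // x Dx; rewrite contourE.
Qed.

End contour_fubini.

End paths.

Section more_rules.
Context {R : realType}.

Lemma cderX (f : R -> R[i]) x l n : cder f x l ->
  cder (fun t => f t ^+ n.+1) x (n.+1%:R * f x ^+ n * l).
Proof.
move=> fl; elim: n => [|n ih].
  by under [X in cder X]eq_fun do rewrite expr1; apply: cder_eq fl _; rewrite mul1r expr0 mul1r.
under [X in cder X]eq_fun do rewrite exprS.
apply: cder_eq (cderM fl ih) _; rewrite -[in RHS]natr1 exprS; ring.
Qed.

Lemma ccontX A (f : R -> R[i]) n : ccont A f -> ccont A (fun u => f u ^+ n).
Proof.
move=> cf; elim: n => [|n ih].
  by under [X in ccont _ X]eq_fun do rewrite expr0; exact: ccont_cst.
by under [X in ccont _ X]eq_fun do rewrite exprS; exact: ccontM.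
Qed.

Lemma ccont_bigsum A I (r : seq I) (P : pred I) (F : I -> R -> R[i]) :
  (forall i, ccont A (F i)) -> ccont A (fun u => \sum_(i <- r | P i) F i u).
Proof.
move=> cF; elim: r => [|a r ih].
  by under [X in ccont _ X]eq_fun do rewrite big_nil; exact: ccont_cst.
under [X in ccont _ X]eq_fun do rewrite big_cons.
by case: (P a) => //; exact: ccontD.
Qed.

Lemma ccont_bigprod A I (r : seq I) (P : pred I) (F : I -> R -> R[i]) :
  (forall i, ccont A (F i)) -> ccont A (fun u => \prod_(i <- r | P i) F i u).
Proof.
move=> cF; elim: r => [|a r ih].
  by under [X in ccont _ X]eq_fun do rewrite big_nil; exact: ccont_cst.
under [X in ccont _ X]eq_fun do rewrite big_cons.
by case: (P a) => //; exact: ccontM.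
Qed.

Lemma ccont_det A n (M : R -> 'M[R[i]]_n) : (forall i j, ccont A (fun u => M u i j)) ->
  ccont A (fun u => \det (M u)).
Proof.
move=> cM; rewrite /determinant; apply: ccont_bigsum => s.
apply: ccontM; first exact: ccont_cst.
exact: ccont_bigprod.
Qed.

Lemma within_eq A (f g : R -> R) : (forall u, A u -> f u = g u) ->
  {within A, continuous f} -> {within A, continuous g}.
Proof.
move=> fg; apply: subspace_eq_continuous => u /set_mem Au; exact: fg.
Qed.

(** By Cramer's rule the entries of the inverse are a cofactor times the inverse of a nonvanishing
    determinant. *)
Lemma ccont_invmx A n (M : R -> 'M[R[i]]_n) : (forall i j, ccont A (fun u => M u i j)) ->
  (forall u, A u -> M u \in unitmx) ->
  forall i j, ccont A (fun u => invmx (M u) i j).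
Proof.
move=> cM uM i j.
have h : ccont A (fun u => (\det (M u))^-1 * \adj (M u) i j).
  apply: ccontM.
    apply: ccontV; last exact: ccont_det.
    by move=> u Au; have := uM u Au; rewrite unitmxE unitfE.
  under [X in ccont _ X]eq_fun do rewrite mxE.
  apply: ccontM; first exact: ccont_cst.
  apply: ccont_det => k l.
  by under [X in ccont _ X]eq_fun do rewrite !mxE.
have E u : A u -> (\det (M u))^-1 * \adj (M u) i j = invmx (M u) i j.
  by move=> Au; rewrite /invmx uM// !mxE.
by case: h => hr hi; split; [apply: within_eq hr|apply: within_eq hi] => u Au /=; rewrite E.
Qed.

End more_rules.

Lemma unitmx_eigenvalue (F : fieldType) n (M : 'M[F]_n) (z : F) :
  (z%:M - M \in unitmx) = ~~ eigenvalue M z.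
Proof.
rewrite /eigenvalue /eigenspace negbK kermx_eq0 row_free_unit.
have -> : z%:M - M = (-1) *: (M - z%:M) by rewrite scaleN1r opprB.
by rewrite unitmxZ// unitrN1.
Qed.

Lemma two_pi_i_neq0 (R : realType) : (two_pi_i : R[i]) != 0.
Proof.
rewrite /two_pi_i eq_complex /= eqxx /= mulf_neq0 ?pnatr_eq0//.
by rewrite gt_eqF// pi_gt0.
Qed.

(** * Closed contours: rational functions and the resolvent *)

Section closed_paths.
Context {R : realType}.
Notation I01 := (`[0, 1]%classic : set R).
Variable gamma : R -> R[i].
Hypothesis hg : piecewise_C1 gamma.
Hypothesis gclosed : gamma 0 = gamma 1.

Let cg := ccont_path hg.

Let I01P (P : R -> Prop) : (forall u, 0 <= u <= 1 -> P u) -> forall u, I01 u -> P u.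
Proof. by move=> h u /=; rewrite in_itv/=; exact: h. Qed.

Lemma contour_deriv0 (F f : R[i] -> R[i]) :
  ccont I01 (fun u => F (gamma u)) -> ccont I01 (fun u => f (gamma u)) ->
  (forall u l, 0 < u < 1 -> cder gamma u l ->
    cder (fun v => F (gamma v)) u (f (gamma u) * l)) ->
  contour_integral gamma f = 0.
Proof. by move=> *; rewrite (contour_deriv hg (F := F))// gclosed subrr. Qed.

Lemma contour_cexp0 (c : R[i]) : contour_integral gamma (fun z => cexp (- z * c)) = 0.
Proof.
have [->|c0] := eqVneq c 0.
  apply: (@contour_deriv0 id) => //.
    under [X in ccont _ X]eq_fun do rewrite mulr0; exact: ccont_cst.
  by move=> u l _ h; apply: cder_eq h _; rewrite mulr0 cexp0 mul1r.
have ce : ccont I01 (fun u => cexp (- gamma u * c)).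
  by apply: ccont_exp; apply: ccontM; [exact: ccontN|exact: ccont_cst].
apply: (@contour_deriv0 (fun z => - c^-1 * cexp (- z * c))) => //.
  by apply: ccontM => //; exact: ccont_cst.
move=> u l _ h.
have h1 := cder_exp (cderM (cderN h) (cder_cst c u)).
apply: cder_eq (cderM (cder_cst (- c^-1) u) h1) _ => /=.
rewrite mul0r add0r mulr0 addr0; set E := cexp _; field; exact: c0.
Qed.

Definition off_path (l : R[i]) := forall u, 0 <= u <= 1 -> gamma u != l.

Lemma ccont_pole l : off_path l -> ccont I01 (fun u => (gamma u - l)^-1).
Proof.
move=> gl; apply: ccontV; last by apply: ccontB => //; exact: ccont_cst.
by apply: I01P => u u01; rewrite subr_eq0 gl.
Qed.

Definition poles (s : seq R[i]) (z : R[i]) := \prod_(l <- s) (z - l)^-1.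

Lemma ccont_poles s : (forall l, l \in s -> off_path l) ->
  ccont I01 (fun u => poles s (gamma u)).
Proof.
move=> hs; apply: (@ccont_prod _ _ _ (fun l u => (gamma u - l)^-1)) => l ls.
by apply: ccont_pole; exact: hs.
Qed.

Lemma contour_invpow l n : off_path l ->
  contour_integral gamma (fun z => (z - l)^-1 ^+ n.+2) = 0.
Proof.
move=> gl; have cl := ccont_pole gl.
apply: (@contour_deriv0 (fun z => - n.+1%:R^-1 * (z - l)^-1 ^+ n.+1)).
- by apply: ccontM; [exact: ccont_cst|exact: ccontX].
- exact: ccontX.
move=> u dg /andP[u0 u1] h.
have gln0 : gamma u - l != 0 by rewrite subr_eq0 gl// (ltW u0) (ltW u1).
have h0 := cderD h (cder_cst (- l) u).
have h1 := cderX n (@cderV _ (fun v => gamma v - l) _ _ gln0 h0).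
apply: cder_eq (cderM (cder_cst (- n.+1%:R^-1) u) h1) _.
rewrite mul0r add0r addr0 expr2 invfM !(exprS _ n.+1) !(exprS _ n).
set w := (gamma u - l)^-1; have n0 : n.+1%:R != 0 :> R[i] by rewrite pnatr_eq0.
move: (n.+1%:R) n0 => N n0; set W := w ^+ n; field; exact: n0.
Qed.

Lemma contour_poles1 l w : winding_number gamma l = w ->
  contour_integral gamma (poles [:: l]) = two_pi_i * w.
Proof.
move=> <-; rewrite /winding_number mulrA divff ?mul1r ?two_pi_i_neq0//.
by congr contour_integral; apply/funext => z; rewrite /poles big_seq1.
Qed.

(* Two distinct poles are separated by partial fractions; a single multiple pole
   has a primitive. *)
Lemma contour_poles s w : (1 < size s)%N -> (forall l, l \in s -> off_path l) ->
  (forall l, l \in s -> winding_number gamma l = w) ->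
  contour_integral gamma (poles s) = 0.
Proof.
move: {2}(size s) (leqnn (size s)) => n; elim: n s => [|n ih] [|a s]//.
rewrite /= ltnS => sn s0 off wn.
have [sa|] := boolP (all (pred1 a) s).
  have -> : poles (a :: s) = (fun z => (z - a)^-1 ^+ (size s).+1).
    apply/funext => z; rewrite /poles big_cons exprS; congr *%R.
    by rewrite (all_pred1P _ _ sa) big_nseq size_nseq -/(iter _ _ _) iter_mulr_1.
  case: (size s) s0 => // k _; apply: contour_invpow; apply: off; exact: mem_head.
move=> /allPn[b bs /= ba].
have ab0 : a - b != 0 by rewrite subr_eq0 eq_sym.
pose r := rem b s.
have sr : perm_eq s (b :: r) by exact: perm_to_rem.
have rs l : l \in r -> l \in s by exact: mem_rem.
have offa : forall l, l \in a :: r -> off_path l.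
  move=> l; rewrite in_cons => /predU1P[->|/rs ls]; apply: off; first exact: mem_head.
  by rewrite in_cons ls orbT.
have offb : forall l, l \in b :: r -> off_path l.
  by move=> l; rewrite -(perm_mem sr) => ls; apply: off; rewrite in_cons ls orbT.
have wa : forall l, l \in a :: r -> winding_number gamma l = w.
  move=> l; rewrite in_cons => /predU1P[->|/rs ls]; apply: wn; first exact: mem_head.
  by rewrite in_cons ls orbT.
have wb : forall l, l \in b :: r -> winding_number gamma l = w.
  by move=> l; rewrite -(perm_mem sr) => ls; apply: wn; rewrite in_cons ls orbT.
have -> : contour_integral gamma (poles (a :: s)) =
    contour_integral gamma (fun z => (a - b)^-1 * (poles (a :: r) z - poles (b :: r) z)).
  apply: eq_contour => // u u01; rewrite /poles big_cons (perm_big _ sr) /= !big_cons.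
  set q := \prod_(l <- r) _.
  have ga : gamma u - a != 0 by rewrite subr_eq0 offa ?mem_head.
  have gb : gamma u - b != 0 by rewrite subr_eq0 offb ?mem_head.
  by field; rewrite ab0 gb ga.
rewrite contourZ//; last by apply: ccontB; exact: ccont_poles.
rewrite contourB//; [|exact: ccont_poles..].
have sz : size s = (size r).+1 by rewrite (perm_size sr).
(* With no other pole left, each of the two integrals is [two_pi_i * w] and they cancel: this is
   where the equality of the winding numbers enters. *)
have [r0|r0] := posnP (size r).
  have -> : r = [::] by exact: size0nil.
  rewrite (contour_poles1 (wa a (mem_head _ _))) (contour_poles1 (wb b (mem_head _ _))).
  by rewrite subrr mulr0.
rewrite !ih ?subrr ?mulr0//= -?sz//.
Qed.

Section resolvent.
Variables (p : nat) (M : 'M[R[i]]_p).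
Hypothesis offM : forall u, 0 <= u <= 1 -> ~~ eigenvalue M (gamma u).

Definition res (z : R[i]) : 'M[R[i]]_p := invmx (z%:M - M).

Lemma res_unit u : 0 <= u <= 1 -> (gamma u)%:M - M \in unitmx.
Proof. by move=> u01; rewrite unitmx_eigenvalue offM. Qed.

Lemma ccont_res i j : ccont I01 (fun u => res (gamma u) i j).
Proof.
apply: ccont_invmx; last by apply: I01P => u; exact: res_unit.
move=> k l; under [X in ccont _ X]eq_fun do rewrite !mxE mulrb.
apply: ccontB; last exact: ccont_cst.
by case: (k == l) => //; exact: ccont_cst.
Qed.

Definition contour_mx (g : R[i] -> R[i]) : 'M[R[i]]_p :=
  \matrix_(i, j) contour_integral gamma (fun z => g z * res z i j).

Lemma cauchy_integralE g : cauchy_integral gamma g M = two_pi_i^-1 *: contour_mx g.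
Proof. by apply/matrixP => i j; rewrite !mxE. Qed.

Lemma contour_mulmx g (A : 'M[R[i]]_p) : ccont I01 (fun u => g (gamma u)) ->
  contour_mx g *m A = \matrix_(i, j)
   contour_integral gamma (fun z => g z * (res z *m A) i j).
Proof.
move=> cgg; apply/matrixP => i j; rewrite !mxE.
transitivity (\sum_k A k j * contour_integral gamma (fun z => g z * res z i k)).
  by apply: eq_bigr => k _; rewrite !mxE mulrC.
have -> : (fun z => g z * (res z *m A) i j) =
    (fun z => \sum_k A k j * (g z * res z i k)).
  apply/funext => z; rewrite mxE mulr_sumr; apply: eq_bigr => k _.
  by rewrite mulrA mulrC.
rewrite (contour_sum hg); last first.
  move=> k; apply: ccontM; first exact: ccont_cst.
  by apply: ccontM => //; exact: ccont_res.
apply: eq_bigr => k _; rewrite (contourZ hg)//.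
by apply: ccontM => //; exact: ccont_res.
Qed.

(* From (z - M)^-1 (M - l) = (z - l) (z - M)^-1 - 1. *)
Lemma contour_poles_cons s l : (forall l', l' \in l :: s -> off_path l') ->
  contour_mx (poles (l :: s)) *m (M - l%:M) =
  contour_mx (poles s) - (contour_integral gamma (poles (l :: s)))%:M.
Proof.
move=> off; have cps := ccont_poles off.
have cs : ccont I01 (fun u => poles s (gamma u)).
  by apply: ccont_poles => l' ls; apply: off; rewrite in_cons ls orbT.
rewrite contour_mulmx//; apply/matrixP => i j; rewrite !mxE mulrb.
transitivity (contour_integral gamma (fun z =>
   poles s z * res z i j - (if i == j then 1 else 0) * poles (l :: s) z)).
  apply: eq_contour => // u u01.
  have E : res (gamma u) *m (M - l%:M) =
     (gamma u - l) *: res (gamma u) - 1%:M.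
    have -> : M - l%:M = (gamma u - l)%:M - ((gamma u)%:M - M).
      by rewrite raddfB /= [RHS]addrAC subKr.
    by rewrite mulmxBr mulVmx ?res_unit// scalar_mxC mul_scalar_mx.
  rewrite E !mxE mulrb /poles big_cons.
  have gl : gamma u - l != 0 by rewrite subr_eq0 off ?mem_head.
  set q := \prod_(_ <- _) _.
  by case: (i == j) => /=; rewrite ?mulr1n ?mulr0n; field.
rewrite (contourB hg) ?(contourZ hg)//.
- by case: ifP; rewrite ?mul1r ?mul0r.
- by apply: ccontM => //; exact: ccont_res.
- by apply: ccontM => //; exact: ccont_cst.
Qed.

End resolvent.

(** Going through the roots of the characteristic polynomial, [contour_poles_cons] exchanges a
    factor [M - l] for a pole at [l]. The scalar left over is [two_pi_i] when the pole is alone and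
    0 when there are several, since all roots have winding number 1. Once all factors are present,
    their product is 0 by Cayley-Hamilton, and only [two_pi_i] remains. *)
Lemma contour_res p (M : 'M[R[i]]_p) :
  (forall u, 0 <= u <= 1 -> ~~ eigenvalue M (gamma u)) ->
  (forall a, eigenvalue M a -> winding_number gamma a = 1) ->
  contour_mx M (fun=> 1) = two_pi_i%:M.
Proof.
(* Size 0 is set apart: there the list of roots is empty and the argument has no first step. *)
case: p M => [|p'] M' offM' windM'; first by apply/matrixP => -[].
have rec := contour_poles_cons offM'.
have [r hr] := closed_field_poly_normal (char_poly M').
rewrite (monicP (char_poly_monic M')) scale1r in hr.
have re l : l \in r -> eigenvalue M' l.
  by move=> lr; rewrite eigenvalue_root_char hr root_prod_XsubC.
have offr l : l \in r -> off_path l.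
  by move=> /re el u u01; apply: contraL (offM' u u01) => /eqP ->; rewrite negbK.
have CH : \prod_(l <- r) (M' - l%:M) = 0.
  rewrite -(Cayley_Hamilton M') hr rmorph_prod; apply: eq_bigr => l _.
  by rewrite raddfB /= horner_mx_X horner_mx_C.
have step s : s != [::] -> {subset s <= r} ->
    contour_mx M' (poles [::]) = two_pi_i%:M + contour_mx M' (poles s) *m \prod_(l <- s) (M' - l%:M).
  elim: s => [//|l s ih] _ sr.
  have lr : l \in r by apply: sr; rewrite mem_head.
  have sr' : {subset s <= r} by move=> x xs; apply: sr; rewrite in_cons xs orbT.
  have off : forall l', l' \in l :: s -> off_path l' by move=> l' /sr; exact: offr.
  have {rec} rec' := rec s l off.
  rewrite big_cons -[_ * _]/(_ *m _) mulmxA rec'.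
  have [s0|s0] := eqVneq s [::].
    rewrite s0 big_nil mulmx1 (contour_poles1 (windM' _ (re _ lr))) mulr1.
    by rewrite addrC subrK.
  have c0 : contour_integral gamma (poles (l :: s)) = 0.
    apply: (@contour_poles _ 1) => //; first by case: (s) s0.
    by move=> l' /sr /re; exact: windM'.
  rewrite c0 raddf0 subr0; exact: ih.
have r0 : r != [::].
  apply/eqP => r0; have := size_char_poly M'; rewrite hr r0 big_nil size_poly1.
  by [].
have := step r r0 (fun x h => h); rewrite CH mulmx0 addr0 => <-.
by apply/matrixP => i j; rewrite !mxE; congr contour_integral; apply/funext => z;
  rewrite /poles big_nil.
Qed.

End closed_paths.

(** * Semigroups and the exponential on a contour *)

Section complex_FTC.
Context {R : realType}.
Notation mu := (@lebesgue_measure R).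

Lemma lebesgue_itvcc_lty (a b : R) : (mu `[a, b] < +oo)%E.
Proof. by rewrite lebesgue_measure_itv/=; case: ifP; rewrite -?EFinD ltry. Qed.

Lemma real_FTC (h q : R -> R) a b : a < b ->
  {within `[a, b], continuous h} -> {within `[a, b], continuous q} ->
  (forall u, a < u < b -> der h u (q u)) ->
  \int[mu]_(u in `[a, b]) q u = h b - h a.
Proof.
move=> ab ch cq hq.
rewrite /Rintegral (@continuous_FTC2 R q h a b ab cq)//.
  move: ch => /(continuous_within_itvP _ ab) [_ c1 c2]; split => // u.
  by rewrite in_itv/= => /hq [].
by move=> u; rewrite in_itv/= => /hq [_ e]; rewrite derive1E e.
Qed.

Lemma complex_FTC (h q : R -> R[i]) a b : a < b ->
  ccont `[a, b] h -> ccont `[a, b] q ->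
  (forall u, a < u < b -> cder h u (q u)) ->
  cint mu `[a, b] q = h b - h a.
Proof.
move=> ab [hr hi] [qr qi] hq; apply: eqC; rewrite !ReImE /=.
  by apply: (@real_FTC (fun u => Re (h u)) (fun u => Re (q u))) => // u /hq[].
by apply: (@real_FTC (fun u => Im (h u)) (fun u => Im (q u))) => // u /hq[].
Qed.

Lemma ccont_real A (f : R -> R) : {within A, continuous f} ->
  ccont A (fun u => (f u)%:C).
Proof. by move=> cf; split => //=; move=> x; exact: cvg_cst. Qed.

End complex_FTC.

Section paths_right_half_plane.
Context {R : realType}.
Variable gamma : R -> R[i].
Hypothesis hg : piecewise_C1 gamma.

Lemma path_bounded : exists2 B, 0 <= B & forall u, 0 <= u <= 1 -> n1 (gamma u) <= B.
Proof. exact: ccont_bounded ler01 (ccont_path hg). Qed.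

Lemma path_Re_gt0 : (forall u, 0 <= u <= 1 -> 0 < Re (gamma u)) ->
  exists2 e, 0 < e & forall u, 0 <= u <= 1 -> e <= Re (gamma u).
Proof.
move=> g0; have [cr _] := ccont_path hg.
have [c cin cmin] := EVT_min ler01 cr.
exists (Re (gamma c)) => [|u u01]; first by apply: g0; move: cin; rewrite in_itv.
by apply: cmin; rewrite in_itv.
Qed.

End paths_right_half_plane.

(** What is retained of [S t = exp (t T)]. Continuity is global so that compositions need no
    restriction of the domain; the derivative is asked at positive times, since the block of a
    Markov semigroup is extended to negative times through the absolute value of [t] and may have a
    corner at 0. The bounds 0 and 1 serve for domination. *)
Record semigroup_block (R : realType) (p : nat) (T : 'M[R]_p) (S : R -> 'M[R]_p) : Prop := {
  block_cont : forall i j, continuous (fun t => S t i j);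
  block_der : forall t i j, 0 < t -> der (fun t => S t i j) t ((S t *m T) i j);
  block0 : S 0 = 1%:M;
  block_ge0 : forall t i j, 0 <= t -> 0 <= S t i j;
  block_le1 : forall t i j, 0 <= t -> S t i j <= 1 }.

Section semigroup_contour.
Context {R : realType} (p : nat) (T : 'M[R]_p) (S : R -> 'M[R]_p).
Notation mu := (@lebesgue_measure R).
Hypothesis hS : semigroup_block T S.

Section one_path.
Variables (x : R) (gamma : R -> R[i]).
Hypotheses (x0 : 0 < x) (hg : piecewise_C1 gamma) (gclosed : gamma 0 = gamma 1).
Let M := cmx (- x *: T).
Hypothesis offM : forall u, 0 <= u <= 1 -> ~~ eigenvalue M (gamma u).

(* The derivative of v |-> e^{-zv} S(x(th - v)) is
   -e^{-zv} S(x(th - v)) (z + xT). *)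
Lemma resolvent_exp th z i j : 0 < th -> z%:M - M \in unitmx ->
  cexp (- z * th%:C) * res M z i j =
  \sum_k (S (x * th) i k)%:C * res M z k j
  - cint mu `[0, th] (fun v => cexp (- z * v%:C) * (S (x * (th - v)) i j)%:C).
Proof.
move=> th0 zM.
pose h (v : R) := \sum_k cexp (- z * v%:C) * (S (x * (th - v)) i k)%:C * res M z k j.
pose q (v : R) := - (cexp (- z * v%:C) * (S (x * (th - v)) i j)%:C).
have Scont k : continuous (fun v : R => S (x * (th - v)) i k).
  move=> v; apply: (@continuous_comp _ _ _ (fun v : R => x * (th - v)) (fun t => S t i k)).
    by apply: cvgM; [exact: cvg_cst|apply: cvgB; [exact: cvg_cst|exact: cvg_id]].
  exact: (block_cont hS).
have cS A k : ccont A (fun v : R => (S (x * (th - v)) i k)%:C).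
  by apply: ccont_real; apply: continuous_subspaceT; exact: Scont.
have ce A : ccont A (fun v : R => cexp (- z * v%:C)).
  apply: ccont_exp; apply: ccontM; first exact: ccont_cst.
  apply: ccont_real; apply: (@continuous_subspaceT _ _ _ (fun v : R => v)) => w.
  exact: cvg_id.
have ch A : ccont A h.
  by apply: ccont_bigsum => k; apply: ccontM; [exact: ccontM|exact: ccont_cst].
have cq A : ccont A q by apply: ccontN; exact: ccontM.
have dh u : 0 < u < th -> cder h u (q u).
  move=> /andP[u0 uth].
  have xt : 0 < x * (th - u) by rewrite mulr_gt0// subr_gt0.
  have dS k : cder (fun v : R => (S (x * (th - v)) i k)%:C) u
      (- (x%:C * \sum_l (S (x * (th - u)) i l)%:C * (T l k)%:C)).
    have d1 : der (fun v : R => x * (th - v)) u (- x).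
      apply: der_eq (derM (der_cst x u) (derB (der_cst th u) (der_id u))) _.
      by rewrite mul0r add0r sub0r mulrN1.
    apply: cder_eq (cder_real (der_comp d1 (block_der hS i k xt))) _.
    rewrite mxE mulrN rmorphN rmorphM /= mulrC; congr (- (_ * _)).
    by rewrite rmorph_sum /=; apply: eq_bigr => l _; rewrite rmorphM.
  have de : cder (fun v : R => cexp (- z * v%:C)) u (- z * cexp (- z * u%:C)).
    apply: cder_eq (cder_exp (cderM (cder_cst (- z) u) (cder_real (der_id u)))) _.
    by rewrite mul0r add0r mulr1.
  have dt k := cderM (cderM de (dS k)) (cder_cst (res M z k j) u).
  have : cder h u (\sum_k ((- z * cexp (- z * u%:C)) * (S (x * (th - u)) i k)%:C
     + cexp (- z * u%:C) * (- (x%:C * \sum_l (S (x * (th - u)) i l)%:C * (T l k)%:C)))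
     * res M z k j).
    split; rewrite ?Re_sum ?Im_sum.
      rewrite (_ : (fun t => Re (h t)) = (fun t => \sum_k Re (cexp (- z * t%:C) *
         (S (x * (th - t)) i k)%:C * res M z k j))); last first.
        by apply/funext => t; rewrite /h Re_sum.
      apply: der_sum => k; have [+ _] := dt k.
      by move/der_eq; apply; rewrite mulr0 addr0.
    rewrite (_ : (fun t => Im (h t)) = (fun t => \sum_k Im (cexp (- z * t%:C) *
       (S (x * (th - t)) i k)%:C * res M z k j))); last first.
      by apply/funext => t; rewrite /h Im_sum.
    apply: der_sum => k; have [_ +] := dt k.
    by move/der_eq; apply; rewrite mulr0 addr0.
  move/cder_eq; apply; rewrite /q.
  pose Su := cmx (S (x * (th - u))).
  have key : (Su *m (z%:M - M) *m res M z) i j = Su i j.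
    by rewrite -mulmxA mulmxV ?mulmx1.
  transitivity (- (cexp (- z * u%:C) * (Su *m (z%:M - M) *m res M z) i j)); last first.
    by rewrite key /Su mxE.
  rewrite mxE mulr_sumr -sumrN; apply: eq_bigr => k _.
  rewrite mulrA -[RHS]mulNr; congr (_ * _).
  have -> : (Su *m (z%:M - M)) i k = z * (S (x * (th - u)) i k)%:C +
      x%:C * \sum_l (S (x * (th - u)) i l)%:C * (T l k)%:C.
    rewrite mulmxBr scalar_mxC mul_scalar_mx !mxE; congr (_ + _).
    rewrite -sumrN mulr_sumr; apply: eq_bigr => l _.
    by rewrite !mxE mulNr rmorphN rmorphM /=; ring.
  ring.
have F := complex_FTC (h := fun v => - h v)
  (q := fun v => cexp (- z * v%:C) * (S (x * (th - v)) i j)%:C) th0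
  (ccontN (ch _)) (ccontM (ce _) (cS _ _)).
have {F} -> := F (fun u hu => cder_eq (cderN (dh u hu)) (opprK _)).
have hth : h th = cexp (- z * th%:C) * res M z i j.
  rewrite /h subrr mulr0 (block0 hS) (bigD1 i)//= big1 ?addr0.
    by rewrite mxE eqxx mulr1.
  by move=> k ki; rewrite mxE eq_sym (negbTE ki) mulr0 mul0r.
have h0 : h 0 = \sum_k (S (x * th) i k)%:C * res M z k j.
  by rewrite /h; apply: eq_bigr => k _; rewrite subr0 mulr0 cexp0 mul1r.
by rewrite -hth -h0 opprK opprD opprK addrCA subrr addr0.
Qed.

Hypothesis windM : forall a, eigenvalue M a -> winding_number gamma a = 1.

Lemma contour_exp th : 0 <= th ->
  contour_mx gamma M (fun z => cexp (- z * th%:C)) = two_pi_i *: cmx (S (x * th)).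
Proof.
(* For [th = 0] the exponential is 1 and the claim is the integral of the resolvent; the formula of
   [resolvent_exp] uses an interval of positive length. *)
rewrite le_eqVlt => /predU1P[<-|th0].
  rewrite mulr0 (block0 hS).
  have -> : (fun z : R[i] => cexp (- z * (0:R)%:C)) = (fun=> 1).
    by apply/funext => z; rewrite mulr0 cexp0.
  rewrite (contour_res hg gclosed offM windM).
  by apply/matrixP => i j; rewrite !mxE; case: (i == j); rewrite ?mulr1 ?mulr0.
apply/matrixP => i j; rewrite !mxE.
have cS k : ccont `[0, 1] (fun u => (S (x * th) i k)%:C * res M (gamma u) k j).
  by apply: ccontM; [exact: ccont_cst|exact: ccont_res].
have csum : ccont `[0, 1] (fun u => \sum_k (S (x * th) i k)%:C * res M (gamma u) k j).
  exact: ccont_bigsum.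
have ce : ccont `[0, 1] (fun u => cexp (- gamma u * th%:C)).
  apply: ccont_exp; apply: ccontM; last exact: ccont_cst.
  by apply: ccontN; exact: ccont_path.
have cr : ccont `[0, 1] (fun u => cexp (- gamma u * th%:C) * res M (gamma u) i j).
  by apply: ccontM => //; exact: ccont_res.
pose f (v : R) (z : R[i]) := cexp (- z * v%:C) * (S (x * (th - v)) i j)%:C.
have I0 : contour_integral gamma (fun z => cint mu `[0, th] (fun v => f v z)) = 0.
  have [B B0 hB] := path_bounded hg.
  (* The bound comes from [|Re (gamma u)| <= B], from [v <= th] and from the entries of [S] being at
     most 1; the factor 2 is that of [n1_cexp]. *)
  rewrite (@contour_fubini _ _ hg _ _ mu _ _ (fun=> 2 * expR (B * th)))//.
  - apply: etrans (_ : cint mu `[0, th] (fun=> 0) = 0); last first.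
      have := @cint_real R _ _ mu `[0, th]%classic (fun=> 0).
      by rewrite /Rintegral integral0.
    apply: eq_cint => v _.
    rewrite (_ : f v = (fun z => (S (x * (th - v)) i j)%:C * cexp (- z * v%:C))); last first.
      by apply/funext => z; rewrite /f mulrC.
    rewrite (contourZ hg) ?(contour_cexp0 hg gclosed) ?mulr0//.
    apply: ccont_exp; apply: ccontM; last exact: ccont_cst.
    by apply: ccontN; exact: ccont_path.
  - apply: cmeasM.
      apply: cmeas_exp; apply: cmeasM; last exact: cmeas_real.
      apply: cmeasN; apply: (cmeas_comp (g := snd)) => //; exact: cmeas_path_ext.
    apply: cmeas_real.
    apply: (@measurableT_comp _ _ _ _ _ _ (fun t => S t i j)).
      by apply: continuous_measurable_fun; exact: (block_cont hS).
    by apply: measurable_funM => //; exact: measurable_funB.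
  - apply: integrable_cst => //; exact: lebesgue_itvcc_lty.
  - move=> v u /=; rewrite in_itv/= => /andP[v0 vth] u01.
    have xt : 0 <= x * (th - v) by rewrite mulr_ge0 ?subr_ge0// ltW.
    apply: le_trans (n1M _ _) _; rewrite -[leRHS]mulr1.
    apply: ler_pM; rewrite ?n1_ge0//; last first.
      by rewrite n1_real ger0_norm ?(block_ge0 hS)// (block_le1 hS).
    apply: le_trans (n1_cexp _) _; rewrite ler_pM2l// ler_expR !ReImE /= mulr0 subr0.
    have hb := le_trans (Re_le_n1 _) (hB u u01).
    apply: le_trans (ler_norm _) _; rewrite normrM normrN (ger0_norm v0).
    by apply: ler_pM.
transitivity (contour_integral gamma (fun z => \sum_k (S (x * th) i k)%:C * res M z k j)
   - contour_integral gamma (fun z => cint mu `[0, th] (fun v => f v z))).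
  have -> : contour_integral gamma (fun z => cint mu `[0, th] (fun v => f v z)) =
    contour_integral gamma (fun z => \sum_k (S (x * th) i k)%:C * res M z k j
       - cexp (- z * th%:C) * res M z i j).
    apply: eq_contour => // u u01.
    by rewrite (resolvent_exp _ _ th0) ?res_unit// subKr.
  by rewrite contourB// subKr.
rewrite I0 subr0 (contour_sum hg)//.
have R1 k : contour_integral gamma (fun z => res M z k j) = two_pi_i * (k == j)%:R.
  have := contour_res hg gclosed offM windM => /matrixP /(_ k j); rewrite !mxE.
  rewrite (_ : (fun z => 1 * _) = (fun z => res M z k j)); last first.
    by apply/funext => z; rewrite mul1r.
  by move=> ->; case: (k == j); rewrite ?mulr1 ?mulr0.
transitivity (\sum_k (S (x * th) i k)%:C * (two_pi_i * (k == j)%:R)).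
  apply: eq_bigr => k _; rewrite (contourZ hg) ?R1//.
  exact: ccont_res.
rewrite (bigD1 j)//= big1 ?addr0 ?eqxx ?mulr1 ?(mulrC two_pi_i)//.
by move=> k kj; rewrite (negbTE kj) !mulr0.
Qed.

End one_path.
End semigroup_contour.

(** * Circles and the existence of admissible contours *)

Section circle.
Context {R : realType}.
Notation mu := (@lebesgue_measure R).
Notation normc := Normc.normc.

Lemma normc_ge0' (z : R[i]) : 0 <= normc z.
Proof. by case: z => a b; exact: sqrtr_ge0. Qed.

Lemma sqr_normc' (z : R[i]) : normc z ^+ 2 = Re z ^+ 2 + Im z ^+ 2.
Proof. by case: z => a b /=; rewrite sqr_sqrtr// addr_ge0 ?sqr_ge0. Qed.

Lemma n1_le_normc (z : R[i]) : n1 z <= 2 * normc z.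
Proof.
have h (x : R) : x ^+ 2 <= normc z ^+ 2 -> `|x| <= normc z.
  by move=> hx; rewrite -(@ler_pXn2r _ 2)// ?nnegrE ?normc_ge0'// real_normK ?num_real.
rewrite mulr_natl mulr2n /n1; apply: lerD; apply: h; rewrite sqr_normc'.
  by rewrite lerDl sqr_ge0.
by rewrite lerDr sqr_ge0.
Qed.

Lemma normc_lt1_gt0 (z : R[i]) : normc z < 1 -> 1 - z != 0.
Proof.
move=> z1; apply/negP; rewrite subr_eq0 => /eqP h.
by move: z1; rewrite -h Normc.normc1 ltxx.
Qed.

Lemma normcX (z : R[i]) n : normc (z ^+ n) = normc z ^+ n.
Proof.
elim: n => [|n ih]; first by rewrite !expr0 Normc.normc1.
by rewrite !exprS Normc.normcM ih.
Qed.

Lemma normc_cexp (z : R[i]) : Re z = 0 -> normc (cexp z) = 1.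
Proof. by move=> z0; rewrite /cexp /= z0 expR0 !mul1r cos2Dsin2 sqrtr1. Qed.

Lemma cexpMn (z : R[i]) n : cexp (z *+ n) = cexp z ^+ n.
Proof.
elim: n => [|n ih]; first by rewrite mulr0n cexp0 expr0.
by rewrite mulrS cexpD ih exprS.
Qed.

(* The mean over the unit circle of 1 / (1 - b e) is 1: expand as a geometric
   series. *)
Lemma cint_geometric (w b : R[i]) : Re w = 0 -> w != 0 -> cexp w = 1 -> normc b < 1 ->
  cint mu `[0, 1] (fun u : R => (1 - b * cexp (u%:C * w))^-1) = 1.
Proof.
move=> w0 wn0 w1 b1; pose e (u : R) := b * cexp (u%:C * w).
have ce A : ccont A e.
  apply: ccontM; first exact: ccont_cst.
  apply: ccont_exp; apply: ccontM; last exact: ccont_cst.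
  by apply: ccont_real; apply: (@continuous_subspaceT _ _ _ (fun v : R => v)) => u; exact: cvg_id.
have ne u : normc (e u) = normc b.
  rewrite /e Normc.normcM normc_cexp ?mulr1// !ReImE w0 /= mul0r mulr0 subr0//.
have e1 u : 1 - e u != 0 by apply: normc_lt1_gt0; rewrite ne.
have cG A : ccont A (fun u => (1 - e u)^-1).
  by apply: ccontV => [u _|]; [exact: e1|apply: ccontB; [exact: ccont_cst|exact: ce]].
have [K K0 hK] := ccont_bounded ler01 (cG `[0, 1]%classic).
have mI : measurable (`[0, 1]%classic : set R) by exact: measurable_itv.
have ic (f : R -> R[i]) : (forall A, ccont A f) -> cintegrable mu `[0, 1] f.
  move=> cf; have [fr fi] := cf `[0, 1]%classic.
  by split; apply: continuous_compact_integrable => //; exact: segment_compact.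
(* A positive power of [e] has a periodic primitive, a multiple of [cexp (u * (w *+ k.+1))], so its
   mean is 0. *)
have pow0 k : cint mu `[0, 1] (fun u => e u ^+ k.+1) = 0.
  pose c := (w *+ k.+1)^-1 * b ^+ k.+1.
  have wk : w *+ k.+1 != 0 by rewrite mulrn_eq0.
  have eE u : e u ^+ k.+1 = b ^+ k.+1 * cexp (u%:C * (w *+ k.+1)).
    by rewrite /e exprMn -cexpMn mulrnAr.
  rewrite (@complex_FTC _ (fun u => c * cexp (u%:C * (w *+ k.+1)))) ?ltr01//.
  - by rewrite mul1r mul0r cexp0 cexpMn w1 expr1n subrr.
  - apply: ccontM; first exact: ccont_cst.
    apply: ccont_exp; apply: ccontM; last exact: ccont_cst.
    by apply: ccont_real; apply: (@continuous_subspaceT _ _ _ (fun v : R => v)) => u; exact: cvg_id.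
  - exact: ccontX.
  - move=> u _; rewrite eE.
    have d := cder_exp (cderM (cder_real (der_id u)) (cder_cst (w *+ k.+1) u)).
    apply: cder_eq (cderM (cder_cst c u) d) _.
    by rewrite mul0r add0r mulr0 addr0 mul1r /c mulrACA mulVf// mul1r.
have split N : cint mu `[0, 1] (fun u => (1 - e u)^-1) =
    1 + cint mu `[0, 1] (fun u => e u ^+ N.+1 * (1 - e u)^-1).
  elim: N => [|N ->].
    have -> : cint mu `[0, 1] (fun u => (1 - e u)^-1) =
       cint mu `[0, 1] (fun u => 1 + e u ^+ 1 * (1 - e u)^-1).
      by apply: eq_cint => u _; rewrite expr1; field.
    rewrite cintD//.
    - rewrite (@cint_real _ _ _ mu _ (fun=> 1)) Rintegral_cst//.
      by rewrite mul1r (_ : fine _ = 1) //; exact: (congr1 fine mu01).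
    - by apply: ic => A; exact: ccont_cst.
    - by apply: ic => A; apply: ccontM => //; exact: ccontX.
  congr (1 + _).
  have -> : cint mu `[0, 1] (fun u => e u ^+ N.+1 * (1 - e u)^-1) =
     cint mu `[0, 1] (fun u => e u ^+ N.+1 + e u ^+ N.+2 * (1 - e u)^-1).
    by apply: eq_cint => u _; rewrite [e u ^+ N.+2]exprS; field.
  rewrite cintD ?pow0 ?add0r//; apply: ic => A; first exact: ccontX.
  by apply: ccontM => //; exact: ccontX.
(* The difference is the tail of the geometric series. In the constant [4 * K], one factor 2
   compares [n1] with the modulus, the other is that of [n1_cint_le], and [K] bounds
   [1 / (1 - e u)]. *)
have bound N : n1 (cint mu `[0, 1] (fun u => (1 - e u)^-1) - 1) <= 4 * K * normc b ^+ N.+1.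
  rewrite (split N) addrC addKr.
  have [L] := ic _ (fun A => ccontM (ccontX N.+1 (ce A)) (cG A)).
  have mf : cmeas (fun u => e u ^+ N.+1 * (1 - e u)^-1).
    have [cr ci] := ccontM (ccontX N.+1 (ce setT)) (cG setT).
    by split; apply: subspace_continuous_measurable_fun.
  move=> _. apply: le_trans. apply: (@n1_cint_le R _ _ mu _ _ (fun=> 2 * normc b ^+ N.+1 * K) mI mf).
  - by apply: integrable_cst => //; exact: lebesgue_itvcc_lty.
  - move=> u /=; rewrite in_itv/= => u01; apply: le_trans (n1M _ _) _.
    apply: ler_pM; rewrite ?n1_ge0 ?hK//.
    by apply: le_trans (n1_le_normc _) _; rewrite normcX ne.
  - rewrite Rintegral_cst// (_ : fine _ = 1); last exact: (congr1 fine mu01).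
    by rewrite mulr1; lra.
apply/eqP; rewrite -subr_eq0; apply/eqP/n1_eq0/eqP; rewrite eq_le n1_ge0 andbT.
apply/ler_addgt0Pr => eps eps0; rewrite add0r.
have : (fun N => 4 * K * normc b ^+ N.+1) @ \oo --> (4 * K * 0 : R).
  apply: cvgM; first exact: cvg_cst.
  have := @cvg_expr R (normc b); rewrite ger0_norm ?normc_ge0'// => /(_ b1).
  by rewrite -(cvg_shiftS (fun N => normc b ^+ N)).
rewrite mulr0 => /cvgrPdist_le /(_ eps eps0)[N _ /(_ N (leqnn N))] /=.
rewrite sub0r normrN => h; apply: le_trans (bound N) _.
exact: le_trans (ler_norm _) h.
Qed.

Variables (c r : R).
Hypotheses (r0 : 0 < r) (rc : r < c).

Definition circle (u : R) : R[i] := (c + r * cos (2 * pi * u)) +i* (r * sin (2 * pi * u)).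

Let e (u : R) : R[i] := cexp (u%:C * two_pi_i).

Lemma circleE u : circle u = c%:C + r%:C * e u.
Proof.
apply: eqC; rewrite ?ReImE /= ?ReImE /= !(mul0r, mulr0, subr0, addr0, add0r).
  by rewrite oppr0 expR0 !mul1r (mulrC u).
by rewrite oppr0 expR0 !mul1r (mulrC u).
Qed.

Lemma normc_e u : normc (e u) = 1.
Proof. by rewrite normc_cexp// !ReImE /= mulr0 mul0r subr0. Qed.

Let der_arg (x : R) : der (fun u : R => 2 * pi * u) x (2 * pi).
Proof.
apply: der_eq (derM (der_cst (2 * pi) x) (der_id x)) _.
by rewrite mul0r add0r mulr1.
Qed.

Let der_re x : der (fun u => Re (circle u)) x (- (r * (2 * pi) * sin (2 * pi * x))).
Proof.
apply: der_eq (derD (der_cst c x) (derM (der_cst r x) (der_comp (der_arg x) (der_cos _)))) _.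
ring.
Qed.

Let der_im x : der (fun u => Im (circle u)) x (r * (2 * pi) * cos (2 * pi * x)).
Proof.
apply: der_eq (derM (der_cst r x) (der_comp (der_arg x) (der_sin _))) _; ring.
Qed.

Lemma circle_derive x : path_derive circle x = r%:C * e x * two_pi_i.
Proof.
rewrite /path_derive !derive1E; have [_ ->] := der_re x; have [_ ->] := der_im x.
apply: eqC; rewrite ?ReImE /= ?ReImE /= !(mul0r, mulr0, subr0, addr0, add0r) oppr0;
rewrite expR0 !mul1r (mulrC x); ring.
Qed.

Lemma circle_piecewise : piecewise_C1 circle.
Proof.
exists 1%N, (fun k => k%:R); split=> [//|//|[|//] _]; split; first exact: ltr01.
- exists (fun u => Re (circle u)); split => [x|x|//]; first by have [] := der_re x.
  rewrite (_ : derive1 _ = fun x => - (r * (2 * pi) * sin (2 * pi * x))); last first.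
    by apply/funext => y; rewrite derive1E; have [_ ->] := der_re y.
  have hd : der (fun x : R => - (r * (2 * pi) * sin (2 * pi * x))) x
     (- (r * (2 * pi) * (2 * pi * cos (2 * pi * x)))).
    apply: der_eq (derN (derM (der_cst (r * (2 * pi)) x)
     (der_comp (der_arg x) (der_sin _)))) _; ring.
  exact: der_cont hd.
- exists (fun u => Im (circle u)); split => [x|x|//]; first by have [] := der_im x.
  rewrite (_ : derive1 _ = fun x => r * (2 * pi) * cos (2 * pi * x)); last first.
    by apply/funext => y; rewrite derive1E; have [_ ->] := der_im y.
  have hd : der (fun x : R => r * (2 * pi) * cos (2 * pi * x)) x
     (r * (2 * pi) * (2 * pi * - sin (2 * pi * x))).
    apply: der_eq (derM (der_cst (r * (2 * pi)) x)
     (der_comp (der_arg x) (der_cos _))) _; ring.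
  exact: der_cont hd.
Qed.

(** Equal points give [cos (2 pi (s - t)) = 1] by the addition formula, hence [sin (pi (s - t)) = 0]
    by the half-angle formula, and the sine does not vanish on the open interval from 0 to [pi]. *)
Lemma circle_simple : simple_closed circle.
Proof.
have ci (x : R) : -1 < x < 1 -> cos (2 * pi * x) = 1 -> x = 0.
  move=> /andP[x1 x2] hc.
  have sx : sin (pi * x) = 0.
    move: hc; rewrite -mulrA mulr_natl cos_mulr2n cos2sin2 => h.
    have : sin (pi * x) ^+ 2 = 0 by move: h; rewrite mulr2n; lra.
    by move/eqP; rewrite sqrf_eq0 => /eqP.
  have p0 := pi_gt0 R.
  case: (ltgtP x 0) => // h.
    have := @sin_gt0_pi R (pi * - x); rewrite mulrN sinN sx oppr0 ltxx => H.
    by suff : false by []; apply: H; nra.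
  have := @sin_gt0_pi R (pi * x); rewrite sx ltxx => H.
  by suff : false by []; apply: H; nra.
split.
  by rewrite /circle mulr0 mulr1 cos0 sin0 mulr_natl cos2pi sin2pi.
move=> s t /andP[s0 s1] /andP[t0 t1] [h1 h2].
have hc : cos (2 * pi * s) = cos (2 * pi * t) by apply: (mulfI (lt0r_neq0 r0)); lra.
have hs : sin (2 * pi * s) = sin (2 * pi * t) by apply: (mulfI (lt0r_neq0 r0)).
apply/eqP; rewrite -subr_eq0; apply/eqP; apply: ci; first by lra.
by rewrite mulrBr cosB hc hs -!expr2 cos2Dsin2.
Qed.

Lemma circle_Re_gt0 u : 0 < Re (circle u).
Proof.
rewrite /circle /=; set x := cos _.
have : 0 <= r * (x + 1).
  by rewrite mulr_ge0 ?(ltW r0)// -lerBlDr sub0r cos_geN1.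
move: rc; rewrite mulrDr mulr1 => h1 h2. lra.
Qed.

Lemma circle_off a : normc (a - c%:C) != r -> forall u, circle u != a.
Proof.
move=> ha u; apply: contra ha => /eqP <-; rewrite circleE addrC addKr.
by rewrite Normc.normcM normc_e mulr1 /= expr0n /= addr0 sqrtr_sqr gtr0_norm.
Qed.

Let cexp_two_pi_i : cexp (two_pi_i : R[i]) = 1.
Proof. by rewrite /cexp /two_pi_i /= expR0 !mul1r mulr_natl cos2pi sin2pi. Qed.

Let ccont_rot A w : ccont A (fun u : R => cexp (u%:C * w)).
Proof.
apply: ccont_exp; apply: ccontM; last exact: ccont_cst.
by apply: ccont_real; apply: (@continuous_subspaceT _ _ _ (fun v : R => v)) => u; exact: cvg_id.
Qed.

Let ccont_cintegrable (f : R -> R[i]) : ccont `[0, 1] f -> cintegrable mu `[0, 1] f.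
Proof.
by move=> [fr fi]; split; apply: continuous_compact_integrable => //; exact: segment_compact.
Qed.

Lemma circle_windingE a H : ccont `[0, 1] H ->
  (forall u, (circle u - a)^-1 * (r%:C * e u) = H u) ->
  winding_number circle a = cint mu `[0, 1] H.
Proof.
move=> cH hH; rewrite /winding_number /contour_integral.
rewrite -/(cint mu `[0, 1] (fun u => (circle u - a)^-1 * path_derive circle u)).
rewrite (@eq_cint _ _ _ mu _ _ (fun u => two_pi_i * H u)); last first.
  by move=> u _; rewrite circle_derive -hH mulrA mulrC.
rewrite cintZ//; last exact: ccont_cintegrable.
by rewrite mulrA mulVf ?two_pi_i_neq0// mul1r.
Qed.

Let rn0 : r%:C != 0.
Proof. by rewrite eq_complex /= eqxx andbT gt_eqF. Qed.

Let normr_r : normc r%:C = r.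
Proof. by rewrite /= expr0n /= addr0 sqrtr_sqr gtr0_norm. Qed.

Let circle_sub a u : circle u - a = r%:C * e u - (a - c%:C).
Proof. rewrite circleE; ring. Qed.

(** With [b = a - c], dividing by [r e] turns the integrand into [1 / (1 - (b / r) e^-1)], to which
    the mean value of the geometric series applies, the rotation being run backwards. *)
Lemma circle_winding_in a : normc (a - c%:C) < r -> winding_number circle a = 1.
Proof.
move=> ha; set b := a - c%:C in ha.
have hb : normc (b / r%:C) < 1.
  by rewrite Normc.normcM Normc.normcV normr_r ltr_pdivrMr// mul1r.
have h1 u : 1 - b / r%:C * cexp (u%:C * - two_pi_i) != 0.
  apply: normc_lt1_gt0; rewrite Normc.normcM mulrN cexpN Normc.normcV normc_e.
  by rewrite invr1 mulr1.
rewrite (@circle_windingE _ (fun u => (1 - b / r%:C * cexp (u%:C * - two_pi_i))^-1)).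
- apply: cint_geometric => //.
  + by rewrite ReN /= oppr0.
  + by rewrite oppr_eq0 two_pi_i_neq0.
  + by rewrite cexpN cexp_two_pi_i invr1.
- apply: ccontV => [u _|]; first exact: h1.
  by apply: ccontB; [exact: ccont_cst|apply: ccontM; [exact: ccont_cst|exact: ccont_rot]].
- move=> u; have := h1 u; rewrite circle_sub mulrN cexpN -/(e u) -/b.
  have e0 : e u != 0 by exact: cexp_neq0.
  have -> : 1 - b / r%:C / e u = (r%:C * e u - b) / (r%:C * e u).
    by field; rewrite rn0 e0.
  by move=> _; rewrite invfM invrK.
Qed.

(** Here [|r / b| < 1], and the integrand is [1 - 1 / (1 - (r / b) e)]: two means equal to 1
    cancel. *)
Lemma circle_winding_out a : r < normc (a - c%:C) -> winding_number circle a = 0.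
Proof.
move=> ha; set b := a - c%:C in ha.
have b0 : b != 0.
  apply/eqP => b0; move: ha; rewrite b0 Normc.normc0 => h.
  by have := lt_trans r0 h; rewrite ltxx.
have hb : normc (r%:C / b) < 1.
  rewrite Normc.normcM Normc.normcV normr_r ltr_pdivrMr ?mul1r//.
  exact: lt_trans ha.
have h1 u : 1 - r%:C / b * cexp (u%:C * two_pi_i) != 0.
  by apply: normc_lt1_gt0; rewrite Normc.normcM normc_e mulr1.
have cG : ccont `[0, 1] (fun u : R => (1 - r%:C / b * cexp (u%:C * two_pi_i))^-1).
  apply: ccontV => [u _|]; first exact: h1.
  by apply: ccontB; [exact: ccont_cst|apply: ccontM; [exact: ccont_cst|exact: ccont_rot]].
rewrite (@circle_windingE _ (fun u => 1 - (1 - r%:C / b * cexp (u%:C * two_pi_i))^-1)).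
- rewrite cintB//.
  + rewrite cint_geometric//; last exact: two_pi_i_neq0.
    rewrite (@cint_real _ _ _ mu _ (fun=> 1)) Rintegral_cst//.
    by rewrite mul1r (_ : fine _ = 1) ?subrr//; exact: (congr1 fine mu01).
  + by apply: ccont_cintegrable; exact: ccont_cst.
  + exact: ccont_cintegrable.
- by apply: ccontB => //; exact: ccont_cst.
- move=> u; rewrite circle_sub -/(e u) -/b; have := h1 u; rewrite -/(e u).
  have -> : 1 - r%:C / b * e u = - (r%:C * e u - b) / b by field.
  rewrite mulf_eq0 oppr_eq0 negb_or => /andP[gb _].
by field; rewrite b0; exact: gb.
Qed.

Lemma circle_admissible (D : set R[i]) p (M : 'M[R[i]]_p) :
  (forall z, 0 < Re z -> D z) ->
  (forall a, eigenvalue M a -> normc (a - c%:C) < r) ->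
  admissible_contour D M circle.
Proof.
move=> hD hM; split.
- exact: circle_piecewise.
- exact: circle_simple.
- move=> u _; split; first by apply/hD/circle_Re_gt0.
  apply/negP => /hM h; have := @circle_off (circle u) _ u.
  by rewrite eqxx lt_eqF// => /(_ isT).
- move=> a Da; apply: circle_winding_out.
  (* A point outside [D] has nonpositive real part, so its distance to the centre is at least [c],
     which exceeds [r]. *)
  have a0 : Re a <= 0 by rewrite leNgt; apply/negP => /hD.
  apply: lt_le_trans rc _.
  rewrite -(@ler_pXn2r _ 2)// ?nnegrE ?normc_ge0' ?(ltW (lt_trans r0 rc))//.
  rewrite sqr_normc' !ReImE /= subr0; have := lt_trans r0 rc; nra.
- by move=> a /hM; exact: circle_winding_in.
Qed.

End circle.

Section contour_existence.
Context {R : realType}.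

(** The inequality says [|l - c|^2 <= c^2 - 1]: the points stay at a definite distance inside the
    circle of centre [c] through 0. As [Re l > 0], it persists when [c] grows, whence the
    induction. *)
Lemma seq_center (s : seq R[i]) : (forall l, l \in s -> 0 < Re l) ->
  exists2 c : R, 1 <= c & forall l, l \in s -> Re l ^+ 2 + Im l ^+ 2 + 1 <= 2 * c * Re l.
Proof.
elim: s => [|a s ih] hs; first by exists 1.
have [l ls|c c1 hc] := ih; first by apply: hs; rewrite in_cons ls orbT.
have a0 : 0 < Re a by apply: hs; rewrite mem_head.
pose q := (Re a ^+ 2 + Im a ^+ 2 + 1) / (2 * Re a).
have q0 : 0 <= q by rewrite divr_ge0 ?mulr_ge0 ?addr_ge0 ?sqr_ge0// ltW.
exists (c + q) => [|l]; first by lra.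
rewrite in_cons => /predU1P[->|ls].
  have -> : Re a ^+ 2 + Im a ^+ 2 + 1 = 2 * q * Re a by rewrite /q; field; rewrite gt_eqF.
  nra.
apply: le_trans (hc l ls) _; have : 0 < Re l by apply: hs; rewrite in_cons ls orbT.
nra.
Qed.

Lemma admissible_contour_exists (D : set R[i]) p (M : 'M[R[i]]_p) :
  (forall z, 0 < Re z -> D z) -> (forall a, eigenvalue M a -> 0 < Re a) ->
  exists gamma, admissible_contour D M gamma /\ forall u, 0 < Re (gamma u).
Proof.
move=> hD hM; have [s hs] := closed_field_poly_normal (char_poly M).
rewrite (monicP (char_poly_monic M)) scale1r in hs.
have es a : eigenvalue M a = (a \in s) by rewrite eigenvalue_root_char hs root_prod_XsubC.
have [l|c c1 hc] := @seq_center s; first by rewrite -es; exact: hM.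
have c2 : 1 <= c ^+ 2 by rewrite expr_ge1// (le_trans ler01 c1).
(* The squared radius lies strictly between [c^2 - 1], which puts the eigenvalues inside, and [c^2],
   which keeps the circle in the right half-plane; it is positive because [c >= 1]. *)
pose r := Num.sqrt (c ^+ 2 - 2^-1).
have r2 : r ^+ 2 = c ^+ 2 - 2^-1 by rewrite sqr_sqrtr//; lra.
have r0 : 0 < r by rewrite sqrtr_gt0; lra.
have rc : r < c.
  by rewrite -(@ltr_pXn2r _ 2)// ?nnegrE ?r2 ?(ltW r0) ?(le_trans ler01 c1)//; lra.
exists (circle c r); split; last exact: circle_Re_gt0.
apply: circle_admissible => // a; rewrite es => /hc h.
rewrite -(@ltr_pXn2r _ 2)// ?nnegrE ?normc_ge0' ?(ltW r0)//.
rewrite sqr_normc' r2 !ReImE /= subr0; nra.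
Qed.

End contour_existence.

(** * Matrix functions and exponential decay of the semigroup *)

Section matrix_functions.
Context {R : realType}.

(** Two values would both be the Cauchy integral over the contour whose existence is part of
    [is_matrix_function]; so the choice made by [xget] is forced. *)
Lemma matrix_functionE (D : set R[i]) g p (M A : 'M[R[i]]_p) :
  is_matrix_function D g M A -> matrix_function D g M = A.
Proof.
move=> hA; have [[gamma hg] hc] := hA.
have [_ hc'] : is_matrix_function D g M (matrix_function D g M).
  exact: (@xgetI _ 0 [set A | is_matrix_function D g M A] A hA).
by rewrite -(hc' _ hg) (hc _ hg).
Qed.

Lemma eigenvalue_scale p (T : 'M[R]_p) (x : R) a : x != 0 ->
  eigenvalue (cmx (- x *: T)) a -> eigenvalue (cmx T) (- a / x%:C).
Proof.
move=> x0 /eigenvalueP[v vE v0]; apply/eigenvalueP; exists v => //.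
have xc : x%:C != 0 by rewrite eq_complex /= eqxx andbT.
apply: (scalerI (a := - x%:C)); first by rewrite oppr_eq0.
rewrite scalerA mulNr mulrCA divff ?mulr1// opprK -vE scalemxAr; congr (_ *m _).
by apply/matrixP => i j; rewrite !mxE rmorphM /= rmorphN.
Qed.

Definition stable p (T : 'M[R]_p) := forall a, eigenvalue (cmx T) a -> Re a < 0.

Lemma stable_scale p (T : 'M[R]_p) (x : R) : stable T -> 0 < x ->
  forall a, eigenvalue (cmx (- x *: T)) a -> 0 < Re a.
Proof.
move=> sT x0 a /(eigenvalue_scale (lt0r_neq0 x0)) /sT.
have -> : - a / x%:C = (- x^-1)%:C * a.
  by rewrite rmorphN fmorphV mulrC mulNr mulrN.
by rewrite !ReImE /= mul0r subr0 mulNr oppr_lt0 pmulr_rgt0 ?invr_gt0.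
Qed.

Lemma admissible_stable (D : set R[i]) p (T : 'M[R]_p) (x : R) : stable T -> 0 < x ->
  (forall z, 0 < Re z -> D z) ->
  exists gamma, admissible_contour D (cmx (- x *: T)) gamma /\ forall u, 0 < Re (gamma u).
Proof.
by move=> sT x0 hD; have h := stable_scale sT x0; exact: (admissible_contour_exists hD h).
Qed.

(** [S t] is the Cauchy integral of [cexp (- z t)] on a contour around the spectrum of [- T]. This
    contour is compact in the open right half-plane, hence in [Re z >= e] for some [e > 0], and the
    integrand is of order [expR (- (e t))]. *)
Lemma S_decay p (T : 'M[R]_p) S : semigroup_block T S -> stable T ->
  exists C e : R, [/\ 0 <= C, 0 < e &
    forall t i j, 0 <= t -> S t i j <= C * expR (- (e * t))].
Proof.
move=> hS sT.
have [gamma [[hg [gc _] off _ wind] gpos]] :=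
  @admissible_stable right_half_plane _ _ 1 sT ltr01 (fun z h => h).
have offM u : 0 <= u <= 1 -> ~~ eigenvalue (cmx (- 1 *: T)) (gamma u) by move=> /off[].
have [e e0 he] := path_Re_gt0 hg (fun u _ => gpos u).
have [K K0 hK] := contour_le hg.
have cr i j := ccont_res hg offM i j.
have [B B0 hB] : exists2 B, 0 <= B & forall i j u, 0 <= u <= 1 ->
    n1 (res (cmx (- 1 *: T)) (gamma u) i j) <= B.
  (* The bounds are chosen as a function of the entry, and their sum bounds all entries at once. *)
  have hb i j : {B | 0 <= B & forall u, 0 <= u <= 1 ->
    n1 (res (cmx (- 1 *: T)) (gamma u) i j) <= B} := cid2 (ccont_bounded ler01 (cr i j)).
  exists (\sum_i \sum_j s2val (hb i j)).
    by apply: sumr_ge0 => i _; apply: sumr_ge0 => j _; exact: s2valP (hb i j).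
  move=> i j u u01; apply: le_trans (s2valP' (hb i j) u u01) _.
  rewrite (bigD1 i)//= (bigD1 j)//= -addrA lerDl addr_ge0//.
    by apply: sumr_ge0 => k _; exact: s2valP (hb i k).
  by apply: sumr_ge0 => k _; apply: sumr_ge0 => l _; exact: s2valP (hb k l).
exists (K * (2 * B)), e; split => //; first by rewrite !mulr_ge0.
move=> t i j t0.
have := contour_exp hS ltr01 hg gc offM wind t0 => /matrixP /(_ i j).
rewrite !mxE mul1r => E.
have ce : ccont `[0, 1] (fun u => cexp (- gamma u * t%:C) * res (cmx (- 1 *: T)) (gamma u) i j).
  apply: ccontM => //; apply: ccont_exp; apply: ccontM; last exact: ccont_cst.
  by apply: ccontN; exact: ccont_path.
have H := hK _ (2 * expR (- (e * t)) * B) (cmeas_ccont (gamma := gamma)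
  (f := fun z => cexp (- z * t%:C) * res (cmx (- 1 *: T)) z i j) ce).
have {}H : n1 (two_pi_i * (S t i j)%:C) <= K * (2 * expR (- (e * t)) * B).
  rewrite -E; apply: H => u u01; apply: le_trans (n1M _ _) _.
  apply: ler_pM; rewrite ?n1_ge0 ?hB//; apply: le_trans (n1_cexp _) _.
  rewrite ler_pM2l// ler_expR !ReImE /= mulr0 subr0 mulNr lerN2.
  by apply: ler_wpM2r => //; exact: he.
have s0 := block_ge0 hS i j t0.
(* The factor [2 pi] is at least 1, so it may be dropped. *)
have : S t i j <= n1 (two_pi_i * (S t i j)%:C).
  rewrite /n1 !ReImE /= !(mul0r, mulr0, subr0, add0r) ?oppr0 normr0 add0r.
  rewrite normrM (ger0_norm s0) ler_peMl// ger0_norm ?mulr_ge0 ?pi_ge0//.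
  by have := pi_ge2 R; lra.
move=> /le_trans /(_ H) => h; apply: le_trans h _.
by rewrite -!mulrA ler_wpM2l// ler_pM2l// mulrC.
Qed.

End matrix_functions.

(** * The Laplace transform of [Theta] and its derivative on matrices *)

Section laplace_contour.
Context {R : realType} d (Omega : measurableType d) (P : probability Omega R).
Variable Theta : {RV P >-> R}.
Hypothesis Theta0 : forall w, 0 < Theta w.

Let mTheta : measurable_fun setT Theta.
Proof. exact: measurable_funPT. Qed.

Lemma claplaceE z : claplace P Theta z = cint P setT (fun w => cexp (- z * (Theta w)%:C)).
Proof. by rewrite /claplace /cexpectation unlock. Qed.

Lemma probT_lty : (P setT < +oo)%E.
Proof. by rewrite probability_setT ltry. Qed.

Section weight.
Variables (p : nat) (T : 'M[R]_p) (S : R -> 'M[R]_p) (x : R) (k : Omega -> R).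
Hypotheses (hS : semigroup_block T S) (x0 : 0 < x) (mk : measurable_fun setT k).
Hypothesis kb : forall e, 0 < e -> exists C, forall w, `|k w| * expR (- (e * Theta w)) <= C.

(** The weight [k] treats two functions at once: [k = 1] gives the Laplace transform and
    [k = - Theta] its derivative. Since the contour lies in [Re z >= e] for some [e > 0], the
    hypothesis [kb] dominates the integrand by a constant, and Fubini reduces to [contour_exp] at
    each value of [Theta]. *)
Lemma cauchy_laplace gamma g :
  admissible_contour right_half_plane (cmx (- x *: T)) gamma ->
  (forall z, 0 < Re z -> g z = cint P setT (fun w => (k w)%:C * cexp (- z * (Theta w)%:C))) ->
  cauchy_integral gamma g (cmx (- x *: T)) =
  cmx (\matrix_(i, j) \int[P]_w (k w * S (x * Theta w) i j)).
Proof.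
move=> [hg [gc _] off _ wind] hgE; set M := cmx _.
have gpos u : 0 <= u <= 1 -> 0 < Re (gamma u) by move=> /off[].
have offM u : 0 <= u <= 1 -> ~~ eigenvalue M (gamma u) by move=> /off[].
have [e e0 he] := path_Re_gt0 hg gpos.
have [C hC] := kb e0.
rewrite cauchy_integralE; apply/matrixP => i j; rewrite !mxE.
apply: (mulfI (two_pi_i_neq0 R)); rewrite mulrA divff ?two_pi_i_neq0// mul1r.
have cr := ccont_res hg offM i j.
have [B B0 hB] := ccont_bounded ler01 cr.
have b1 z w : e <= Re z -> n1 ((k w)%:C * cexp (- z * (Theta w)%:C)) <= 2 * C.
  move=> ez; apply: le_trans (n1M _ _) _; rewrite n1_real.
  apply: le_trans (_ : `|k w| * (2 * expR (- (e * Theta w))) <= _).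
    apply: ler_wpM2l => //; apply: le_trans (n1_cexp _) _.
    rewrite ler_pM2l// ler_expR !ReImE /= mulr0 subr0 mulNr lerN2.
    by rewrite ler_wpM2r// ltW.
  by rewrite mulrCA ler_pM2l.
have m1 z : cmeas (fun w => (k w)%:C * cexp (- z * (Theta w)%:C)).
  apply: cmeasM; first exact: cmeas_real.
  by apply: cmeas_exp; apply: cmeasM; [exact: cmeas_cst|exact: cmeas_real].
pose f (w : Omega) (z : R[i]) := (k w)%:C * cexp (- z * (Theta w)%:C) * res M z i j.
have -> : contour_integral gamma (fun z => g z * res M z i j) =
    contour_integral gamma (fun z => cint P setT (fun w => f w z)).
  apply: eq_contour => // u u01; rewrite hgE ?gpos// mulrC -cintZ//.
    by apply: eq_cint => w _; rewrite /f mulrC.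
  apply: (@cintegrable_dom _ _ _ P _ _ (fun=> 2 * C)) => //.
    by apply: integrable_cst => //; exact: probT_lty.
  by move=> w _; apply: b1; exact: he.
have mfu : cmeas (fun z : Omega * R => f z.1 (path_ext gamma z.2)).
  apply: cmeasM; last first.
    exact: (cmeas_comp (g := snd) measurable_snd (cmeas_ccont (gamma := gamma) (f := fun z => res M z i j) cr)).
  apply: cmeasM.
    exact: (cmeas_comp (g := fst) measurable_fst (cmeas_real mk)).
  apply: cmeas_exp; apply: cmeasM.
    exact: cmeasN (cmeas_comp (g := snd) measurable_snd (cmeas_path_ext hg)).
  exact: (cmeas_comp (g := fst) measurable_fst (cmeas_real mTheta)).
have ib : P.-integrable setT (EFin \o (fun=> 2 * C * B)).
  by apply: integrable_cst => //; exact: probT_lty.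
have fb w u : setT w -> 0 <= u <= 1 -> n1 (f w (gamma u)) <= 2 * C * B.
  move=> _ u01; apply: le_trans (n1M _ _) _; apply: ler_pM; rewrite ?n1_ge0 ?hB//.
  by apply: b1; exact: he.
have fE w : contour_integral gamma (f w) = two_pi_i * (k w * S (x * Theta w) i j)%:C.
  have := contour_exp hS x0 hg gc offM wind (ltW (Theta0 w)) => /matrixP /(_ i j).
  rewrite !mxE => E; rewrite rmorphM /= mulrCA -E -(contourZ hg).
    by apply: eq_contour => // u _; rewrite mulrA.
  apply: ccontM => //; apply: ccont_exp; apply: ccontM; last exact: ccont_cst.
  by apply: ccontN; exact: ccont_path.
rewrite (contour_fubini hg measurableT mfu ib fb).
have iS := contour_fubini_integrable hg measurableT mfu ib fb.
have -> : cint P setT (fun w => contour_integral gamma (f w)) =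
   cint P setT (fun w => two_pi_i * (k w * S (x * Theta w) i j)%:C).
  by apply: eq_cint => w _; exact: fE.
rewrite cintZ ?cint_real//.
have := cintegrableZ two_pi_i^-1 measurableT iS; apply: eq_cintegrable => // w _.
by rewrite fE mulrA mulVf ?two_pi_i_neq0// mul1r.
Qed.

End weight.
End laplace_contour.

Section exponential_remainder.
Context {R : realType}.
Notation mu := (@lebesgue_measure R).

Let ccont_lin (v : R[i]) A : ccont A (fun t : R => t%:C * v).
Proof.
apply: ccontM; last exact: ccont_cst.
by apply: ccont_real; apply: (@continuous_subspaceT _ _ _ (fun v : R => v)) => u; exact: cvg_id.
Qed.

Let cder_lin (v : R[i]) u : cder (fun t : R => t%:C * v) u v.
Proof.
apply: cder_eq (cderM (cder_real (der_id u)) (cder_cst v u)) _.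
by rewrite mulr0 addr0 mul1r.
Qed.

Let n1_cint01_le (f : R -> R[i]) B : ccont `[0, 1] f ->
  (forall u, 0 <= u <= 1 -> n1 (f u) <= B) -> n1 (cint mu `[0, 1] f) <= 2 * B.
Proof.
move=> [fr fi] fB; rewrite /n1 /= mulr_natl mulr2n.
have h (g : R -> R) : {within `[0, 1], continuous g} ->
    (forall u, 0 <= u <= 1 -> `|g u| <= B) -> `|\int[mu]_(u in `[0, 1]) g u| <= B.
  move=> cg gB.
  have ig : mu.-integrable `[0, 1] (EFin \o g).
    by apply: continuous_compact_integrable => //; exact: segment_compact.
  apply: le_trans (le_normr_Rintegral _ ig) _ => //.
  have <- : \int[mu]_(u in `[0, 1]) B = B.
    by rewrite Rintegral_cst// (_ : fine _ = 1) ?mulr1//; exact: (congr1 fine mu01).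
  apply: le_Rintegral => //.
  - exact: (integrable_abse ig).
  - by apply: integrable_cst => //; exact: lebesgue_itvcc_lty.
have h1 : `|\int[mu]_(x in `[0, 1]) Re (f x)| <= B.
  by apply: h => // u u01; apply: le_trans (fB u u01); exact: Re_le_n1.
have h2 : `|\int[mu]_(x in `[0, 1]) Im (f x)| <= B.
  by apply: h => // u u01; apply: le_trans (fB u u01); exact: Im_le_n1.
exact: lerD h1 h2.
Qed.

Lemma n1_realM (t : R) (v : R[i]) : 0 <= t <= 1 -> n1 (t%:C * v) <= n1 v.
Proof.
move=> /andP[t0 t1]; apply: le_trans (n1M _ _) _.
by rewrite n1_real ger0_norm// ler_piMl// n1_ge0.
Qed.

Lemma n1_cexp_le (v : R[i]) : n1 (cexp v) <= 2 * expR (n1 v).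
Proof.
apply: le_trans (n1_cexp _) _; rewrite ler_pM2l// ler_expR.
exact: le_trans (ler_norm _) (Re_le_n1 _).
Qed.

(** Taylor's formula with integral remainder on the segment from 0 to [v], here at order one and in
    the next lemma at order two. Each integration costs a factor 2, and the exponential another one:
    hence 4, then 8. *)
Lemma cexp_sub1_le (v : R[i]) : n1 (cexp v - 1) <= 4 * n1 v * expR (n1 v).
Proof.
have ce A : ccont A (fun t : R => cexp (t%:C * v)) by exact: ccont_exp.
have -> : cexp v - 1 = cint mu `[0, 1] (fun t => v * cexp (t%:C * v)).
  rewrite (complex_FTC ltr01 (ce _)).
  - by rewrite mul1r mul0r cexp0.
  - by apply: ccontM => //; exact: ccont_cst.
  - by move=> u _; exact: cder_exp.
apply: le_trans (n1_cint01_le (B := n1 v * (2 * expR (n1 v))) _ _) _.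
- by apply: ccontM => //; exact: ccont_cst.
- move=> u u01; apply: le_trans (n1M _ _) _; apply: ler_wpM2l; first exact: n1_ge0.
  apply: le_trans (n1_cexp_le _) _; rewrite ler_pM2l// ler_expR; exact: n1_realM.
- by rewrite le_eqVlt; apply/orP; left; apply/eqP; ring.
Qed.

Lemma cexp_sub1_sub_le (v : R[i]) : n1 (cexp v - 1 - v) <= 8 * n1 v ^+ 2 * expR (n1 v).
Proof.
have ce A : ccont A (fun t : R => cexp (t%:C * v) - t%:C * v) by apply: ccontB => //; exact: ccont_exp.
have -> : cexp v - 1 - v = cint mu `[0, 1] (fun t => v * (cexp (t%:C * v) - 1)).
  rewrite (complex_FTC ltr01 (ce _)).
  - by rewrite mul1r mul0r cexp0 subr0; ring.
  - apply: ccontM; first exact: ccont_cst.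
    by apply: ccontB; [exact: ccont_exp|exact: ccont_cst].
  - move=> u _; apply: cder_eq (cderD (cder_exp (cder_lin v u)) (cderN (cder_lin v u))) _.
    by rewrite mulrBr mulr1.
apply: le_trans (n1_cint01_le (B := n1 v * (4 * n1 v * expR (n1 v))) _ _) _.
- apply: ccontM; first exact: ccont_cst.
  by apply: ccontB; [exact: ccont_exp|exact: ccont_cst].
- move=> u u01; apply: le_trans (n1M _ _) _; apply: ler_wpM2l; first exact: n1_ge0.
  apply: le_trans (cexp_sub1_le _) _; have h := n1_realM v u01.
  by apply: ler_pM; rewrite ?mulr_ge0 ?n1_ge0 ?expR_ge0 ?ler_expR// ler_pM2l.
- by rewrite le_eqVlt; apply/orP; left; apply/eqP; ring.
Qed.

(** Square the inequality [x <= expR x] at [x = c t / 2]. *)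
Lemma sqr_expN_le (c t : R) : 0 < c -> 0 <= t -> t ^+ 2 * expR (- (c * t)) <= 4 / c ^+ 2.
Proof.
move=> c0 t0; rewrite expRN ler_pdivrMr ?expR_gt0//.
have -> : expR (c * t) = expR (c * t / 2) ^+ 2.
  by rewrite -expRM_natl; congr expR; field.
have h := expR_ge1Dx (c * t / 2).
have h2 : c * t / 2 <= expR (c * t / 2) by lra.
have q0 : 0 <= c * t / 2 by rewrite !mulr_ge0// ltW.
have -> : t ^+ 2 = 4 / c ^+ 2 * (c * t / 2) ^+ 2 by field; rewrite gt_eqF.
by rewrite ler_wpM2l ?divr_ge0 ?sqr_ge0// ler_pXn2r ?nnegrE ?expR_ge0.
Qed.

Lemma id_expN_le (c t : R) : 0 < c -> 0 <= t -> t * expR (- (c * t)) <= c^-1.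
Proof.
move=> c0 t0; rewrite expRN ler_pdivrMr ?expR_gt0// ler_pdivlMl//.
by have := expR_ge1Dx (c * t); lra.
Qed.

End exponential_remainder.

Lemma derive1_eq (K : numFieldType) (f : K -> K) (z l : K) :
  (forall eps : K, 0 < eps -> exists2 del, 0 < del & forall h, h != 0 -> `|h| < del ->
     `|h^-1 * (f (h + z) - f z) - l| <= eps) ->
  derive1 (f : K -> K^o) z = l.
Proof.
move=> H; rewrite /derive1; apply: cvg_lim; first exact: norm_hausdorff.
apply/cvgrPdist_le => /= eps eps0; have [del del0 hdel] := H eps eps0.
near=> h; rewrite distrC; apply: hdel; first by near: h; exact: nbhs_dnbhs_neq.
by near: h; exact: dnbhs0_lt.
Unshelve. all: by end_near. Qed.

Section laplace_derivative.
Context {R : realType} d (Omega : measurableType d) (P : probability Omega R).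
Variable Theta : {RV P >-> R}.
Hypothesis Theta0 : forall w, 0 < Theta w.

Let mTheta : measurable_fun setT Theta.
Proof. exact: measurable_funPT. Qed.

Let E (z : R[i]) (w : Omega) := cexp (- z * (Theta w)%:C).

Let mE z : cmeas (E z).
Proof. by apply: cmeas_exp; apply: cmeasM; [exact: cmeas_cst|exact: cmeas_real]. Qed.

Let n1E z w : n1 (E z w) <= 2 * expR (- (Re z * Theta w)).
Proof.
apply: le_trans (n1_cexp _) _.
by rewrite !ReImE /= mulr0 subr0 mulNr.
Qed.

Let ibd C : P.-integrable setT (EFin \o (fun=> C)).
Proof. by apply: integrable_cst => //; exact: probT_lty. Qed.

Let iE z : 0 < Re z -> cintegrable P setT (E z).
Proof.
move=> z0; apply: (@cintegrable_dom _ _ _ P _ _ (fun=> 2)) => // w _.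
apply: le_trans (n1E _ _) _; rewrite ger_pMr// -expR0 ler_expR oppr_le0.
by rewrite mulr_ge0// ltW.
Qed.

Definition claplace' (z : R[i]) :=
  cint P setT (fun w => (- Theta w)%:C * cexp (- z * (Theta w)%:C)).

Let iTE z : 0 < Re z -> cintegrable P setT (fun w => (- Theta w)%:C * E z w).
Proof.
move=> z0; apply: (@cintegrable_dom _ _ _ P _ _ (fun=> 2 * (Re z)^-1)) => //.
  by apply: cmeasM => //; apply: cmeas_real; exact: measurableT_comp.
move=> w _; apply: le_trans (n1M _ _) _; rewrite n1_real normrN gtr0_norm//.
apply: le_trans (ler_wpM2l (ltW (Theta0 w)) (n1E z w)) _.
by rewrite mulrCA ler_pM2l// id_expN_le// ltW.
Qed.

(** Under the expectation, the error is [cexp (- z Theta)] times a second-order Taylor remainder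
    divided by [h], of order [n1 h * Theta^2 * expR (n1 h * Theta)]. As [n1 h <= Re z / 2], a factor
    [expR (- (c Theta))] survives and absorbs [Theta^2] by [sqr_expN_le], whatever the law of
    [Theta]. The constant 64 is 2 for the exponential, 4 for [h^-1] and 8 for the remainder. *)
Lemma claplace_quotient z : 0 < Re z -> exists2 K, 0 <= K & forall h, h != 0 ->
  n1 h <= Re z / 2 ->
  n1 (h^-1 * (claplace P Theta (h + z) - claplace P Theta z) - claplace' z) <= K * n1 h.
Proof.
move=> z0; pose c := Re z / 2; have c0 : 0 < c by rewrite divr_gt0.
exists (2 * (64 * (4 / c ^+ 2))); first by rewrite !mulr_ge0 ?invr_ge0 ?sqr_ge0.
move=> h h0 hz.
have hr0 : 0 < Re (h + z).
  rewrite ReD; have := le_trans (Re_le_n1 h) hz; rewrite ler_norml => /andP[+ _]; lra.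
pose F w := E z w * (h^-1 * (cexp (- h * (Theta w)%:C) - 1 - - h * (Theta w)%:C)).
have FE : cint P setT F = h^-1 * (claplace P Theta (h + z) - claplace P Theta z) - claplace' z.
  have HE y : claplace P Theta y = cint P setT (E y) by rewrite claplaceE.
  have iD : cintegrable P setT (fun w => E (h + z) w - E z w).
    by apply: cintegrableD; [|exact: iE|apply: cintegrableN => //; exact: iE].
  rewrite !HE -(cintB measurableT (iE hr0) (iE z0)) -(cintZ _ measurableT iD).
  rewrite /claplace' -(cintB measurableT (cintegrableZ _ measurableT iD) (iTE z0)).
  apply: eq_cint => w _; rewrite /F /E opprD mulrDl cexpD rmorphN.
  by field.
rewrite -FE -mulrA -[X in _ <= 2 * X]mulr1.
have -> : 64 * (4 / c ^+ 2) * n1 h * 1 = \int[P]_w (64 * (4 / c ^+ 2) * n1 h).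
  by rewrite Rintegral_cst// (_ : fine _ = 1)//; exact: (congr1 fine (probability_setT P)).
apply: n1_cint_le => //.
  apply: cmeasM => //; apply: cmeasM; first exact: cmeas_cst.
  apply: cmeasB; last by apply: cmeasM; [exact: cmeas_cst|exact: cmeas_real].
  apply: cmeasB; last exact: cmeas_cst.
  by apply: cmeas_exp; apply: cmeasM; [exact: cmeas_cst|exact: cmeas_real].
move=> w _; have t0 := Theta0 w; set t := Theta w in t0 *.
have nh : 0 < n1 h by rewrite lt_neqAle n1_ge0 andbT eq_sym; apply: contra h0 => /eqP /n1_eq0 ->.
have hv : n1 (- h * t%:C) = n1 h * t.
  by rewrite /n1 !ReImE /= !mulr0 subr0 add0r !normrM !normrN (gtr0_norm t0) -mulrDl.
have hinv : n1 h^-1 <= 4 / n1 h.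
  apply: le_trans (n1V_le (e := n1 h / 2) _ _) _.
  - by rewrite divr_gt0.
  - rewrite /n1 -[Re h ^+ 2]real_normK ?num_real// -[Im h ^+ 2]real_normK ?num_real//.
    by have := sqr_ge0 (`|Re h| - `|Im h|); rewrite /n1; nra.
  - by rewrite invf_div; rewrite le_eqVlt; apply/orP; left; apply/eqP; field; rewrite gt_eqF.
have hx := cexp_sub1_sub_le (- h * t%:C); rewrite hv in hx.
have b1 : n1 (F w) <= 2 * expR (- (Re z * t)) *
    (4 / n1 h * (8 * (n1 h * t) ^+ 2 * expR (n1 h * t))).
  apply: le_trans (n1M _ _) _; apply: ler_pM (n1_ge0 _) (n1_ge0 _) (n1E z w) _.
  apply: le_trans (n1M _ _) _; exact: ler_pM (n1_ge0 _) (n1_ge0 _) hinv hx.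
apply: le_trans b1 _.
have -> : 2 * expR (- (Re z * t)) * (4 / n1 h * (8 * (n1 h * t) ^+ 2 * expR (n1 h * t))) =
   64 * n1 h * (t ^+ 2 * (expR (- (Re z * t)) * expR (n1 h * t))).
  by field; rewrite gt_eqF.
rewrite [leRHS]mulrAC; apply: ler_wpM2l; first by rewrite mulr_ge0 ?n1_ge0.
apply: le_trans (sqr_expN_le c0 (ltW t0)).
rewrite ler_wpM2l ?sqr_ge0// -expRD ler_expR -mulNr -mulrDl -mulNr ler_wpM2r ?(ltW t0)//.
by rewrite /c; lra.
Qed.

Lemma cderive_claplace z : 0 < Re z -> cderive (claplace P Theta) z = claplace' z.
Proof.
move=> z0; have [K K0 hK] := claplace_quotient z0.
apply: (@derive1_eq R[i]) => eps eps0.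
(* A positive element of [R[i]] is a positive real number. *)
have /andP[/eqP ie re0] : (Im eps == 0) && (0 < Re eps).
  by move: eps0; rewrite ltcE /= eq_sym.
(* Since [n1 h <= 2 * del], the first term ensures the hypothesis of [claplace_quotient] and the
   second makes its bound at most [eps]; [K + 1] avoids a division by 0. *)
pose del := Num.min (Re z / 4) (Re eps / (2 * (K + 1))).
have K10 : 0 < 2 * (K + 1) by rewrite mulr_gt0// ltr_wpDl.
have del0 : 0 < del by rewrite lt_min !divr_gt0.
exists del%:C => [|h h0]; first by rewrite ltcR.
rewrite -[`|h|]/((Normc.normc h)%:C) ltcR => hd.
have hn : n1 h <= 2 * del.
  by apply: le_trans (n1_le_normc h) _; rewrite ler_pM2l// ltW.
have d1 : del <= Re z / 4 by rewrite ge_min lexx.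
have d2 : del <= Re eps / (2 * (K + 1)) by rewrite ge_min lexx orbT.
have hK' := hK h h0 _.
set D := _ - _ in hK' *.
have -> : eps = (Re eps)%:C by apply: eqC.
rewrite -[`|D|]/((Normc.normc D)%:C) lecR.
apply: le_trans (_ : n1 D <= _).
  rewrite -(@ler_pXn2r _ 2)// ?nnegrE ?n1_ge0 ?normc_ge0'// sqr_normc' /n1.
  rewrite -[Re D ^+ 2]real_normK ?num_real// -[Im D ^+ 2]real_normK ?num_real//.
  by rewrite sqrrD lerD2r lerDl mulrn_wge0// mulr_ge0.
apply: le_trans (hK' _) _; first by lra.
move: d2; rewrite ler_pdivlMr// => d2.
apply: le_trans (ler_wpM2l K0 hn) _; nra.
Qed.

End laplace_derivative.

Section laplace_matrix_functions.
Context {R : realType} d (Omega : measurableType d) (P : probability Omega R).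
Variable Theta : {RV P >-> R}.
Hypothesis Theta0 : forall w, 0 < Theta w.
Variables (p : nat) (T : 'M[R]_p) (S : R -> 'M[R]_p) (x : R).
Hypotheses (hS : semigroup_block T S) (sT : stable T) (x0 : 0 < x).

Lemma matrix_function_claplace :
  matrix_function right_half_plane (claplace P Theta) (cmx (- x *: T)) =
  cmx (\matrix_(i, j) \int[P]_w S (x * Theta w) i j).
Proof.
apply: matrix_functionE; split.
  by have [gamma [h _]] := @admissible_stable _ right_half_plane _ _ _ sT x0 (fun z h => h); exists gamma.
move=> gamma hg.
rewrite (@cauchy_laplace _ _ _ P Theta Theta0 _ _ S _ (fun=> 1) hS x0)//.
- congr cmx; apply/matrixP => i j; rewrite !mxE.
  by apply: eq_Rintegral => w _; rewrite mul1r.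
- move=> e e0; exists 1 => w; rewrite normr1 mul1r -expR0 ler_expR oppr_le0.
  by rewrite mulr_ge0// ltW.
- by move=> z _; rewrite claplaceE; apply: eq_cint => w _; rewrite mul1r.
Qed.

Lemma matrix_function_cderive_claplace :
  matrix_function right_half_plane (cderive (claplace P Theta)) (cmx (- x *: T)) =
  cmx (\matrix_(i, j) \int[P]_w (- Theta w * S (x * Theta w) i j)).
Proof.
apply: matrix_functionE; split.
  by have [gamma [h _]] := @admissible_stable _ right_half_plane _ _ _ sT x0 (fun z h => h); exists gamma.
move=> gamma hg.
rewrite (@cauchy_laplace _ _ _ P Theta Theta0 _ _ S _ (fun w => - Theta w) hS x0)//.
- by apply: measurableT_comp => //; exact: measurable_funPT.
- move=> e e0; exists e^-1 => w; rewrite normrN gtr0_norm//.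
  by apply: id_expN_le => //; exact: ltW.
- by move=> z z0; rewrite cderive_claplace.
Qed.

End laplace_matrix_functions.

(** * Transition semigroups of a Markov jump process *)

Lemma der_eps (R : realType) (f : R -> R) (x l : R) :
  (forall eps : R, 0 < eps -> exists2 del, 0 < del & forall h, h != 0 -> `|h| < del ->
     `|h^-1 * (f (h + x) - f x) - l| <= eps) -> der f x l.
Proof.
move=> H.
have C : (fun h => h^-1 *: ((f \o shift x) (h *: (1 : R)) - f x)) @ 0^' --> l.
  apply/cvgrPdist_le => eps eps0; have [del del0 hdel] := H eps eps0.
  near=> h; rewrite distrC /= [h *: 1]mulr1; apply: hdel.
    by near: h; exact: nbhs_dnbhs_neq.
  by near: h; exact: dnbhs0_lt.
apply: DeriveDef; first by apply/cvg_ex; exists l.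
by rewrite /derive; apply: cvg_lim.
Unshelve. all: by end_near. Qed.

Lemma cvg_sum (R : realType) (U : Type) (F : set_system U) {FF : Filter F}
    I (r : seq I) (f : I -> U -> R) (l : I -> R) :
  (forall i, f i x @[x --> F] --> l i) ->
  (fun x => \sum_(i <- r) f i x) @ F --> \sum_(i <- r) l i.
Proof.
move=> fl; elim: r => [|a r ih].
  rewrite big_nil (_ : (fun x => _) = (fun=> 0)); first exact: cvg_cst.
  by apply/funext => x; rewrite big_nil.
rewrite big_cons (_ : (fun x => _) = (fun x => f a x + \sum_(i <- r) f i x)); last first.
  by apply/funext => x; rewrite big_cons.
by apply: cvgD.
Qed.

Section semigroup.
Context {R : realType} (m : nat) (Pt : R -> 'M[R]_m) (Q : 'M[R]_m).
Hypotheses (hP : transition_semigroup Pt) (hQ : has_intensity Pt Q).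

Let P0 : Pt 0 = 1%:M. Proof. by case: hP. Qed.
Let PD s t : 0 <= s -> 0 <= t -> Pt (s + t) = Pt s *m Pt t. Proof. by case: hP => _ h _ _; exact: h. Qed.
Lemma Pt_ge0 t i j : 0 <= t -> 0 <= Pt t i j. Proof. by case: hP => _ _ h _; exact: h. Qed.
Lemma Pt_sum1 t i : 0 <= t -> \sum_j Pt t i j = 1. Proof. by case: hP => _ _ _ h; exact: h. Qed.

Lemma Pt_le1 t i j : 0 <= t -> Pt t i j <= 1.
Proof.
move=> t0; rewrite -(Pt_sum1 i t0) (bigD1 j)//= lerDl sumr_ge0// => k _.
exact: Pt_ge0.
Qed.

(** The rows of [Pt t] are probability weights, so multiplication by it averages entries. Estimates
    near time 0 are carried in this way to all times without loss. *)
Lemma stochastic_le (t : R) (B : 'M[R]_m) (e : R) i j : 0 <= t ->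
  (forall k, `|B k j| <= e) -> `|(Pt t *m B) i j| <= e.
Proof.
move=> t0 Be; rewrite mxE; apply: le_trans (ler_norm_sum _ _ _) _.
rewrite -[leRHS]mul1r -(Pt_sum1 i t0) mulr_suml; apply: ler_sum => k _.
by rewrite normrM ger0_norm ?Pt_ge0// ler_wpM2l ?Pt_ge0.
Qed.

Let G (h : R) : 'M[R]_m := h^-1 *: (Pt h - 1%:M).

Let G_cvg i j : (fun h => G h i j) @ 0^'+ --> Q i j.
Proof.
rewrite (_ : (fun h => _) = (fun h => h^-1 * (Pt h i j - (i == j)%:R))); last first.
  by apply/funext => h; rewrite !mxE.
exact: hQ.
Qed.

Let P_cvg i j : (fun h => Pt h i j) @ 0^'+ --> (1%:M : 'M[R]_m) i j.
Proof.
have H : (fun h => h * G h i j + (1%:M : 'M[R]_m) i j) @ 0^'+ --> 0 * Q i j + (1%:M : 'M[R]_m) i j.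
  apply: cvgD; last exact: cvg_cst.
  apply: cvgM; last exact: G_cvg.
  by apply: cvg_at_right_filter; exact: cvg_id.
rewrite mul0r add0r in H; apply: cvg_trans H; apply: near_eq_cvg.
near=> h; have h0 : h != 0.
  by rewrite gt_eqF//; near: h; exact: nbhs_right_gt.
by rewrite !mxE mulrA divff// mul1r subrK.
Unshelve. all: by end_near. Qed.

Let PG_cvg t i j : (fun h => (Pt t *m G h) i j) @ 0^'+ --> (Pt t *m Q) i j.
Proof.
rewrite mxE (_ : (fun h => _) = (fun h => \sum_k Pt t i k * G h k j)); last first.
  by apply/funext => h; rewrite mxE.
by apply: cvg_sum => k; apply: cvgM; [exact: cvg_cst|exact: G_cvg].
Qed.

Let GP_cvg t i j : (fun h => (G h *m Pt t) i j) @ 0^'+ --> (Q *m Pt t) i j.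
Proof.
rewrite mxE (_ : (fun h => _) = (fun h => \sum_k G h i k * Pt t k j)); last first.
  by apply/funext => h; rewrite mxE.
by apply: cvg_sum => k; apply: cvgM; [exact: G_cvg|exact: cvg_cst].
Qed.

(** Both sides are the limit of [(Pt (t + h) - Pt t) / h] from the right, with [Pt (t + h)] factored
    in the two possible orders. *)
Lemma Pt_comm t : 0 <= t -> Pt t *m Q = Q *m Pt t.
Proof.
move=> t0; apply/matrixP => i j.
apply: (@cvg_unique _ (@norm_hausdorff _ R) ((fun h => (Pt t *m G h) i j) @ 0^'+)).
  exact: PG_cvg.
have H := GP_cvg (t := t) (i := i) (j := j); apply: cvg_trans H; apply: near_eq_cvg; near=> h.
have h0 : 0 <= h by apply: ltW; near: h; exact: nbhs_right_gt.
by rewrite /G -scalemxAl -scalemxAr mulmxBl mulmxBr mul1mx mulmx1 -!PD// (addrC h t).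
Unshelve. all: by end_near. Qed.

Let B1_cvg i j : (fun h => (G h - Q) i j) @ 0^'+ --> (0 : R).
Proof.
rewrite (_ : (fun h => _) = (fun h => G h i j - Q i j)); last first.
  by apply/funext => h; rewrite !mxE.
have H : (fun h => G h i j - Q i j) @ 0^'+ --> Q i j - Q i j.
  by apply: cvgB; [exact: G_cvg|exact: cvg_cst].
by rewrite subrr in H.
Qed.

(** Meant for left difference quotients: there [Pt (t + h)] is factored out, and the error is this
    difference at [- h]. *)
Let B2_cvg i j : (fun h => (G h - Pt h *m Q) i j) @ 0^'+ --> (0 : R).
Proof.
rewrite (_ : (fun h => _) = (fun h => G h i j - \sum_k Pt h i k * Q k j)); last first.
  by apply/funext => h; rewrite !mxE.
have H : (fun h => G h i j - \sum_k Pt h i k * Q k j) @ 0^'+ -->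
    Q i j - \sum_k (1%:M : 'M[R]_m) i k * Q k j.
  apply: cvgB; first exact: G_cvg.
  by apply: cvg_sum => k; apply: cvgM; [exact: P_cvg|exact: cvg_cst].
have E : \sum_k (1%:M : 'M[R]_m) i k * Q k j = Q i j.
  by have := mul1mx Q => /matrixP /(_ i j); rewrite mxE.
by rewrite E subrr in H.
Qed.

Let B3_cvg i j : (fun h => (Pt h - 1%:M) i j) @ 0^'+ --> (0 : R).
Proof.
rewrite (_ : (fun h => _) = (fun h => Pt h i j - (1%:M : 'M[R]_m) i j)); last first.
  by apply/funext => h; rewrite !mxE.
have H : (fun h => Pt h i j - (1%:M : 'M[R]_m) i j) @ 0^'+ -->
    (1%:M : 'M[R]_m) i j - (1%:M : 'M[R]_m) i j.
  by apply: cvgB; [exact: P_cvg|exact: cvg_cst].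
by rewrite subrr in H.
Qed.

Let uniform_small (B : R -> 'M[R]_m) : (forall i j, (fun h => B h i j) @ 0^'+ --> (0 : R)) ->
  forall e, 0 < e -> exists2 del, 0 < del &
    forall h, 0 < h < del -> forall i j, `|B h i j| <= e.
Proof.
move=> Bc e e0.
have : \forall h \near 0^'+, forall ij : 'I_m * 'I_m, `|B h ij.1 ij.2| <= e.
  apply: filter_forall => -[i j] /=.
  have /cvgrPdist_le /(_ e e0) := Bc i j.
  by apply: filterS => h; rewrite sub0r normrN.
case => del /= del0 hdel; exists del => // h /andP[h0 hd] i j.
apply: (hdel h _ h0 (i, j)).
by rewrite /= sub0r normrN gtr0_norm.
Qed.

Lemma Pt_uniform_continuous e : 0 < e -> exists2 del, 0 < del &
  forall s t, 0 <= s -> 0 <= t -> `|s - t| < del -> forall i j, `|Pt s i j - Pt t i j| <= e.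
Proof.
move=> e0; have [del del0 hdel] := uniform_small B3_cvg e0.
have one s t i j : 0 <= s -> s < t -> t - s < del -> `|Pt t i j - Pt s i j| <= e.
  move=> s0 st ts; have -> : Pt t i j - Pt s i j = (Pt s *m (Pt (t - s) - 1%:M)) i j.
    rewrite mulmxBr mulmx1 -PD ?subr_ge0 ?(ltW st)// (_ : s + (t - s) = t); last by ring.
    by rewrite [in RHS]mxE [in RHS]mxE.
  by apply: stochastic_le => // k; apply: hdel; rewrite subr_gt0 st.
exists del => // s t s0 t0 st i j; case: (ltgtP s t) => h.
- by rewrite distrC; apply: one => //; move: st; rewrite ltr0_norm ?subr_lt0// opprB.
- by apply: one => //; move: st; rewrite gtr0_norm ?subr_gt0.
- by rewrite h subrr normr0 ltW.
Qed.

(** Nothing is assumed of [Pt] at negative times; reflecting time gives a function continuous on the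
    whole line with the same values at nonnegative times. *)
Lemma Pt_abs_continuous i j : continuous (fun t : R => Pt `|t| i j).
Proof.
move=> t; apply/cvgrPdist_le => e e0.
have [del del0 hdel] := Pt_uniform_continuous e0.
near=> s; apply: hdel => //.
apply: le_lt_trans (ler_dist_dist _ _) _.
by near: s; exact: cvgr_dist_lt.
Unshelve. all: by end_near. Qed.

(** The one-sided derivative at 0 gives a two-sided one at [t > 0]: factor out [Pt t] for [h > 0]
    and [Pt (t + h)] for [h < 0]. In both cases a stochastic matrix multiplies an error that is
    small uniformly in the entries. *)
Lemma Pt_der t i j : 0 < t -> der (fun s : R => Pt `|s| i j) t ((Pt t *m Q) i j).
Proof.
move=> t0; apply: der_eps => e e0.
have [d1 d10 hd1] := uniform_small B1_cvg e0.
have [d2 d20 hd2] := uniform_small B2_cvg e0.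
exists (Num.min t (Num.min d1 d2)) => [|h h0]; first by rewrite !lt_min t0 d10.
rewrite !lt_min => /andP[ht /andP[h1 h2]].
have ht0 : 0 < h + t by move: ht; rewrite ltr_norml => /andP[+ _]; lra.
rewrite (gtr0_norm t0) (gtr0_norm ht0).
case: (ltgtP h 0) h0 => // hs _.
  have k0 : 0 < - h by rewrite oppr_gt0.
  rewrite ltr0_norm// in h1 h2.
  have E : Pt t = Pt (h + t) *m Pt (- h).
    by rewrite -PD ?(ltW ht0) ?(ltW k0)//; congr Pt; ring.
  have -> : h^-1 * (Pt (h + t) i j - Pt t i j) - (Pt t *m Q) i j =
     (Pt (h + t) *m (G (- h) - Pt (- h) *m Q)) i j.
    rewrite mulmxBr mulmxA -E /G -scalemxAr mulmxBr -E mulmx1.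
    by rewrite [in RHS]mxE [in RHS]mxE [X in _ = _ + X]mxE [in RHS]mxE [in RHS]mxE invrN; ring.
  by apply: stochastic_le => [|k]; [exact: ltW|apply: hd2; rewrite k0].
rewrite gtr0_norm// in h1.
have -> : h^-1 * (Pt (h + t) i j - Pt t i j) - (Pt t *m Q) i j =
   (Pt t *m (G h - Q)) i j.
  rewrite mulmxBr /G -scalemxAr mulmxBr -PD ?(ltW t0) ?(ltW hs)// mulmx1 (addrC t).
  by rewrite [in RHS]mxE [in RHS]mxE [X in _ = _ + X]mxE [in RHS]mxE [in RHS]mxE.
by apply: stochastic_le => [|k]; [exact: ltW|apply: hd1; rewrite hs].
Qed.

(** By commutation the derivative is also [Q *m Pt t], whose row [i] vanishes with that of [Q]. *)
Lemma Pt_cst_row i : (forall j, Q i j = 0) -> forall t j, 0 <= t -> Pt t i j = (i == j)%:R.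
Proof.
move=> Qi t j; rewrite le_eqVlt => /predU1P[<-|t0]; first by rewrite P0 mxE.
have := @real_FTC R (fun s : R => Pt `|s| i j) (fun=> 0) 0 t t0.
rewrite Rintegral_cst// mul0r normr0 gtr0_norm// P0 [_%:M _ _]mxE => H.
apply/eqP; rewrite -subr_eq0; apply/eqP; rewrite -H//.
- by apply: continuous_subspaceT; exact: Pt_abs_continuous.
- by move=> s; exact: cvg_cst.
- move=> u /andP[u0 _]; have := Pt_der i j u0.
  rewrite Pt_comm ?(ltW u0)// mxE big1// => k _; by rewrite Qi mul0r.
Qed.

End semigroup.

(** The function [s |-> Pt1 s *m Pt2 (t - s)] has derivative 0 because [Q] commutes with [Pt2]; its
    values at 0 and [t] are the two semigroups. The lemma is needed because [transient] comes with a
    process, hence a semigroup, of its own. *)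
Lemma semigroup_unique (R : realType) (m : nat) (Pt1 Pt2 : R -> 'M[R]_m) (Q : 'M[R]_m) :
  transition_semigroup Pt1 -> has_intensity Pt1 Q ->
  transition_semigroup Pt2 -> has_intensity Pt2 Q ->
  forall t, 0 <= t -> Pt1 t = Pt2 t.
Proof.
move=> h1 q1 h2 q2 t; rewrite le_eqVlt => /predU1P[<-|t0].
  by case: h1 => -> _ _ _; case: h2 => -> _ _ _.
apply/matrixP => i j.
pose F (s : R) := \sum_k Pt1 `|s| i k * Pt2 `|t - s| k j.
have cF : continuous F.
  have -> : F = fun s : R => \sum_k Pt1 `|s| i k * Pt2 `|t - s| k j by [].
  move=> s; apply: cvg_sum => k; apply: cvgM; first exact: (Pt_abs_continuous h1 q1).
  apply: (@continuous_comp _ _ _ (fun s : R => t - s) (fun s : R => Pt2 `|s| k j)).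
    by apply: cvgB; [exact: cvg_cst|exact: cvg_id].
  exact: (Pt_abs_continuous h2 q2).
have := @real_FTC R F (fun=> 0) 0 t t0.
rewrite Rintegral_cst// mul0r => H.
have : 0 = F t - F 0.
  apply: H; first exact: continuous_subspaceT.
    by move=> s; exact: cvg_cst.
  move=> u /andP[u0 ut]; have tu : 0 < t - u by rewrite subr_gt0.
  have d0 : der (fun s : R => t - s) u (-1).
    by apply: der_eq (derB (der_cst t u) (der_id u)) _; rewrite sub0r.
  have d k := derM (Pt_der h1 q1 i k u0) (der_comp d0 (Pt_der h2 q2 k j tu)).
  apply: der_eq (der_sum d) _.
  rewrite big_split /= (gtr0_norm u0) (gtr0_norm tu).
  have -> : \sum_k (Pt1 u *m Q) i k * Pt2 (t - u) k j = (Pt1 u *m Q *m Pt2 (t - u)) i j.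
    by rewrite [RHS]mxE.
  have -> : \sum_k Pt1 u i k * ((Pt2 (t - u) *m Q) k j * -1) = - (Pt1 u *m (Pt2 (t - u) *m Q)) i j.
    by rewrite [in RHS]mxE -sumrN; apply: eq_bigr => k _; rewrite mulrN1 mulrN.
  by rewrite (Pt_comm h2 q2 (ltW tu)) mulmxA subrr.
move/esym/eqP; rewrite subr_eq0 /F subr0 subrr normr0 gtr0_norm// => /eqP.
case: h1 => e1 _ _ _; case: h2 => e2 _ _ _; rewrite e1 e2.
rewrite (bigD1 j)//= big1 ?addr0; last first.
  by move=> k kj; rewrite mxE (negbTE kj) mulr0.
rewrite mxE eqxx mulr1 => ->; rewrite (bigD1 i)//= big1 ?addr0; last first.
  by move=> k ki; rewrite mxE eq_sym (negbTE ki) mul0r.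
by rewrite mxE eqxx mul1r.
Qed.

(** * The transient block of the semigroup *)

Section phase_block.
Context {R : realType} (p : nat) (T : 'M[R]_p) (Pt : R -> 'M[R]_(p + 1)).
Hypotheses (hP : transition_semigroup Pt) (hQ : has_intensity Pt (ph_intensity T)).

Definition phase_block (t : R) : 'M[R]_p := ulsubmx (Pt `|t|).

Lemma ph_intensity_absorbing j : ph_intensity T (absorbing p) j = 0.
Proof.
rewrite /ph_intensity /absorbing; case: (split_ordP j) => k ->.
  by rewrite block_mxEdl mxE.
by rewrite block_mxEdr mxE.
Qed.

Lemma Pt_absorbing t j : 0 <= t -> Pt t (absorbing p) j = (absorbing p == j)%:R.
Proof. by apply: (Pt_cst_row hP hQ) => k; exact: ph_intensity_absorbing. Qed.

Lemma phase_blockE t i j : 0 <= t -> phase_block t i j = Pt t (lshift 1 i) (lshift 1 j).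
Proof. by move=> t0; rewrite !mxE ger0_norm. Qed.

Lemma phase_block_semigroup : semigroup_block T phase_block.
Proof.
have E i j : (fun t => phase_block t i j) = (fun t : R => Pt `|t| (lshift 1 i) (lshift 1 j)).
  by apply/funext => t; rewrite !mxE.
split.
- by move=> i j; rewrite E; exact: Pt_abs_continuous.
- move=> t i j t0; rewrite E; apply: der_eq (Pt_der hP hQ _ _ t0) _.
  rewrite !mxE big_split_ord /= [X in _ + X]big1 ?addr0; last first.
    by move=> k _; rewrite /ph_intensity block_mxEdl mxE mulr0.
  by apply: eq_bigr => k _; rewrite /ph_intensity block_mxEul phase_blockE// ltW.
- case: hP => P0 _ _ _; apply/matrixP => i j; rewrite !mxE normr0 P0 !mxE.
  by rewrite (inj_eq (@lshift_inj _ _)).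
- by move=> t i j t0; rewrite phase_blockE//; exact: Pt_ge0.
- by move=> t i j t0; rewrite phase_blockE//; exact: Pt_le1.
Qed.

(** The absorbing rows of [Pt t] and of the intensity matrix have zero entries in the transient
    columns, so the upper left block of a product is the product of the upper left blocks. The same
    reason gives the semigroup property below. *)
Lemma phase_block_comm t : 0 <= t -> phase_block t *m T = T *m phase_block t.
Proof.
move=> t0; apply/matrixP => i j.
have := Pt_comm hP hQ t0 => /matrixP /(_ (lshift 1 i) (lshift 1 j)).
rewrite mxE big_split_ord /= [X in _ + X]big1 ?addr0; last first.
  by move=> k _; rewrite /ph_intensity block_mxEdl mxE mulr0.
rewrite [RHS]mxE big_split_ord /= [X in _ = _ + X]big1 ?addr0; last first.
  move=> k _; rewrite (_ : rshift p k = absorbing p); last by rewrite /absorbing (ord1 k).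
  by rewrite Pt_absorbing// mulrb ifF ?mulr0//; apply/negbTE; rewrite eq_sym eq_lrshift.
move=> H; rewrite !mxE.
transitivity (\sum_k Pt t (lshift 1 i) (lshift 1 k) * ph_intensity T (lshift 1 k) (lshift 1 j)).
  by apply: eq_bigr => k _; rewrite /ph_intensity block_mxEul phase_blockE.
by rewrite H; apply: eq_bigr => k _; rewrite /ph_intensity block_mxEul phase_blockE.
Qed.

Lemma phase_blockD s t : 0 <= s -> 0 <= t -> phase_block (s + t) = phase_block s *m phase_block t.
Proof.
move=> s0 t0; apply/matrixP => i j; rewrite phase_blockE ?addr_ge0//.
case: hP => _ PD _ _; rewrite PD// mxE big_split_ord /= [X in _ + X]big1 ?addr0; last first.
  move=> k _; rewrite (_ : rshift p k = absorbing p); last by rewrite /absorbing (ord1 k).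
  by rewrite Pt_absorbing// mulrb ifF ?mulr0//; apply/negbTE; rewrite eq_sym eq_lrshift.
by rewrite mxE; apply: eq_bigr => k _; rewrite !phase_blockE.
Qed.

Lemma phase_block_sum t i : 0 <= t ->
  \sum_j phase_block t i j = 1 - Pt t (lshift 1 i) (absorbing p).
Proof.
move=> t0; rewrite -(Pt_sum1 hP (lshift 1 i) t0) big_split_ord /= big_ord1.
by rewrite addrK; apply: eq_bigr => j _; rewrite phase_blockE.
Qed.

End phase_block.

(** * Stability of [T] from transience *)

Section invariant_measure.
Context {R : realType} (p : nat) (S : nat -> 'M[R]_p) (w : 'I_p -> R).
Hypothesis S0 : S 0%N = 1%:M.
Hypothesis SD : forall m n, S (m + n)%N = S m *m S n.
Hypothesis Sge0 : forall n i j, 0 <= S n i j.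
Hypothesis Ssum : forall n i, \sum_j S n i j <= 1.
Hypothesis Sdiag : forall j, (fun n => S n j j) @ \oo --> (0 : R).
Hypothesis w0 : forall i, 0 <= w i.
Hypothesis wS : forall n j, w j <= \sum_i w i * S n i j.

(** Row sums at most 1 cannot increase the total mass, so the inequalities [wS], summed over [j],
    are all equalities. *)
Let wS_eq n j : w j = \sum_i w i * S n i j.
Proof.
have h : \sum_j w j = \sum_j \sum_i w i * S n i j.
  apply/le_anti/andP; split; first exact: ler_sum.
  rewrite exchange_big /=; apply: ler_sum => i _.
  by rewrite -mulr_sumr ler_piMr.
have d : \sum_j (\sum_i w i * S n i j - w j) = 0 by rewrite sumrB h subrr.
have := psumr_eq0P _ d; move=> /(_ (fun k _ => _)) H.
by apply/esym/eqP; rewrite -subr_eq0; apply/eqP; apply: H => // k; rewrite subr_ge0.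
Qed.

(* The states reachable from j form a closed set carrying a w-invariant
   flow, so only they feed j; but from j they all lead back to S_jj. *)
Lemma invariant_measure0 j : w j = 0.
Proof.
pose C i := `[< exists n, 0 < S n j i >].
have Cj : C j by apply/asboolP; exists 0%N; rewrite S0 mxE eqxx ltr01.
have Cclosed n i k : C i -> ~~ C k -> S n i k = 0.
  move=> /asboolP[m hm] /asboolP Ck; apply/eqP; rewrite eq_le Sge0 andbT leNgt.
  apply/negP => hn; apply: Ck; exists (m + n)%N; rewrite SD mxE (bigD1 i)//=.
  by rewrite ltr_pwDl ?mulr_gt0// sumr_ge0// => l _; rewrite mulr_ge0.
(* Balance of mass on [C]: the states of [C] already send the whole of their mass into [C], so by
   invariance nothing can enter from outside. *)
have outside n i : ~~ C i -> w i * S n i j = 0.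
  move=> Ci.
  have E : \sum_(k | C k) w k = \sum_i w i * \sum_(k | C k) S n i k.
    rewrite (eq_bigr _ (fun k _ => wS_eq n k)) exchange_big /=.
    by apply: eq_bigr => l _; rewrite mulr_sumr.
  (* Conservation of the total mass forces the row sum to be 1 wherever [w] is positive, and
     closedness of [C] keeps that row inside [C]. *)
  have full l : C l -> w l * \sum_(k | C k) S n l k = w l.
    move=> Cl; have tot : \sum_l w l = \sum_l w l * \sum_k S n l k.
      rewrite [LHS](eq_bigr _ (fun k _ => wS_eq n k)) exchange_big /=.
      by apply: eq_bigr => k _; rewrite mulr_sumr.
    have h1 : w l * \sum_k S n l k = w l.
      apply/eqP; rewrite eq_le ler_piMr//=.
      have d : \sum_l (w l - w l * \sum_k S n l k) = 0 by rewrite sumrB tot subrr.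
      have H : forall k, true -> 0 <= w k - w k * \sum_l0 S n k l0.
        by move=> k _; rewrite subr_ge0 ler_piMr.
      have e0 : w l - w l * \sum_k S n l k = 0 := psumr_eq0P H d isT.
      by move/eqP: e0; rewrite subr_eq0 => /eqP <-.
    rewrite -[RHS]h1; congr (_ * _); rewrite [RHS](bigID C) /= [X in _ + X]big1 ?addr0//.
    by move=> k Ck; exact: Cclosed.
  move: E; rewrite [RHS](bigID C) /= [X in X + _](eq_bigr _ full) => E.
  have Z : \sum_(l | ~~ C l) w l * \sum_(k | C k) S n l k = 0.
    by apply: (addrI (\sum_(k | C k) w k)); rewrite addr0 -E.
  have H : forall l, ~~ C l -> 0 <= w l * \sum_(k | C k) S n l k.
    by move=> l _; rewrite mulr_ge0// sumr_ge0.
  have : w i * \sum_(k | C k) S n i k = 0 := psumr_eq0P H Z Ci.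
  rewrite (bigD1 j)//= mulrDr; move/eqP.
  rewrite paddr_eq0; first by move=> /andP[/eqP].
    by rewrite mulr_ge0.
  by rewrite mulr_ge0// sumr_ge0.
(* If [S m j i > 0], then [S m j i * S n i j <= S (m + n) j j], which tends to 0. *)
have inside i : C i -> (fun n => w i * S n i j) @ \oo --> (0 : R).
  move=> /asboolP[m hm]; rewrite -(mulr0 (w i)); apply: cvgM; first exact: cvg_cst.
  apply: (@squeeze_cvgr _ _ _ _ (fun=> 0) (fun n => (S m j i)^-1 * S (n + m)%N j j)).
  - apply: nearW => n; rewrite Sge0 /= ler_pdivlMl// addnC SD mxE (bigD1 i)//=.
    by rewrite lerDl sumr_ge0// => l _; rewrite mulr_ge0.
  - exact: cvg_cst.
  - rewrite -(mulr0 (S m j i)^-1); apply: cvgM; first exact: cvg_cst.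
    by have := Sdiag j; rewrite -(cvg_shiftn m).
have L : (fun n => \sum_i w i * S n i j) @ \oo --> (\sum_(i < p) 0 : R).
  apply: cvg_sum => i; have [Ci|Ci] := boolP (C i); first exact: inside.
  under eq_fun do rewrite outside//; exact: cvg_cst.
rewrite big1// in L.
apply: (@cvg_unique _ (@norm_hausdorff _ R) ((fun n => \sum_i w i * S n i j) @ \oo)) => //.
have -> : (fun n => \sum_i w i * S n i j) = (fun=> w j).
  by apply/funext => n; rewrite -wS_eq.
exact: cvg_cst.
Qed.

End invariant_measure.

Section eigenvector.
Context {R : realType} (p : nat) (T : 'M[R]_p) (S : R -> 'M[R]_p).
Hypothesis hS : semigroup_block T S.
Hypothesis ST : forall t, 0 <= t -> S t *m T = T *m S t.
Hypothesis SD : forall s t, 0 <= s -> 0 <= t -> S (s + t) = S s *m S t.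
Hypothesis Ssum : forall t i, 0 <= t -> \sum_j S t i j <= 1.
Hypothesis Sdiag : forall j, (fun n : nat => S n%:R j j) @ \oo --> (0 : R).
Notation normc := Normc.normc.

Lemma normc_sum n (F : 'I_n -> R[i]) : normc (\sum_i F i) <= \sum_i normc (F i).
Proof.
elim/big_rec2: _ => [|i x y _ h]; first by rewrite Normc.normc0.
by apply: le_trans (le_normcD _ _) _; rewrite lerD2l.
Qed.

Lemma normc_cexpE (z : R[i]) : normc (cexp z) = expR (Re z).
Proof.
rewrite /cexp /= !exprMn -mulrDr cos2Dsin2 mulr1 sqrtr_sqr gtr0_norm//.
exact: expR_gt0.
Qed.

(** The row [cexp (- t a) *: (v *m S t)] has derivative 0: since [S t] commutes with [T], the
    derivative of [v *m S t] is [v *m T *m S t], that is [a] times itself. *)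
Lemma eigenvector_flow (v : 'rV[R[i]]_p) a : v *m cmx T = a *: v ->
  forall t, 0 <= t -> v *m cmx (S t) = cexp (t%:C * a) *: v.
Proof.
move=> va t; rewrite le_eqVlt => /predU1P[<-|t0].
  by rewrite (block0 hS) mul0r cexp0 scale1r /cmx map_mx1 mulmx1.
apply/matrixP => i j; rewrite (ord1 i) !mxE.
under eq_bigr do rewrite mxE.
pose V (s : R) := \sum_k v 0 k * (S s k j)%:C.
pose F (s : R) := cexp (s%:C * - a) * V s.
have cl A b : ccont A (fun s : R => cexp (s%:C * b)).
  apply: ccont_exp; apply: ccontM; last exact: ccont_cst.
  by apply: ccont_real; apply: (@continuous_subspaceT _ _ _ (fun v : R => v)) => u; exact: cvg_id.
have cV A : ccont A V.
  apply: ccont_bigsum => k; apply: ccontM; first exact: ccont_cst.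
  by apply: ccont_real; apply: continuous_subspaceT; exact: (block_cont hS).
have dF u : 0 < u < t -> cder F u 0.
  move=> /andP[u0 _].
  have de : cder (fun s : R => cexp (s%:C * - a)) u (- a * cexp (u%:C * - a)).
    apply: cder_eq (cder_exp (cderM (cder_real (der_id u)) (cder_cst (- a) u))) _.
    by rewrite mulr0 addr0 mul1r.
  have dV : cder V u (a * V u).
    have dk k := cderM (cder_cst (v 0 k) u) (cder_real (block_der hS k j u0)).
    have : cder V u (\sum_k v 0 k * ((S u *m T) k j)%:C).
      split; rewrite ?Re_sum ?Im_sum.
        rewrite (_ : (fun t => Re (V t)) = (fun t => \sum_k Re (v 0 k * (S t k j)%:C))); last first.
          by apply/funext => s; rewrite /V Re_sum.
        by apply: der_sum => k; have [+ _] := dk k; rewrite mul0r add0r.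
      rewrite (_ : (fun t => Im (V t)) = (fun t => \sum_k Im (v 0 k * (S t k j)%:C))); last first.
        by apply/funext => s; rewrite /V Im_sum.
      by apply: der_sum => k; have [_ +] := dk k; rewrite mul0r add0r.
    move/cder_eq; apply; rewrite (ST (ltW u0)).
    have : (v *m cmx T *m cmx (S u)) 0 j = a * V u.
      by rewrite va -scalemxAl !mxE; congr (_ * _); apply: eq_bigr => k _; rewrite mxE.
    move=> <-; rewrite -mulmxA mxE; apply: eq_bigr => k _; congr (_ * _).
    rewrite !mxE rmorph_sum; apply: eq_bigr => l _; by rewrite !mxE rmorphM.
  apply: cder_eq (cderM de dV) _; ring.
have := complex_FTC t0 (ccontM (cl _ _) (cV _)) (ccont_cst _ 0) dF.
have -> : cint lebesgue_measure `[0, t] (fun=> 0) = 0 :> R[i].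
  have := @cint_real R _ _ (@lebesgue_measure R) `[0, t]%classic (fun=> 0).
  by rewrite /Rintegral integral0.
move/esym/eqP; rewrite subr_eq0 /F mul0r cexp0 mul1r mulrN cexpN => /eqP h.
have V0 : V 0 = v 0 j.
  rewrite /V (block0 hS) (bigD1 j)//= big1 ?addr0; first by rewrite mxE eqxx mulr1.
  by move=> k kj; rewrite mxE (negbTE kj) mulr0.
rewrite -V0 -h mulrA mulfV ?mul1r//.
exact: cexp_neq0.
Qed.

(** If [Re a >= 0], then [|cexp (n a)| >= 1], and the triangle inequality in
    [v *m S n = cexp (n a) *: v] makes the moduli of the entries of [v] a subinvariant measure,
    which must vanish. *)
Lemma stable_of_vanishing : stable T.
Proof.
move=> a /eigenvalueP[v va v0]; rewrite ltNge; apply/negP => a0.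
pose w i := normc (v 0 i).
have wE j : w j = 0.
  apply: (@invariant_measure0 R p (fun n => S n%:R) w) => //.
  - exact: (block0 hS).
  - by move=> m n; rewrite natrD SD.
  - by move=> n i k; apply: (block_ge0 hS).
  - by move=> n i; apply: Ssum.
  - by move=> i; exact: normc_ge0'.
  - move=> n k.
    have := eigenvector_flow va (ler0n R n) => /matrixP /(_ 0 k).
    rewrite [RHS]mxE => /(congr1 (@Normc.normc R)); rewrite Normc.normcM normc_cexpE => E.
    apply: le_trans (_ : expR (Re (n%:R%:C * a)) * w k <= _).
      rewrite ler_peMl ?normc_ge0'// -expR0 ler_expR ReM /= mul0r subr0.
      by rewrite mulr_ge0.
    rewrite -/(w k) in E; rewrite -E mxE; apply: le_trans (normc_sum _) _.
    apply: ler_sum => i _; rewrite Normc.normcM mxE /w /= expr0n /= addr0 sqrtr_sqr.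
    by rewrite ger0_norm// (block_ge0 hS).
move/eqP: v0; apply; apply/matrixP => i j; rewrite (ord1 i) mxE.
by apply: Normc.eq0_normc; exact: wE.
Qed.

End eigenvector.

(** * From the process to the law of its absorption time *)

Section process.
Context {R : realType} d (Omega : measurableType d) (P : probability Omega R).
Context (m : nat) (J : R -> Omega -> 'I_m) (Pt : R -> 'M[R]_m).
Hypothesis mJ : forall t i, 0 <= t -> measurable [set w | J t w = i].
Hypothesis hcyl : forall (n : nat) (t : nat -> R) (i : nat -> 'I_m),
  0 <= t 0%N -> (forall k, t k <= t k.+1) ->
  P (cylinder J t i n.+2) =
  (P (cylinder J t i n.+1) * (Pt (t n.+1 - t n) (i n) (i n.+1))%:E)%E.

Lemma process_pair s t a b : 0 <= s -> s <= t ->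
  P ([set w | J s w = a] `&` [set w | J t w = b]) =
  (P [set w | J s w = a] * (Pt (t - s) a b)%:E)%E.
Proof.
move=> s0 st; pose t' (k : nat) := if k is 0%N then s else t.
pose i' (k : nat) := if k is 0%N then a else b.
have := @hcyl 0%N t' i' s0.
have E1 : cylinder J t' i' 1 = [set w | J s w = a].
  apply/seteqP; split => w /=; first by move=> /(_ 0%N); apply.
  by move=> h k /=; rewrite ltnS leqn0 => /eqP ->.
have E2 : cylinder J t' i' 2 = [set w | J s w = a] `&` [set w | J t w = b].
  apply/seteqP; split => w /=.
    by move=> h; split; [exact: (h 0%N)|exact: (h 1%N)].
  by move=> [h1 h2] [|[|k]].
by rewrite E1 E2; apply; case => /=.
Qed.

Lemma process_marginal (alpha : 'rV[R]_m) t j :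
  (forall i, P [set w | J 0 w = i] = (alpha 0 i)%:E) -> 0 <= t ->
  P [set w | J t w = j] = (\sum_i alpha 0 i * Pt t i j)%:E.
Proof.
move=> h0 t0.
have -> : [set w | J t w = j] =
    \big[setU/set0]_(i < m) ([set w | J 0 w = i] `&` [set w | J t w = j]).
  rewrite -bigcup_seq; apply/seteqP; split => w /=; last by case => k _ [].
  by move=> h; exists (J 0 w) => //=; rewrite mem_index_enum.
have mt : measurable [set w | J t w = j] by exact: mJ.
rewrite measure_bigsetU_ord; last 2 first.
- by move=> i; apply: measurableI => //; apply: mJ.
- by move=> i k _ _ [w [[/= <- _] [<- _]]].
rewrite -sumEFin; apply: eq_bigr => i _.
by have E := process_pair i j (lexx 0) t0; rewrite h0 subr0 -EFinM in E; exact: E.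
Qed.

End process.

Section transience.
Context {R : realType}.

(** The indicator of [J n = i] tends almost surely to 0, as the visits to [i] are bounded in time;
    dominated convergence transfers this to the probabilities, which are the diagonal entries of the
    semigroup. *)
Lemma transient_vanish m (Q : 'M[R]_m) i (Pt : R -> 'M[R]_m) : transient Q i ->
  transition_semigroup Pt -> has_intensity Pt Q ->
  (fun n : nat => Pt n%:R i i) @ \oo --> (0 : R).
Proof.
move=> [d [Om [P [J [[mJ [_ [_ [h0 [Pt' [hP' hQ' hcyl]]]]]] hae]]]]] hP hQ.
have PE (n : nat) : P [set w | J n%:R w = i] = (Pt n%:R i i)%:E.
  rewrite (process_marginal mJ hcyl i h0)// (semigroup_unique hP hQ hP' hQ')//.
  rewrite (bigD1 i)//= big1 ?addr0.
    by rewrite mxE !eqxx mul1r.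
  by move=> k ki; rewrite mxE eqxx (negbTE ki) mul0r.
pose E (n : nat) := [set w | J n%:R w = i].
have mE n : measurable (E n) by exact: mJ.
have [] := @dominated_convergence _ _ R P setT measurableT
  (fun n w => (\1_(E n) w)%:E) (cst 0%E) (cst 1%E).
- by move=> n; apply/measurable_EFinP; exact: measurable_indic.
- exact: measurable_cst.
- apply: filterS hae => w [M hM] _.
  apply: cvg_near_cst; near=> n.
  have nM : M < n%:R by near: n; exact: nbhs_infty_gtr.
  rewrite indicE memNset//= => /hM; rewrite ler0n => /(_ isT).
  by rewrite leNgt nM.
- exact: (integrable_cst 1 measurableT (probT_lty P)).
- by apply: aeW => w n _; rewrite /= lee_fin indicE; case: (_ \in _); rewrite ?normr1 ?normr0.
move=> _ _; rewrite integral0 => H.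
have {}H : (fun n : nat => (Pt n%:R i i)%:E) @ \oo --> 0%:E.
  move: H; rewrite (_ : [sequence _]_n = (fun n : nat => (Pt n%:R i i)%:E))//.
  by apply/funext => n; rewrite /= integral_indic// setIT; exact: PE.
exact: (fine_cvg H).
Unshelve. all: by end_near. Qed.

End transience.

Section phase_type_law.
Context {R : realType}.

Lemma prob_ae_eq d (Om : measurableType d) (P : probability Om R) (A B : set Om) :
  measurable A -> measurable B -> {ae P, forall w, A w <-> B w} -> P A = P B.
Proof.
move=> mA mB AB; rewrite -(setIT A) -(setIT B) -!integral_indic//.
apply: ae_eq_integral => //; try exact/measurable_EFinP/measurable_indic.
apply: filterS AB => w ABw _; rewrite !indicE.
have [wA|wA] := boolP (w \in A).
  by rewrite (mem_set (ABw.1 (set_mem wA))).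
by rewrite memNset// => /ABw.2 /mem_set h; rewrite h in wA.
Qed.

(** Being absorbed at [t] gives [tau <= t] by definition of the infimum. The converse needs that the
    infimum is attained, which is right-continuity, and that absorption lasts, which the Markov
    property gives only almost surely and for fixed pairs of times; hence the detour through
    rational times. *)
Lemma absorption_le d (Om : measurableType d) (P : probability Om R) p (T : 'M[R]_p)
    (J : R -> Om -> 'I_(p + 1)) (tau : {RV P >-> R}) (alpha : 'rV[R]_(p + 1)) t :
  markov_jump_process P J alpha (ph_intensity T) -> absorption_time P J tau -> 0 <= t ->
  P [set w | tau w <= t] = P [set w | J t w = absorbing p].
Proof.
move=> [mJ [rc [_ [h0 [Pt [hP hQ hcyl]]]]]] hae t0.
have mtau : measurable [set w | tau w <= t].
  rewrite (_ : [set w | tau w <= t] = setT `&` tau @^-1` `]-oo, t]).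
    by apply: measurable_funPT => //; exact: measurable_itv.
  by apply/seteqP; split => w /=; rewrite in_itv/= => -[].
have mJt : measurable [set w | J t w = absorbing p] by exact: mJ.
(* Once absorbed at a rational time, the process is almost surely absorbed at t. *)
have stay : {ae P, forall w, forall q : rat, 0 <= ratr q :> R -> ratr q <= t :> R ->
    J (ratr q) w = absorbing p -> J t w = absorbing p}.
  (* The rationals are enumerated so that countably many null events are put together. *)
  have : {ae P, forall w, forall n : nat, if unpickle n is Some q then
      0 <= ratr q :> R -> ratr q <= t :> R ->
      J (ratr q) w = absorbing p -> J t w = absorbing p else True}.
    apply: ae_foralln => n; case: (unpickle n) => [q|]; last exact: aeW.
    have [q0|q0] := boolP (0 <= ratr q :> R); last by apply: aeW.
    have [qt|qt] := boolP (ratr q <= t :> R); last by apply: aeW.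
    pose A := [set w | J (ratr q) w = absorbing p]; pose B := [set w | J t w = absorbing p].
    have mA : measurable A by exact: mJ.
    have AB0 : P (A `\` B) = 0%E.
      transitivity (P A - P (A `&` B))%E.
        by apply: measureD => //; rewrite -ge0_fin_numE// fin_num_measure.
      have E := process_pair hcyl (absorbing p) (absorbing p) q0 qt.
      rewrite (Pt_absorbing hP hQ) ?subr_ge0// eqxx mule1 in E.
      have -> : P (A `&` B) = P A by exact: E.
      by rewrite subee// fin_num_measure.
    exists (A `\` B); split => //; first exact: measurableD.
    move=> w /= H; split; first by apply: contrapT => nA; apply: H => _ _ /nA.
    by move=> wB; apply: H.
  apply: filterS => w H q; have := H (pickle q); by rewrite pickleK.
apply: prob_ae_eq => //; apply: filterS2 stay hae => w st tE.
split; last first.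
  move=> /= Jt; rewrite -lee_fin tE; apply: ereal_inf_lbound.
  by exists t.
move=> /= tt; pose E := [set s : R | 0 <= s /\ J s w = absorbing p].
have tau0 : 0 <= tau w.
  rewrite -lee_fin tE; apply: le_ereal_inf_tmp => _ [s [s0 _] <-].
  by rewrite lee_fin.
have abs_near e : 0 < e -> exists2 s, E s & tau w <= s < tau w + e.
  move=> e0; have : (ereal_inf [set s%:E | s in E] < (tau w + e)%:E)%E.
    by rewrite -tE lte_fin ltrDl.
  move=> /ereal_inf_lt[_ [s Es <-]]; rewrite lte_fin => se; exists s => //.
  rewrite se andbT -lee_fin tE; apply: ereal_inf_lbound; by exists s.
have [e /= e0 he] := rc w _ tau0.
(* The state is constant on some interval to the right of [tau], and this interval contains an
   absorption time. *)
have Jtau : J (tau w) w = absorbing p.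
  have [s [s0 Js] /andP[]] := abs_near e e0.
  rewrite le_eqVlt => /predU1P[->//|ts] se.
  by rewrite -(he s)//= ltr0_norm ?subr_lt0// opprB ltrBlDl.
move: tt; rewrite le_eqVlt => /predU1P[<-//|tt].
(* A rational time in this interval is still in the absorbing state, and [st] leads from there to
   [t]. *)
have : tau w < Num.min t (tau w + e) by rewrite lt_min tt ltrDl.
move=> /rat_in_itvoo[q]; rewrite in_itv/= lt_min => /andP[q1 /andP[q2 q3]].
apply: (st q); [exact: le_trans (ltW q1)|exact: ltW|].
by rewrite he//= ltr0_norm ?subr_lt0// opprB ltrBlDl.
Qed.

(** From here on the process is gone: apart from the signs of [T], this is all that is used of the
    hypothesis that [Y] is phase-type. The last clause comes from the absence of initial mass at the
    absorbing state. *)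
Lemma phase_type_survival d (Omega : measurableType d) (P : probability Omega R)
    (Y : {RV P >-> R}) p (alpha : 'rV[R]_p) (T : 'M[R]_p) :
  phase_type Y alpha T -> exists S : R -> 'M[R]_p,
  [/\ semigroup_block T S, stable T, forall i, 0 <= alpha 0 i & \sum_i alpha 0 i = 1] /\
  (forall t, 0 <= t -> P [set w | Y w <= t] = (1 - (alpha *m S t *m ones p) 0 0)%:E) /\
  P [set w | Y w <= 0] = 0%E.
Proof.
move=> [_ tr [d' [Om [P' [J [tau [hJ habs hlaw]]]]]]].
have hJ' := hJ; case: hJ' => [mJ [rc [_ [h0 [Pt [hP hQ hcyl]]]]]].
pose S := phase_block Pt.
have hS : semigroup_block T S by exact: phase_block_semigroup hP hQ.
have aE i : P' [set w | J 0 w = lshift 1 i] = (alpha 0 i)%:E by rewrite h0 row_mxEl.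
have a0 i : 0 <= alpha 0 i by rewrite -lee_fin -aE.
have abs0 : P' [set w | J 0 w = absorbing p] = 0%E by rewrite h0 row_mxEr mxE.
have asum : \sum_i alpha 0 i = 1.
  pose al : 'rV[R]_(p + 1) := row_mx alpha 0.
  have : P' setT = (\sum_i al 0 i)%:E.
    have -> : [set: Om] = \big[setU/set0]_(i < p + 1) [set w | J 0 w = i].
      by rewrite -bigcup_seq; apply/seteqP; split => w //= _; exists (J 0 w) => //=; rewrite mem_index_enum.
    rewrite measure_bigsetU_ord; last 2 first.
    - by move=> i; exact: mJ.
    - by move=> i k _ _ [w [/= <- <-]].
    transitivity (\sum_i (al 0 i)%:E)%E; last by rewrite sumEFin.
    by apply: eq_bigr => i _; exact: h0.
  rewrite probability_setT => -[H]; rewrite H big_split_ord /= big_ord1 /al row_mxEr mxE addr0.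
  by apply: eq_bigr => i _; rewrite row_mxEl.
exists S; split; first split => //.
  apply: (stable_of_vanishing hS).
  + by move=> t t0; exact: phase_block_comm hP hQ _ t0.
  + by move=> s t; exact: phase_blockD hP hQ _ _.
  + move=> t i t0; rewrite (phase_block_sum hP)// gerBl; exact: Pt_ge0 hP _ _ _ t0.
  + move=> j; have := transient_vanish (tr j) hP hQ.
    apply: cvg_trans; apply: near_eq_cvg; apply: nearW => n.
    by rewrite phase_blockE.
have YE t : 0 <= t -> P [set w | Y w <= t] = P' [set w | J t w = absorbing p].
  move=> t0; rewrite -(absorption_le hJ habs t0).
  have E U (f : U -> R) : f @^-1` `]-oo, t]%classic = [set w | f w <= t].
    by apply/seteqP; split => w /=; rewrite in_itv.
  rewrite -(E _ Y) -(E _ tau); exact: hlaw (measurable_itv _).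
split; last by rewrite YE.
move=> t t0; rewrite YE// (process_marginal mJ hcyl _ h0)//; congr EFin.
rewrite big_split_ord /= big_ord1 row_mxEr mxE mul0r addr0 -mulmxA mxE -asum -sumrB.
apply: eq_bigr => i _; rewrite row_mxEl mxE.
under eq_bigr do rewrite [ones p _ _]mxE mulr1.
by rewrite (phase_block_sum hP)// mulrBr mulr1 subKr.
Qed.

End phase_type_law.

(** * Gamma integrals *)

Section improper.
Context {R : realType}.
Notation mu := (@lebesgue_measure R).

Section exhaustion.
Variables (D : set R) (f F : R -> R) (a b : nat -> R) (la lb : R).
Hypotheses (mD : measurable D) (mf : measurable_fun setT f).
Hypotheses (ab : forall n, a n < b n).
Hypotheses (anI : forall n, a n.+1 <= a n) (bnD : forall n, b n <= b n.+1).
Hypothesis DE : D = \bigcup_n `[a n, b n]%classic.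
Hypothesis dF : forall x, D x -> der F x (f x).
Hypothesis cf : forall x, D x -> {for x, continuous f}.
Hypotheses (Fa : F (a n) @[n --> \oo] --> la) (Fb : F (b n) @[n --> \oo] --> lb).

Let sub n : `[a n, b n]%classic `<=` D.
Proof. by rewrite DE => x h; exists n. Qed.

Let nd : nondecreasing_seq (fun n => `[a n, b n]%classic : set R).
Proof.
apply/nondecreasing_seqP => n; apply/subsetPset => x /=.
by rewrite !in_itv/= => /andP[h k]; rewrite (le_trans (anI n) h) (le_trans k (bnD n)).
Qed.

Let cfn n : {within `[a n, b n], continuous f}.
Proof. by apply: continuous_in_subspaceT => x /set_mem /sub; exact: cf. Qed.

Let ifn n : mu.-integrable `[a n, b n] (EFin \o f).
Proof. by apply: continuous_compact_integrable => //; exact: segment_compact. Qed.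

Let In n : \int[mu]_(x in `[a n, b n]) f x = F (b n) - F (a n).
Proof.
apply: real_FTC => //.
  apply: continuous_in_subspaceT => x /set_mem /sub Dx; exact: der_cont (dF Dx).
move=> u h; apply: dF; apply: (sub (n := n)); rewrite /= in_itv/=.
by move: h => /andP[/ltW -> /ltW ->].
Qed.

Let Ine n : (\int[mu]_(x in `[a n, b n]) (f x)%:E = (F (b n) - F (a n))%:E)%E.
Proof. by rewrite -In /Rintegral fineK// integrable_fin_num. Qed.

Let limF : F (b n) - F (a n) @[n --> \oo] --> lb - la.
Proof. exact: cvgB. Qed.

(** For a nonnegative function, monotone convergence along the exhausting intervals yields
    integrability together with the value; for a signed function, treated next, integrability is
    assumed and dominated convergence is used. *)
Lemma improper_FTC_ge0 : (forall x, D x -> 0 <= f x) ->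
  mu.-integrable D (EFin \o f) /\ \int[mu]_(x in D) f x = lb - la.
Proof.
move=> f0.
have L : (\int[mu]_(x in D) (f x)%:E = (lb - la)%:E)%E.
  have C : ((\int[mu]_(x in `[a n, b n]) (f x)%:E) @[n --> \oo] -->
      \int[mu]_(x in D) (f x)%:E)%E.
    rewrite DE; refine (@ge0_nondecreasing_set_cvg_integral _ (measurableTypeR R) R
      (fun n => `[a n, b n]%classic) (EFin \o f) mu nd _ _ _).
    - by move=> n; exact: measurable_itv.
    - by move=> n; exact: (measurable_int mu (ifn n)).
    - by move=> n x h; rewrite lee_fin f0//; exact: sub h.
  apply: (cvg_unique (@ereal_hausdorff R) C).
  rewrite (_ : (fun n => _) = (fun n => (F (b n) - F (a n))%:E)); last first.
    by apply/funext => n; exact: Ine.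
  by apply: cvg_EFin => //; exact: nearW.
split; last by rewrite /Rintegral L.
apply/integrableP; split; first by apply/measurable_EFinP; exact: measurable_funTS.
suff -> : (\int[mu]_(x in D) `|(EFin \o f) x| = \int[mu]_(x in D) (f x)%:E)%E by rewrite L ltry.
by apply: eq_integral => x /set_mem Dx /=; rewrite ger0_norm// f0.
Qed.

Lemma improper_FTC : mu.-integrable D (EFin \o f) -> \int[mu]_(x in D) f x = lb - la.
Proof.
move=> fi.
have mfD : measurable_fun D (EFin \o f) := measurable_int mu fi.
pose fn n x := ((EFin \o f) \_ `[a n, b n]%classic) x.
have [] := @dominated_convergence _ _ R mu D mD fn (EFin \o f) (abse \o (EFin \o f)).
- move=> n; apply: (measurable_funS measurableT) => //.
  exact: (measurable_restrictT _ (measurable_itv _)).1 (measurable_int mu (ifn n)).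
- exact: mfD.
- apply: aeW => x Dx; apply: cvg_near_cst.
  have : (\bigcup_n `[a n, b n]%classic) x by rewrite -DE.
  move=> [N _ xN]; exists N => // n /= Nn.
  by rewrite /fn patchE mem_set//; move/subsetPset: (nd Nn); apply.
- exact: integrable_abse.
- apply: aeW => x n Dx; rewrite /fn patchE; case: ifP => // _.
  by rewrite abse0 /= lee_fin; exact: normr_ge0.
move=> _ _ C.
have {}C : (fun n => \int[mu]_(x in D) fn n x)%E @ \oo --> (\int[mu]_(x in D) f x)%:E.
  by rewrite /Rintegral fineK//; exact: integrable_fin_num.
have E n : (\int[mu]_(x in D) fn n x = (F (b n) - F (a n))%:E)%E.
  rewrite -Ine /fn -integral_mkcondr (setIidr (@sub n)); exact: eq_integral.
rewrite (funext E) in C.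
exact: (cvg_unique (@norm_hausdorff _ R) (fine_cvg C) limF).
Qed.

End exhaustion.

Lemma itv0y_bigcup : `]0, +oo[%classic = \bigcup_n `[n.+1%:R^-1 : R, n.+2%:R]%classic.
Proof.
apply/seteqP; split => [x /=|x [n _] /=]; rewrite !in_itv/= ?andbT; last first.
  by move=> /andP[h _]; apply: lt_le_trans h; rewrite invr_gt0.
move=> x0; pose n := (Num.truncn x^-1 + Num.truncn x).+1.
exists n => //=; rewrite in_itv/=; apply/andP; split.
  rewrite invf_ple ?posrE//; apply: ltW; apply: lt_le_trans (Num.Theory.truncnS_gt _) _.
  by rewrite ler_nat ltnS; apply: leqW; exact: leq_addr.
apply: ltW; apply: lt_le_trans (Num.Theory.truncnS_gt _) _.
by rewrite ler_nat ltnS; do 2 apply: leqW; exact: leq_addl.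
Qed.

Lemma itv0c_bigcup (y : R) : 0 < y -> `]0, y]%classic = \bigcup_n `[y / n.+2%:R, y]%classic.
Proof.
move=> y0; apply/seteqP; split => [x /=|x [n _] /=]; rewrite !in_itv/=; last first.
  by move=> /andP[h ->]; rewrite andbT; apply: lt_le_trans h; rewrite divr_gt0.
move=> /andP[x0 xy]; exists (Num.truncn (y / x)) => //=; rewrite in_itv/= xy andbT.
rewrite ler_pdivrMr// mulrC -ler_pdivrMr//; apply: ltW.
by apply: lt_le_trans (Num.Theory.truncnS_gt _) _; rewrite ler_nat.
Qed.

Lemma cvg_invS : (n.+1%:R^-1 : R) @[n --> \oo] --> (0 : R).
Proof. exact: cvg_harmonic. Qed.

Lemma cvg_natSS (T : topologicalType) (F : R -> T) (l : T) : F x @[x --> +oo] --> l ->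
  F n.+2%:R @[n --> \oo] --> l.
Proof.
move=> h; apply: (@cvg_comp _ _ _ (fun n : nat => n.+2%:R : R) F _ (+oo%R)) => //.
have := @cvgr_idn R; rewrite -(cvg_shiftn 2); apply: cvg_trans.
by apply: near_eq_cvg; apply: nearW => n /=; rewrite addn2.
Qed.

Lemma cvg_invSS (T : topologicalType) (F : R -> T) (l : T) : F x @[x --> 0^'+] --> l ->
  F (n.+1%:R^-1) @[n --> \oo] --> l.
Proof.
move=> h; apply: (@cvg_comp _ _ _ (fun n : nat => n.+1%:R^-1 : R) F _ (0^'+)) => //.
move=> A [e /= e0 he]; have := cvg_invS => /cvgrPdist_lt /(_ e e0).
apply: filterS => n hn; apply: he => /=; last by rewrite invr_gt0.
by move: hn; rewrite sub0r.
Qed.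

Section half_line.
Variables (f F : R -> R) (la lb : R).
Hypotheses (mf : measurable_fun setT f).
Hypothesis dF : forall x, 0 < x -> der F x (f x).
Hypothesis cf : forall x, 0 < x -> {for x, continuous f}.
Hypotheses (Fa : F x @[x --> 0^'+] --> la) (Fb : F x @[x --> +oo] --> lb).

Let inv_le n : n.+2%:R^-1 <= n.+1%:R^-1 :> R.
Proof. by rewrite lef_pV2 ?posrE ?ltr0n// ler_nat. Qed.

Let lt_ab n : n.+1%:R^-1 < n.+2%:R :> R.
Proof.
apply: le_lt_trans (_ : 1 < _); last by rewrite ltr1n.
by rewrite invf_le1 ?ltr0n// ler1n.
Qed.

Let le_b n : n.+2%:R <= n.+3%:R :> R. Proof. by rewrite ler_nat. Qed.

Let in0y (x : R) : `]0, +oo[%classic x -> 0 < x.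
Proof. by rewrite /= in_itv/= andbT. Qed.

Lemma half_line_FTC_ge0 : (forall x, 0 < x -> 0 <= f x) ->
  mu.-integrable `]0, +oo[ (EFin \o f) /\ \int[mu]_(x in `]0, +oo[) f x = lb - la.
Proof.
move=> f0; apply: (@improper_FTC_ge0 _ f F _ _ _ _ mf lt_ab inv_le le_b itv0y_bigcup).
- by move=> x /in0y; exact: dF.
- by move=> x /in0y; exact: cf.
- exact: cvg_invSS.
- exact: cvg_natSS.
- by move=> x /in0y; exact: f0.
Qed.

Lemma half_line_FTC : mu.-integrable `]0, +oo[ (EFin \o f) ->
  \int[mu]_(x in `]0, +oo[) f x = lb - la.
Proof.
move=> fi; apply: (@improper_FTC _ f F _ _ la lb (measurable_itv _) lt_ab inv_le le_b itv0y_bigcup).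
- by move=> x /in0y; exact: dF.
- by move=> x /in0y; exact: cf.
- exact: cvg_invSS.
- exact: cvg_natSS.
- exact: fi.
Qed.

End half_line.

Lemma der_powR (nu x : R) : 0 < x -> der (fun u => u `^ nu) x (nu * x `^ (nu - 1)).
Proof. exact: is_derive1_powR. Qed.

Lemma powR_cont (nu x : R) : 0 < x -> {for x, continuous (fun u => u `^ nu)}.
Proof. by move=> x0; exact: der_cont (der_powR nu x0). Qed.

End improper.

Section gamma.
Context {R : realType}.
Notation mu := (@lebesgue_measure R).

Lemma powR_subr1 (y a : R) : 0 < y -> y `^ a = y `^ (a - 1) * y.
Proof.
move=> y0; rewrite -[X in _ * X](powRr1 (ltW y0)) -powRD ?subrK//.
by rewrite lt0r_neq0// implybT.
Qed.

(** With [k = c / (b + 1)] and [m = 1 + 1 / k] one has [1 + y <= m * expR (k y)]; raise to the power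
    [b] and use [k b <= c]. The shift in [b + 1] covers [b = 0]. *)
Lemma expRN_le_weight (c b : R) : 0 < c -> 0 <= b ->
  exists2 K : R, 0 < K & forall y, 0 <= y -> expR (- (c * y)) <= K * (1 + y) `^ (- b).
Proof.
move=> c0 b0; pose k := c / (b + 1); have k0 : 0 < k by rewrite divr_gt0// ltr_wpDl.
pose m := 1 + k^-1; have m0 : 0 < m by rewrite addr_gt0// invr_gt0.
exists (m `^ b) => [|y y0]; first exact: powR_gt0.
have y1 : 0 < 1 + y by rewrite ltr_wpDr.
rewrite powRN ler_pdivlMr ?powR_gt0// expRN mulrC ler_pdivrMr ?expR_gt0//.
have h : 1 + y <= m * expR (k * y).
  apply: le_trans (_ : m * (1 + k * y) <= _); last by rewrite ler_pM2l// expR_ge1Dx.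
  have -> : m * (1 + k * y) = 1 + y + (k^-1 + k * y) by rewrite /m; field; rewrite lt0r_neq0.
  by rewrite lerDl; apply: addr_ge0; [rewrite invr_ge0 ltW|apply: mulr_ge0 => //; exact: ltW].
have h2 : (1 + y) `^ b <= (m * expR (k * y)) `^ b.
  by apply: ge0_ler_powR => //; rewrite nnegrE ltW// mulr_gt0// expR_gt0.
apply: le_trans h2 _; rewrite powRM; [|exact: ltW|exact: expR_ge0].
rewrite ler_pM2l ?powR_gt0//.
rewrite -expRM ler_expR mulrAC; apply: ler_wpM2r => //.
rewrite /k mulrAC ler_pdivrMr ?ltr_wpDl//.
by apply: ler_wpM2l; [exact: ltW|rewrite lerDl].
Qed.

Lemma in0y (x : R) : `]0, +oo[%classic x -> 0 < x.
Proof. by rewrite /= in_itv/= andbT. Qed.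

Lemma cvg_inv1D : ((1 + y)^-1 : R) @[y --> +oo] --> (0 : R).
Proof.
apply/(@gtr0_cvgV0 _ _ _ _ (fun y => 1 + y)).
  by near=> y; rewrite ltr_wpDr//; near: y; exact: nbhs_pinfty_ge.
by apply/cvgryPge => A; near=> y; rewrite -lerBlDl; near: y; exact: nbhs_pinfty_ge.
Unshelve. all: by end_near. Qed.

Lemma beta_weight_integrable (nu : R) : 0 < nu ->
  mu.-integrable `]0, +oo[ (EFin \o (fun y => nu * (y `^ (nu - 1) * (1 + y) `^ (- (nu + 1))))).
Proof.
move=> nu0; pose F y : R := (y / (1 + y)) `^ nu.
have d1 y : 0 < y -> der (fun y : R => (1 + y)^-1) y (- ((1 + y) ^- 2)).
  move=> y0; have h : 1 + y != 0 by rewrite lt0r_neq0// ltr_wpDr// ltW.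
  apply: der_eq (derV h (derD (der_cst 1 y) (der_id y))) _.
  by field.
have dF y : 0 < y -> der F y (nu * (y `^ (nu - 1) * (1 + y) `^ (- (nu + 1)))).
  move=> y0; have y1 : 0 < 1 + y by rewrite ltr_wpDr// ltW.
  have q0 : 0 < y / (1 + y) by rewrite divr_gt0.
  apply: der_eq (der_comp (derM (der_id y) (d1 y y0)) (der_powR nu q0)) _.
  rewrite powRM ?ltW ?invr_gt0// -powR_inv1 ?ltW// -powRrM.
  have -> : (1 + y) `^ (- (nu + 1)) = (1 + y) `^ (-1 * (nu - 1)) * (1 + y) ^- 2.
    rewrite -powR_mulrn ?ltW// -powRN -powRD; last by rewrite lt0r_neq0// implybT.
    by congr (_ `^ _); ring.
  rewrite powR_inv1 ?ltW//; field; exact: lt0r_neq0.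
apply: (fun mf cf h0 h1 f0 => (@half_line_FTC_ge0 _ _ F 0 1 mf dF cf h0 h1 f0).1) => [|y y0|||y y0].
- apply: measurable_funM => //; apply: measurable_funM; first exact: measurable_powR.
  apply: (measurableT_comp (@measurable_powR R (- (nu + 1)))); exact: measurable_funD.
- have y1 : 0 < 1 + y by rewrite ltr_wpDr// ltW.
  apply: cvgM; first exact: cvg_cst.
  apply: cvgM; first exact: powR_cont.
  exact: der_cont (der_comp (derD (der_cst 1 y) (der_id y)) (der_powR _ y1)).
- apply: (@squeeze_cvgr _ _ _ _ (fun=> 0) (fun y => y `^ nu)); last 2 first.
  + exact: cvg_cst.
  + exact: powR_cvg0.
  near=> y; have y0 : 0 < y by near: y; exact: nbhs_right_gt.
  have y1 : 0 < 1 + y by rewrite ltr_wpDr// ltW.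
  rewrite powR_ge0/=; apply: ge0_ler_powR; [exact: ltW|rewrite nnegrE ltW// divr_gt0//|by rewrite nnegrE ltW|].
  by rewrite ler_pdivrMr// mulrDr mulr1 lerDl; apply: mulr_ge0; exact: ltW.
- have h : (y / (1 + y) : R) @[y --> +oo] --> (1 : R).
    have hh : (1 - (1 + y)^-1 : R) @[y --> +oo] --> (1 - 0 : R).
      by apply: cvgB; [exact: cvg_cst|exact: cvg_inv1D].
    rewrite subr0 in hh; apply: cvg_trans hh; apply: near_eq_cvg; near=> y.
    have y0 : 0 <= y by near: y; exact: nbhs_pinfty_ge.
    by field; rewrite lt0r_neq0// ltr_wpDr.
  have := cvg_comp _ _ h (powR_cont (nu := nu) ltr01).
  by rewrite powR1.
- by rewrite mulr_ge0 ?mulr_ge0 ?powR_ge0// ltW.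
Unshelve. all: by end_near. Qed.

Lemma gamma_weight_integrable (nu c : R) : 0 < nu -> 0 < c ->
  mu.-integrable `]0, +oo[ (EFin \o (fun y => y `^ (nu - 1) * expR (- (c * y)))).
Proof.
move=> nu0 c0.
have nu1 : 0 <= nu + 1 by rewrite addr_ge0// ltW.
have [K K0 hK] := expRN_le_weight c0 nu1.
have I := @integrableZl _ _ _ mu _ (measurable_itv _) (K / nu) _ (beta_weight_integrable nu0).
apply: (@integrable_dom _ _ _ mu _ _ (fun y => K / nu * (nu * (y `^ (nu - 1) * (1 + y) `^ (- (nu + 1)))))).
- exact: measurable_itv.
- apply: measurable_funM; first exact: measurable_powR.
  by apply: measurableT_comp => //; apply: measurableT_comp => //; exact: measurable_funM.
- exact: I.
- move=> y /in0y y0; rewrite ger0_norm ?mulr_ge0 ?powR_ge0 ?expR_ge0//.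
  apply: le_trans (ler_wpM2l (powR_ge0 _ _) (hK y (ltW y0))) _.
  by rewrite le_eqVlt; apply/orP; left; apply/eqP; field; rewrite lt0r_neq0.
Qed.

(** The left side is a measure with the right value on half-open intervals, and these determine
    Lebesgue measure. *)
Lemma lebesgue_measureZ (c : R) (c0 : 0 < c) (A : set R) : measurable A ->
  (c%:E * pushforward mu ( *%R c : _ -> measurableTypeR R) A = mu A)%E.
Proof.
move=> mA.
have mphi : measurable_fun (setT : set R) ( *%R c : _ -> measurableTypeR R).
  exact: measurable_funM.
have U := @lebesgue_measure_unique R
  (mscale (NngNum (ltW c0)) (pushforward mu ( *%R c : _ -> measurableTypeR R))).
apply/esym/(U mphi) => // _ [[a b]] _ <-.
pose I : set R := `](a / c), (b / c)]%classic.
transitivity (c%:E * mu I)%E; last first.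
  rewrite (_ : I = *%R c @^-1` `]a, b]%classic)//.
  by apply/seteqP; split => x; rewrite /I /= !in_itv/= ltr_pdivrMr// ler_pdivlMr// mulrC.
rewrite /I !lebesgue_measure_itv/= !lte_fin ltr_pM2r ?invr_gt0//.
case: ifPn => _; last by rewrite mule0.
by rewrite -!EFinB -EFinM; congr EFin; field; rewrite lt0r_neq0.
Qed.

Lemma ge0_integral_scale (c : R) (f : R -> \bar R) : 0 < c -> measurable_fun setT f ->
  (forall x, 0 <= f x)%E ->
  (\int[mu]_(x in `]0%R, +oo[) f x = c%:E * \int[mu]_(x in `]0%R, +oo[) f (c * x)%R)%E.
Proof.
move=> c0 mf f0.
have mphi : measurable_fun (setT : set (measurableTypeR R)) ( *%R c : _ -> measurableTypeR R).
  exact: measurable_funM.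
have mI : measurable (`]0, +oo[%classic : set (measurableTypeR R)) by exact: measurable_itv.
have mfI : measurable_fun (`]0, +oo[%classic : set (measurableTypeR R)) f by exact: measurable_funTS.
have h := @ge0_integral_pushforward _ _ _ _ _ _ mphi mu _ f mI mfI (fun x _ => f0 x).
have h2 := @ge0_integral_mscale _ _ _ (pushforward mu ( *%R c : _ -> measurableTypeR R)) _ mI
  (NngNum (ltW c0)) f mfI (fun x _ => f0 x).
have E : ( *%R c : _ -> measurableTypeR R) @^-1` `]0, +oo[ = `]0, +oo[%classic.
  by apply/seteqP; split => x; rewrite /= !in_itv/= !andbT pmulr_rgt0.
rewrite E in h; rewrite -[X in (_ * X)%E]h.
rewrite -[RHS](h2 mphi).
by apply: eq_measure_integral => //= A mA AS; apply/esym/lebesgue_measureZ.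
Qed.

Lemma GammaE (a : R) : 0 < a ->
  (\int[mu]_(y in `]0%R, +oo[) (y `^ (a - 1) * expR (- y))%:E = (Gamma a)%:E)%E.
Proof.
move=> a0; have := gamma_weight_integrable a0 ltr01.
under [EFin \o _]funext => y do rewrite /= mul1r.
by move=> i; rewrite /Gamma /Rintegral fineK// integrable_fin_num//; exact: measurable_itv.
Qed.

Lemma gamma_scale (a y : R) : 0 < a -> 0 < y ->
  (\int[mu]_(s in `]0%R, +oo[) (s `^ (a - 1) * expR (- (s * y)))%:E =
  (y `^ (- a) * Gamma a)%:E)%E.
Proof.
move=> a0 y0; have := GammaE a0.
rewrite (ge0_integral_scale y0); last 2 first.
- apply/measurable_EFinP; apply: measurable_funM; first exact: measurable_powR.
  by apply: measurableT_comp.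
- by move=> x; rewrite lee_fin mulr_ge0 ?powR_ge0 ?expR_ge0.
under eq_integral => x /set_mem /in0y x0.
  rewrite powRM ?ltW// -mulrA EFinM (mulrC y); over.
rewrite ge0_integralZl//; last 3 first.
- apply/measurable_EFinP; apply: measurable_funTS; apply: measurable_funM; first exact: measurable_powR.
  by apply: measurableT_comp => //; apply: measurableT_comp => //; exact: measurable_funM.
- by move=> x _; rewrite lee_fin mulr_ge0 ?powR_ge0 ?expR_ge0.
- by rewrite lee_fin powR_ge0.
rewrite muleA -EFinM mulrC -powR_subr1// => h.
rewrite EFinM -h muleA -EFinM powRN mulVf ?mul1e//; exact/lt0r_neq0/powR_gt0.
Qed.

Lemma Gamma_gt0 (a : R) : 0 < a -> 0 < Gamma a.
Proof.
move=> a0; rewrite -lte_fin -GammaE//.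
(* A lower bound of the integrand for [1 <= y <= 2], where the power is at least [y^-1 >= 1 / 2]
   because [a - 1 >= -1]. *)
pose c : R := 2^-1 * expR (- 2).
have c0 : 0 < c by rewrite mulr_gt0 ?invr_gt0 ?expR_gt0.
apply: lt_le_trans (_ : (\int[mu]_(y in `[1%R, 2%R]) (cst c%:E) y <= _)%E).
  rewrite integral_cst//= lebesgue_measure_itv/= lte_fin ltr1n -EFinB -EFinM lte_fin.
  by rewrite mulr_gt0// subr_gt0 ltr1n.
pose f (y : R) := (y `^ (a - 1) * expR (- y))%:E.
have mf : measurable_fun setT f.
  apply/measurable_EFinP; apply: measurable_funM; first exact: measurable_powR.
  by apply: measurableT_comp.
have f0 y : (0 <= f y)%E by rewrite lee_fin mulr_ge0 ?powR_ge0 ?expR_ge0.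
apply: le_trans (_ : (\int[mu]_(y in `[1%R, 2%R]) f y <= _)%E).
  apply: ge0_le_integral => //; first by move=> y _; rewrite /= lee_fin ltW.
    exact: measurable_funTS.
  move=> y; rewrite /= in_itv/= => /andP[y1 y2].
  rewrite lee_fin ler_pM ?invr_ge0 ?expR_ge0//; last by rewrite ler_expR lerN2.
  apply: le_trans (_ : y^-1 <= _); first by rewrite lef_pV2 ?posrE// (lt_le_trans ltr01).
  rewrite -powR_inv1 ?(le_trans ler01)// ler_powR//; lra.
apply: ge0_subset_integral => //; first exact: measurable_funTS.
by move=> y; rewrite /= !in_itv/= andbT => /andP[y1 _]; exact: lt_le_trans y1.
Qed.

End gamma.

Lemma tonelli_on {R : realType} d1 d2 (T1 : measurableType d1) (T2 : measurableType d2)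
    (m1 : {sigma_finite_measure set T1 -> \bar R})
    (m2 : {sigma_finite_measure set T2 -> \bar R})
    (D1 : set T1) (D2 : set T2) (f : T1 * T2 -> \bar R) :
  measurable D1 -> measurable D2 -> measurable_fun setT f ->
  (forall x y, D1 x -> D2 y -> 0 <= f (x, y))%E ->
  (\int[m1]_(x in D1) \int[m2]_(y in D2) f (x, y) =
   \int[m2]_(y in D2) \int[m1]_(x in D1) f (x, y))%E.
Proof.
move=> mD1 mD2 mf f0; pose g := (f \_ (D1 `*` D2))%E.
have mD : measurable (D1 `*` D2) by exact: measurableX.
have mg : measurable_fun setT g.
  by apply/(measurable_restrictT _ mD); exact: measurable_funTS.
have g0 z : (0 <= g z)%E.
  by rewrite /g patchE; case: ifP => // /set_mem; case: z => x y [/= h k]; exact: f0.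
have gE1 x y : D1 x -> g (x, y) = ((fun y => f (x, y)) \_ D2) y.
  move=> h; rewrite /g !patchE; case: (pselect (D2 y)) => k.
    by rewrite !mem_set.
  by rewrite !memNset// => -[].
have gE2 x y : D2 y -> g (x, y) = ((fun x => f (x, y)) \_ D1) x.
  move=> h; rewrite /g !patchE; case: (pselect (D1 x)) => k.
    by rewrite !mem_set.
  by rewrite !memNset// => -[].
have g1 x y : ~ D1 x -> g (x, y) = 0%E by move=> h; rewrite /g patchE memNset// => -[].
have g2 x y : ~ D2 y -> g (x, y) = 0%E by move=> h; rewrite /g patchE memNset// => -[].
have F := @fubini_tonelli _ _ _ _ _ m1 m2 _ mg g0.
transitivity (\int[m1]_x \int[m2]_y g (x, y))%E.
  rewrite integral_mkcond; apply: eq_integral => x _; rewrite patchE.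
  case: ifPn => [/set_mem h|/negP h].
    by rewrite integral_mkcond; apply: eq_integral => y _; rewrite gE1.
  by under eq_integral do [rewrite g1; last by move=> k; apply: h; rewrite inE]; rewrite integral0.
rewrite F [RHS]integral_mkcond; apply: eq_integral => y _; rewrite patchE.
case: ifPn => [/set_mem h|/negP h].
  by rewrite [RHS]integral_mkcond; apply: eq_integral => x _; rewrite gE2.
by under eq_integral do [rewrite g2; last by move=> k; apply: h; rewrite inE]; rewrite integral0.
Qed.

Lemma measurable_expRNM {R : realType} (y : R) :
  measurable_fun setT (fun s : R => expR (- (s * y))).
Proof.
apply: measurableT_comp; first exact: measurable_expR.
by apply: measurableT_comp => //; exact: measurable_funM.
Qed.

(** * Mellin and Laplace transforms of the semigroup *)

Section moment.
Context {R : realType} (p : nat) (T : 'M[R]_p) (S : R -> 'M[R]_p).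
Notation mu := (@lebesgue_measure R).
Hypotheses (hS : semigroup_block T S) (sT : stable T).

Let D : set (measurableTypeR R) := `]0, +oo[%classic.
Let mD : measurable D. Proof. exact: measurable_itv. Qed.

(** The Mellin transform of [S], which turns out to be [Gamma nu] times the power [- nu] of [- T];
    [lap] is its Laplace transform, the resolvent of [T]. *)
Definition moment (nu : R) : 'M[R]_p :=
  \matrix_(i, j) \int[mu]_(y in `]0, +oo[) (y `^ (nu - 1) * S y i j).

Definition lap (u : R) : 'M[R]_p :=
  \matrix_(i, j) \int[mu]_(y in `]0, +oo[) (expR (- (u * y)) * S y i j).

Lemma measurable_block i j : measurable_fun setT (fun y => S y i j).
Proof. by apply: continuous_measurable_fun; exact: (block_cont hS). Qed.

Lemma moment_integrable nu i j : 0 < nu ->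
  mu.-integrable `]0, +oo[ (EFin \o (fun y => y `^ (nu - 1) * S y i j)).
Proof.
move=> nu0; have [C [e [C0 e0 hC]]] := S_decay hS sT.
apply: (@integrable_dom _ _ _ mu _ _ (fun y => C * (y `^ (nu - 1) * expR (- (e * y))))) => //.
- by apply: measurable_funM; [exact: measurable_powR|exact: measurable_block].
- exact: (@integrableZl _ _ _ mu _ mD C _ (gamma_weight_integrable nu0 e0)).
- move=> y /in0y y0; have yl := ltW y0.
  rewrite ger0_norm ?mulr_ge0 ?powR_ge0 ?(block_ge0 hS)// mulrCA.
  by apply: ler_wpM2l; [exact: powR_ge0|exact: hC].
Qed.

Lemma lap_integrable u i j : 0 <= u ->
  mu.-integrable `]0, +oo[ (EFin \o (fun y => expR (- (u * y)) * S y i j)).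
Proof.
(* The dominating function is the integrand of [moment 1], whose weight is 1. *)
move=> u0; apply: (@integrable_dom _ _ _ mu _ _ (fun y => y `^ (1 - 1) * S y i j)) => //.
- apply: measurable_funM; last exact: measurable_block.
  by apply: measurableT_comp => //; apply: measurableT_comp => //; exact: measurable_funM.
- exact: moment_integrable.
- move=> y /in0y y0; have yl := ltW y0.
  rewrite ger0_norm ?mulr_ge0 ?expR_ge0 ?(block_ge0 hS)// subrr powRr0 mul1r.
  rewrite -[leRHS]mul1r; apply: ler_wpM2r; first exact: (block_ge0 hS).
  by rewrite -expR0 ler_expR oppr_le0 mulr_ge0.
Qed.

(** Integration by parts against [S' = S T], with boundary term [la] at 0 and none at infinity. The
    exponential weight gives the resolvent equation, the power weight the functional equation of
    [moment]. *)
Lemma block_by_parts (w w' : R -> R) (la : R) i j :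
  (forall y, 0 < y -> der w y (w' y)) ->
  (forall y, 0 < y -> {for y, continuous w'}) ->
  measurable_fun setT w -> measurable_fun setT w' ->
  mu.-integrable `]0, +oo[ (EFin \o (fun y => w' y * S y i j)) ->
  (forall k, mu.-integrable `]0, +oo[ (EFin \o (fun y => w y * S y i k))) ->
  w y * S y i j @[y --> 0^'+] --> la -> w y * S y i j @[y --> +oo] --> (0 : R) ->
  \int[mu]_(y in `]0, +oo[) (w' y * S y i j) +
  \sum_k \int[mu]_(y in `]0, +oo[) (w y * S y i k) * T k j = - la.
Proof.
move=> dw cw mw mw' i1 i2 l0 ly.
pose f y := w' y * S y i j + \sum_k T k j * (w y * S y i k).
have dF y : 0 < y -> der (fun y => w y * S y i j) y (f y).
  move=> y0; apply: der_eq (derM (dw y y0) (block_der hS i j y0)) _.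
  by rewrite /f mxE mulr_sumr; congr (_ + _); apply: eq_bigr => k _; ring.
have iT k : mu.-integrable `]0, +oo[ (EFin \o (fun y => T k j * (w y * S y i k))).
  exact: (@integrableZl _ _ _ mu _ mD (T k j) _ (i2 k)).
have iS : mu.-integrable `]0, +oo[ (EFin \o (fun y => \sum_k T k j * (w y * S y i k))).
  rewrite (_ : EFin \o _ = fun y => \sum_k (T k j * (w y * S y i k))%:E)%E; last first.
    by apply/funext => y /=; rewrite sumEFin.
  apply: integrable_sum => // k _; exact: iT.
have mf : measurable_fun setT f.
  apply: measurable_funD; first by apply: measurable_funM => //; exact: measurable_block.
  apply: measurable_sum => k; apply: measurable_funM => //; apply: measurable_funM => //.
  exact: measurable_block.
have cf y : 0 < y -> {for y, continuous f}.
  move=> y0; apply: cvgD.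
    by apply: cvgM; [exact: cw|exact: (block_cont hS)].
  apply: cvg_sum => k; apply: cvgM; first exact: cvg_cst.
  by apply: cvgM; [exact: der_cont (dw y y0)|exact: (block_cont hS)].
have ifn : mu.-integrable `]0, +oo[ (EFin \o f).
  by have := integrableD mD i1 iS; apply: eq_integrable => // y _ /=; rewrite EFinD.
have := half_line_FTC dF cf l0 ly ifn.
rewrite sub0r => <-.
rewrite [RHS](@RintegralD _ _ _ mu D _ _ mD i1 iS).
congr (_ + _); rewrite (@Rintegral_sum _ _ _ mu D _ (fun k y => T k j * (w y * S y i k)) mD iT); apply: eq_bigr => k _.
rewrite mulrC -(@RintegralZl _ _ _ mu D _ _ mD (i2 k)); exact: eq_Rintegral.
Qed.

Lemma block_cvg0 i j : S y i j @[y --> +oo] --> (0 : R).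
Proof.
have [C [e [C0 e0 hC]]] := S_decay hS sT.
have [K K0 hK] := expRN_le_weight e0 ler01.
apply: (@squeeze_cvgr _ _ _ _ (fun=> 0) (fun y => C * K * (1 + y)^-1)); last 2 first.
- exact: cvg_cst.
- rewrite -[X in _ --> X](mulr0 (C * K)); apply: cvgM; first exact: cvg_cst.
  exact: cvg_inv1D.
near=> y; have y0 : 0 <= y by near: y; exact: nbhs_pinfty_ge.
rewrite (block_ge0 hS)//=; apply: le_trans (hC _ i j y0) _.
rewrite -mulrA; apply: ler_wpM2l => //; apply: le_trans (hK y y0) _.
by rewrite powR_inv1// addr_ge0.
Unshelve. all: by end_near. Qed.

(** Integration by parts with the weight [expR (- (u y))], whose boundary term at 0 is [S 0 = 1]. At
    [u = 0] this also proves that [T] is invertible. *)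
Lemma lap_mul u : 0 <= u -> lap u *m (u%:M - T) = 1%:M.
Proof.
move=> u0; apply/matrixP => i j.
have dw y : 0 < y -> der (fun y => expR (- (u * y))) y (- u * expR (- (u * y))).
  move=> y0; apply: der_eq (der_comp (derN (derM (der_cst u y) (der_id y))) (der_exp _)) _.
  by rewrite mul0r add0r mulr1 mulrC.
have mw : measurable_fun setT (fun y : R => expR (- (u * y))).
  by apply: measurableT_comp => //; apply: measurableT_comp => //; exact: measurable_funM.
have := @block_by_parts _ _ (i == j)%:R i j dw _ mw _ _ (fun k => lap_integrable i k u0).
have -> : \int[mu]_(y in `]0, +oo[) (- u * expR (- (u * y)) * S y i j) = - u * lap u i j.
  rewrite mxE -(@RintegralZl _ _ _ mu D _ _ mD (lap_integrable i j u0)).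
  by apply: eq_Rintegral => y _; rewrite mulrA.
move=> H; have {}H : - u * lap u i j +
    \sum_k \int[mu]_(y in `]0, +oo[) (expR (- (u * y)) * S y i k) * T k j = - (i == j)%:R.
  apply: H => [y y0||||].
  - by apply: cvgM; [exact: cvg_cst|exact: der_cont (dw y y0)].
  - exact: measurable_funM.
  - have := @integrableZl _ _ _ mu _ mD (- u) _ (lap_integrable i j u0).
    by apply: eq_integrable => // y _ /=; rewrite -EFinM mulrA.
  - have : expR (- (u * y)) * S y i j @[y --> 0^'+] --> expR (- (u * 0)) * S 0 i j.
      apply: cvg_at_right_filter; apply: cvgM; last exact: (block_cont hS).
      apply: der_cont (der_comp (derN (derM (der_cst u 0) (der_id 0))) (der_exp _)).
    by rewrite mulr0 oppr0 expR0 mul1r (block0 hS) mxE.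
  - apply: (@squeeze_cvgr _ _ _ _ (fun=> 0) (fun y => S y i j)); last 2 first.
    + exact: cvg_cst.
    + exact: block_cvg0.
    near=> y; have y0 : 0 <= y by near: y; exact: nbhs_pinfty_ge.
    rewrite mulr_ge0 ?expR_ge0 ?(block_ge0 hS)//=.
    rewrite -[leRHS]mul1r; apply: ler_wpM2r; first exact: (block_ge0 hS).
    by rewrite -expR0 ler_expR oppr_le0 mulr_ge0.
rewrite mulmxBr mxE [X in _ + X]mxE mul_mx_scalar [X in X - _]mxE [X in _ - X]mxE [RHS]mxE.
apply: oppr_inj; rewrite -H opprB addrC mulNr; congr (_ + _).
by apply: eq_bigr => k _; rewrite !mxE.
Unshelve. all: by end_near. Qed.

Lemma lapE u : 0 <= u -> lap u = invmx (u%:M - T) /\ u%:M - T \in unitmx.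
Proof.
move=> u0; have h := lap_mul u0; have [_ U] := mulmx1_unit h; split=> //.
by rewrite -[LHS](mulmxK U) h mul1mx.
Qed.

Lemma moment1E : moment 1 = lap 0.
Proof.
apply/matrixP => i j; rewrite !mxE; apply: eq_Rintegral => y _.
by rewrite subrr powRr0 mul0r oppr0 expR0.
Qed.

Lemma moment1 : moment 1 = invmx (- T).
Proof. by rewrite moment1E; have [-> _] := lapE (lexx 0); rewrite raddf0 sub0r. Qed.

Lemma block_unit : - T \in unitmx.
Proof. by have [_] := lapE (lexx 0); rewrite raddf0 sub0r. Qed.

Lemma lap_ge0 u i j : 0 <= lap u i j.
Proof.
rewrite mxE; apply: Rintegral_ge0 => y /in0y /ltW y0.
by rewrite mulr_ge0 ?expR_ge0 ?(block_ge0 hS).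
Qed.

Lemma lap_le u i j : 0 <= u -> lap u i j <= lap 0 i j.
Proof.
move=> u0; rewrite !mxE; apply: le_Rintegral => //; try exact: lap_integrable.
move=> y /in0y /ltW y0; apply: ler_wpM2r; first exact: (block_ge0 hS).
by rewrite ler_expR lerN2 mul0r mulr_ge0.
Qed.

Lemma moment_mul a : 0 < a -> moment (a + 1) *m (- T) = a *: moment a.
Proof.
move=> a0; apply/matrixP => i j.
have a1 : 0 < a + 1 by rewrite addr_gt0.
have i2 k : mu.-integrable `]0, +oo[ (EFin \o (fun y => y `^ a * S y i k)).
  by have := moment_integrable i k a1; rewrite addrK.
have := @block_by_parts _ _ 0 i j (fun y y0 => der_powR a y0) _ _ _ _ i2.
have -> : \int[mu]_(y in `]0, +oo[) (a * y `^ (a - 1) * S y i j) = a * moment a i j.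
  rewrite mxE -(@RintegralZl _ _ _ mu D _ _ mD (moment_integrable i j a0)).
  by apply: eq_Rintegral => y _; rewrite mulrA.
move=> H; have {}H : a * moment a i j +
    \sum_k \int[mu]_(y in `]0, +oo[) (y `^ a * S y i k) * T k j = - 0.
  apply: H => [y y0|||||].
  - by apply: cvgM; [exact: cvg_cst|exact: powR_cont].
  - exact: measurable_powR.
  - by apply: measurable_funM => //; exact: measurable_powR.
  - have := @integrableZl _ _ _ mu _ mD a _ (moment_integrable i j a0).
    by apply: eq_integrable => // y _ /=; rewrite -EFinM mulrA.
  - have : y `^ a * S y i j @[y --> 0^'+] --> 0 * S 0 i j.
      apply: cvgM; first exact: powR_cvg0.
      by apply: cvg_at_right_filter; exact: (block_cont hS).
    by rewrite mul0r.
  - have [C [e [C0 e0 hC]]] := S_decay hS sT.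
    have [K K0 hK] := expRN_le_weight e0 (ltW a1).
    apply: (@squeeze_cvgr _ _ _ _ (fun=> 0) (fun y => C * K * (1 + y)^-1)); last 2 first.
    + exact: cvg_cst.
    + rewrite -[X in _ --> X](mulr0 (C * K)); apply: cvgM; first exact: cvg_cst.
      exact: cvg_inv1D.
    near=> y; have y0 : 0 <= y by near: y; exact: nbhs_pinfty_ge.
    have y1 : 0 < 1 + y by rewrite ltr_wpDr.
    rewrite mulr_ge0 ?powR_ge0 ?(block_ge0 hS)//=.
    have q : y `^ a <= (1 + y) `^ a.
      by apply: ge0_ler_powR; rewrite ?nnegrE ?lerDr//; exact: ltW.
    have s : S y i j <= C * (K * (1 + y) `^ (- (a + 1))).
      by apply: le_trans (hC _ i j y0) _; apply: ler_wpM2l => //; exact: hK.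
    apply: le_trans (ler_pM (powR_ge0 _ _) (block_ge0 hS i j y0) q s) _.
    have -> : (1 + y)^-1 = (1 + y) `^ a * (1 + y) `^ (- (a + 1)).
      rewrite -powRD; last by rewrite lt0r_neq0// implybT.
      by rewrite -powR_inv1 ?ltW//; congr (_ `^ _); ring.
    by rewrite le_eqVlt; apply/orP; left; apply/eqP; ring.
have E : (moment (a + 1) *m T) i j =
    \sum_k \int[mu]_(y in `]0, +oo[) (y `^ a * S y i k) * T k j.
  by rewrite mxE; apply: eq_bigr => k _; rewrite mxE addrK.
by apply/eqP; rewrite mulmxN mxE [X in _ == X]mxE E eq_sym -subr_eq0 opprK H oppr0.
Unshelve. all: by end_near. Qed.

Lemma stieltjes a i j : 0 < a < 1 ->
  (\int[mu]_(s in `]0%R, +oo[) (s `^ (- a) * lap s i j)%:E = (Gamma (1 - a) * moment a i j)%:E)%E.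
Proof.
move=> /andP[a0 a1]; have b0 : 0 < 1 - a by rewrite subr_gt0.
pose f (z : R * R) := (z.1 `^ (- a) * (expR (- (z.1 * z.2)) * S z.2 i j))%:E.
have mf : measurable_fun setT f.
  apply/measurable_EFinP; apply: measurable_funM.
    exact: (measurableT_comp (@measurable_powR R (- a)) (@measurable_fst _ _ _ _)).
  apply: measurable_funM; last exact: (measurableT_comp (measurable_block i j) (@measurable_snd _ _ _ _)).
  by apply: measurableT_comp => //; apply: measurableT_comp => //; exact: measurable_funM.
have F := @tonelli_on R _ _ _ _ mu mu D D f mD mD mf.
have EL s : 0 <= s -> ((lap s i j)%:E = \int[mu]_(y in D) (expR (- (s * y)) * S y i j)%:E)%E.
  move=> s0; rewrite mxE /Rintegral fineK; first by [].
  exact: (integrable_fin_num mD (lap_integrable i j s0)).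
have EM : ((moment a i j)%:E = \int[mu]_(y in D) (y `^ (a - 1) * S y i j)%:E)%E.
  rewrite mxE /Rintegral fineK; first by [].
  exact: (integrable_fin_num mD (moment_integrable i j a0)).
have fL s y : D y -> (0 <= (expR (- (s * y)) * S y i j)%:E)%E.
  by move=> /in0y /ltW y0; rewrite lee_fin; apply: mulr_ge0; [exact: expR_ge0|exact: (block_ge0 hS)].
transitivity (\int[mu]_(s in D) \int[mu]_(y in D) f (s, y))%E.
  apply: eq_integral => s /set_mem /in0y s0.
  rewrite EFinM (EL s (ltW s0)).
  have k0 : (0 <= (s `^ (- a))%:E)%E by rewrite lee_fin powR_ge0.
  have Z := ge0_integralZl mu mD (measurable_int mu (lap_integrable i j (ltW s0))) (fL s) k0.
  apply: etrans (esym Z) _; apply: eq_integral => y _.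
  by rewrite /f /= EFinM.
rewrite F; last first.
  move=> s y _ Dy; rewrite /f EFinM; apply: mule_ge0; last exact: fL.
  by rewrite lee_fin powR_ge0.
have k0 : (0 <= (Gamma (1 - a))%:E)%E by rewrite lee_fin; apply: ltW; exact: Gamma_gt0.
have fM y : D y -> (0 <= (y `^ (a - 1) * S y i j)%:E)%E.
  by move=> /in0y /ltW y0; rewrite lee_fin; apply: mulr_ge0; [exact: powR_ge0|exact: (block_ge0 hS)].
have Z := ge0_integralZl mu mD (measurable_int mu (moment_integrable i j a0)) fM k0.
rewrite EFinM EM; apply: etrans _ Z.
apply: eq_integral => y /set_mem /in0y y0.
have g := gamma_scale b0 y0.
transitivity ((S y i j)%:E * \int[mu]_(s in `]0%R, +oo[) (s `^ (1 - a - 1) * expR (- (s * y)))%:E)%E.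
  have mh : measurable_fun setT (fun s : R => s `^ (1 - a - 1) * expR (- (s * y))).
    by apply: measurable_funM; [exact: measurable_powR|exact: measurable_expRNM].
  have mg : measurable_fun D (fun s => (s `^ (1 - a - 1) * expR (- (s * y)))%:E).
    by apply/measurable_EFinP; exact: measurable_funTS mh.
  have g0 s : D s -> (0 <= (s `^ (1 - a - 1) * expR (- (s * y)))%:E)%E.
    by move=> _; rewrite lee_fin; apply: mulr_ge0; [exact: powR_ge0|exact: expR_ge0].
  have s0 : (0 <= (S y i j)%:E)%E by rewrite lee_fin; apply: (block_ge0 hS); exact: ltW.
  apply: etrans _ (ge0_integralZl mu mD mg g0 s0).
  apply: eq_integral => s _; rewrite /f /= -EFinM; congr EFin.
  by rewrite (_ : 1 - a - 1 = - a); ring.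
by rewrite g -!EFinM /=; congr EFin; rewrite opprB; ring.
Qed.

End moment.

(** * The fractional power z ^ (- a) as a Stieltjes integral *)

Section gamma_function.
Context {R : realType}.
Notation mu := (@lebesgue_measure R).

(** A single transient state with exit rate 1. Its [moment] is Gamma and its [lap] is [1 / (1 + s)],
    so the functional equation, the value at 1 and the beta integral are instances of the matrix
    lemmas. *)
Let T1 : 'M[R]_1 := (-1)%:M.
Let S1 (t : R) : 'M[R]_1 := (expR (- t))%:M.

Let S1E t i j : S1 t i j = expR (- t).
Proof. by rewrite !ord1 mxE eqxx mulr1n. Qed.

Let S1_block : semigroup_block T1 S1.
Proof.
have d t : der (fun t : R => expR (- t)) t (- expR (- t)).
  by apply: der_eq (der_comp (derN (der_id t)) (der_exp _)) _; rewrite mulrN1.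
have E i j : (fun t => S1 t i j) = (fun t => expR (- t)) by apply/funext => t; exact: S1E.
split.
- by move=> i j; rewrite E => t; exact: der_cont (d t).
- move=> t i j t0; rewrite E; apply: der_eq (d t) _.
  by rewrite /T1 mul_mx_scalar mxE S1E mulN1r.
- by rewrite /S1 oppr0 expR0.
- by move=> t i j t0; rewrite S1E expR_ge0.
- by move=> t i j t0; rewrite S1E -expR0 ler_expR oppr_le0.
Qed.

Let S1_stable : stable T1.
Proof.
move=> a /eigenvalueP[v vE v0].
have : v *m cmx T1 = (-1) *: v by rewrite /cmx /T1 map_scalar_mx mul_mx_scalar rmorphN1.
rewrite vE => /eqP; rewrite -subr_eq0 -scalerBl scaler_eq0 (negbTE v0) orbF subr_eq0.
by move=> /eqP ->; rewrite ReN /= oppr_lt0 ltr01.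
Qed.

Let momentE nu : moment S1 nu 0 0 = Gamma nu.
Proof. by rewrite mxE /Gamma; apply: eq_Rintegral => y _; rewrite S1E. Qed.

Lemma Gamma_succ (a : R) : 0 < a -> Gamma (a + 1) = a * Gamma a.
Proof.
move=> a0; have := moment_mul S1_block S1_stable a0.
move=> /matrixP/(_ 0 0); rewrite /T1 mxE [RHS]mxE -!momentE => <-.
by rewrite big_ord1 !mxE eqxx mulr1n opprK mulr1.
Qed.

Lemma Gamma1 : Gamma 1 = 1 :> R.
Proof.
rewrite -momentE (moment1 S1_block S1_stable) /T1.
rewrite (_ : - (-1)%:M = 1%:M) ?invmx1 ?mxE ?eqxx//.
by apply/matrixP => i j; rewrite !mxE mulNrn opprK.
Qed.

Lemma beta_reflection (a : R) : 0 < a < 1 ->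
  (\int[mu]_(s in `]0%R, +oo[) (s `^ (- a) * (1 + s)^-1)%:E = (Gamma (1 - a) * Gamma a)%:E)%E.
Proof.
move=> a01; rewrite -(momentE a) -(stieltjes S1_block S1_stable _ _ a01).
apply: eq_integral => s /set_mem /in0y s0.
have := lap_mul S1_block S1_stable (ltW s0).
move=> /matrixP/(_ 0 0); rewrite /T1 mxE big_ord1 !mxE eqxx !mulr1n opprK => h.
congr (_ * _)%:E; have s1 : 1 + s != 0 by rewrite lt0r_neq0// ltr_wpDr// ltW.
by apply: (mulIf s1); rewrite mulVf// [X in _ * X]addrC h.
Qed.

End gamma_function.

Section balakrishnan.
Context {R : realType}.
Notation mu := (@lebesgue_measure R).

Let D : set (measurableTypeR R) := `]0, +oo[%classic.
Let mD : measurable D. Proof. exact: measurable_itv. Qed.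

Lemma cder_ccont (A : set R) (f : R -> R[i]) :
  (forall u, A u -> exists l, cder f u l) -> ccont A f.
Proof.
by move=> h; split; apply: continuous_in_subspaceT => u /set_mem /h [l [hr hi]];
  [exact: der_cont hr|exact: der_cont hi].
Qed.

(* The distance from [- s] to the sector [{|arg w| <= th, |w| >= exp (- B)}] is at
   least a constant multiple of [1 + s]. *)
Lemma sector_bound (th B : R) : 0 <= th < pi -> 0 <= B ->
  exists2 c : R, 0 < c & forall (M : R[i]) s, `|Im M| <= th -> - B <= Re M -> 0 <= s ->
    cexp M + s%:C != 0 /\ n1 ((cexp M + s%:C)^-1) <= c * (1 + s)^-1.
Proof.
move=> /andP[th0 thpi] B0.
have cpi : -1 < cos th.
  by rewrite -cospi ltr_cos ?in_itv/= ?th0 ?pi_ge0 ?lexx ?ltW.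
(* With this [k], [2 rho s cos] is at least [- (1 - k) (rho^2 + s^2)] in the sector, so
   [|w + s|^2 >= k (rho^2 + s^2)]; [r0] is the least possible modulus. *)
pose k := Num.min 1 (1 + cos th); pose r0 := expR (- B).
have k0 : 0 < k by rewrite /k lt_min ltr01/= -ltrBlDl sub0r.
have k1 : k <= 1 by rewrite /k ge_min lexx.
have kc : k <= 1 + cos th by rewrite /k ge_min lexx orbT.
have r00 : 0 < r0 := expR_gt0 _.
have r01 : r0 <= 1 by rewrite -expR0 ler_expR oppr_le0.
exists (4 / (k * r0)) => [|M s hM hB s0]; first by rewrite divr_gt0 ?mulr_gt0.
set w := cexp M.
pose rho := expR (Re M).
have rr : r0 <= rho by rewrite ler_expR.
have cc : k - 1 <= cos (Im M).
  have -> : cos (Im M) = cos `|Im M| by case: (ger0P (Im M)) => // _; rewrite cosN.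
  apply: le_trans (_ : cos th <= _); first by rewrite lerBlDl.
  rewrite leNgt ltr_cos ?in_itv/= ?normr_ge0 ?th0 ?ltW//; first by rewrite -leNgt.
  exact: le_lt_trans hM thpi.
pose e := k * r0 / 2 * (1 + s).
have e0 : 0 < e by rewrite mulr_gt0 ?divr_gt0 ?mulr_gt0// ltr_wpDr.
have E : Re (w + s%:C) ^+ 2 + Im (w + s%:C) ^+ 2 = rho ^+ 2 + 2 * rho * s * cos (Im M) + s ^+ 2.
  rewrite !ReImE /= -/rho addr0.
  have h := cos2Dsin2 (Im M).
  transitivity (rho ^+ 2 * (cos (Im M) ^+ 2 + sin (Im M) ^+ 2) + 2 * rho * s * cos (Im M) + s ^+ 2).
    by ring.
  by rewrite h mulr1.
have he : e ^+ 2 <= Re (w + s%:C) ^+ 2 + Im (w + s%:C) ^+ 2.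
  rewrite E.
  have rho0 : 0 < rho := expR_gt0 _.
  have h1 : k * (rho ^+ 2 + s ^+ 2) <= rho ^+ 2 + 2 * rho * s * cos (Im M) + s ^+ 2.
    have p0 : 0 <= 2 * rho * s by rewrite !mulr_ge0// ltW.
    have := ler_wpM2l p0 cc; have q0 : 0 <= (1 - k) * (rho - s) ^+ 2.
      by rewrite mulr_ge0 ?sqr_ge0// subr_ge0.
    move: q0; rewrite -subr_ge0 => q0 q1; nra.
  apply: le_trans h1.
  have h2 : r0 ^+ 2 * (1 + s ^+ 2) <= rho ^+ 2 + s ^+ 2.
    have := ler_pM (ltW r00) (ltW r00) rr rr; rewrite -!expr2 => a1.
    have a2 : r0 ^+ 2 <= 1 by rewrite expr_le1// ltW.
    have a3 := ler_wpM2r (sqr_ge0 s) a2.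
    by rewrite mulrDr mulr1; apply: lerD => //; rewrite mul1r in a3.
  apply: le_trans (ler_wpM2l (ltW k0) h2).
  have h3 : (1 + s) ^+ 2 <= 2 * (1 + s ^+ 2) by have := sqr_ge0 (1 - s); nra.
  have -> : e ^+ 2 = k * (r0 ^+ 2 * ((k / 4) * (1 + s) ^+ 2)) by rewrite /e; field.
  apply: ler_wpM2l; first exact: ltW.
  apply: ler_wpM2l; first exact: sqr_ge0.
  apply: le_trans (_ : (2^-1 * (1 + s) ^+ 2) <= _); last by lra.
  by apply: ler_wpM2r; [exact: sqr_ge0|lra].
split.
  apply/negP => /eqP z; move: he; rewrite z /= expr0n /= addr0 leNgt => /negP; apply.
  exact: exprn_gt0.
apply: le_trans (n1V_le e0 he) _.
rewrite le_eqVlt; apply/orP; left; apply/eqP; rewrite /e; field.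
by rewrite !lt0r_neq0// ltr_wpDr.
Qed.

Lemma stieltjes_weight_integrable (a : R) : 0 < a < 1 ->
  mu.-integrable D (EFin \o (fun s => s `^ (- a) * (1 + s)^-1)).
Proof.
move=> a01; apply/integrableP; split.
  apply/measurable_EFinP; apply: measurable_funTS; apply: measurable_funM; first exact: measurable_powR.
  by apply: measurable_funV; exact: measurable_funD.
have -> : (\int[mu]_(s in D) `|(EFin \o (fun s : R => s `^ (- a) * (1 + s)^-1)%R) s| =
    \int[mu]_(s in D) (s `^ (- a) * (1 + s)^-1)%:E)%E.
  apply: eq_integral => s /set_mem /in0y s0 /=.
  by rewrite ger0_norm// mulr_ge0 ?powR_ge0// invr_ge0 addr_ge0// ltW.
by rewrite (beta_reflection a01) ltry.
Qed.

Lemma cvg_n1_0 (F : set_system R) (f : R -> R[i]) (b : R -> R) : Filter F ->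
  (\forall s \near F, n1 (f s) <= b s) -> b s @[s --> F] --> (0 : R) ->
  (Re (f s) @[s --> F] --> (0 : R)) /\ (Im (f s) @[s --> F] --> (0 : R)).
Proof.
move=> FF fb b0.
have nb : - b s @[s --> F] --> (0 : R) by rewrite -oppr0; exact: cvgN.
by split; apply: (@squeeze_cvgr _ _ _ _ (fun s => - b s) b) => //;
  apply: filterS fb => s hs; rewrite -ler_norml; apply: le_trans hs;
  [exact: Re_le_n1|exact: Im_le_n1].
Qed.

Section sector.
Variables (a : R) (L : R[i]).
Hypotheses (a01 : 0 < a < 1) (Lpi : `|Im L| < pi).

(** The path [t |-> cexp (t L)] joins 1 to the target inside a sector that avoids the negative axis.
    [F1] is [s^(-a) w^a / (w + s)]; its [t]-derivative [G] is also the [s]-derivative of [F2], which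
    vanishes at both ends of the half-line. So the integral of [F1] in [s] does not depend on [t],
    and at [t = 0] it is the beta integral. *)
Let w (t : R) : R[i] := cexp (t%:C * L).
Let wa (t : R) : R[i] := cexp (a%:C * (t%:C * L)).
Let F1 (t s : R) : R[i] := (s `^ (- a))%:C * (wa t * (w t + s%:C)^-1).
Let G (t s : R) : R[i] := (s `^ (- a))%:C *
  (L * wa t * (a%:C * (w t + s%:C)^-1 - w t * ((w t + s%:C)^-1 * (w t + s%:C)^-1))).
Let F2 (t s : R) : R[i] := - (L * wa t) * ((s `^ (1 - a))%:C * (w t + s%:C)^-1).

Let bnd : exists2 c : R, 0 < c & forall t s, 0 <= t <= 1 -> 0 <= s ->
  w t + s%:C != 0 /\ n1 ((w t + s%:C)^-1) <= c * (1 + s)^-1.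
Proof.
have th : 0 <= `|Im L| < pi by rewrite normr_ge0.
have [c c0 hc] := sector_bound th (normr_ge0 (Re L)).
exists c => // t s /andP[t0 t1] s0; apply: hc => //.
  by rewrite !ReImE /= mul0r addr0 normrM ger0_norm// -[leRHS]mul1r ler_wpM2r.
rewrite !ReImE /= mul0r subr0 lerNl -mulrN.
apply: le_trans (ler_norm _) _.
by rewrite normrM normrN ger0_norm// -[leRHS]mul1r ler_wpM2r.
Qed.

Let ReL t : 0 <= t <= 1 -> Re (t%:C * L) <= `|Re L|.
Proof.
move=> /andP[t0 t1]; rewrite !ReImE /= mul0r subr0; apply: le_trans (ler_norm _) _.
by rewrite normrM ger0_norm// -[leRHS]mul1r ler_wpM2r.
Qed.

Let n1w t : 0 <= t <= 1 -> n1 (w t) <= 2 * expR `|Re L|.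
Proof.
by move=> ht; apply: le_trans (n1_cexp _) _; rewrite ler_pM2l// ler_expR ReL.
Qed.

Let n1wa t : 0 <= t <= 1 -> n1 (wa t) <= 2 * expR `|Re L|.
Proof.
move=> ht; apply: le_trans (n1_cexp _) _; rewrite ler_pM2l// ler_expR.
move: a01 => /andP[a0 a1]; rewrite ReM [Im a%:C]/= mul0r subr0 [Re a%:C]/=.
apply: le_trans (_ : a * `|Re L| <= _).
  by apply: ler_wpM2l; [exact: ltW|exact: ReL].
by rewrite -[leRHS]mul1r ler_wpM2r// ltW.
Qed.

Let dlin t : cder (fun t : R => t%:C * L) t L.
Proof.
apply: cder_eq (cderM (cder_real (der_id t)) (cder_cst L t)) _.
by rewrite mulr0 addr0 mul1r.
Qed.

Let dw t : cder w t (L * w t). Proof. exact: cder_exp. Qed.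

Let dwa t : cder wa t (a%:C * L * wa t).
Proof.
apply: cder_eq (cder_exp (cderM (cder_cst a%:C t) (dlin t))) _.
by rewrite mul0r add0r.
Qed.

Let dF1 t s : w t + s%:C != 0 -> cder (fun t => F1 t s) t (G t s).
Proof.
move=> h; apply: cder_eq (cderM (cder_cst _ t) (cderM (dwa t)
  (cderV h (cderD (dw t) (cder_cst s%:C t))))) _.
by rewrite /G; field.
Qed.

Let dF2 t s : 0 < s -> w t + s%:C != 0 -> cder (fun s => F2 t s) s (G t s).
Proof.
move=> s0 h.
apply: cder_eq (cderM (cder_cst _ s) (cderM (cder_real (der_powR (1 - a) s0))
  (cderV h (cderD (cder_cst (w t) s) (cder_real (der_id s)))))) _.
rewrite /G (_ : 1 - a - 1 = - a); last by ring.
rewrite (_ : (s `^ (1 - a))%:C = (s `^ (- a))%:C * s%:C); last first.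
  rewrite (powR_subr1 _ s0) (_ : 1 - a - 1 = - a); last by ring.
  by apply: eqC; rewrite !ReImE /=; ring.
rewrite (_ : ((1 - a) * s `^ (- a))%:C = (1 - a%:C) * (s `^ (- a))%:C); last first.
  by apply: eqC; rewrite !ReImE /=; ring.
by field.
Qed.

Let F1_bound : exists2 K : R, 0 < K & forall t s, 0 <= t <= 1 -> 0 < s ->
  [/\ n1 (F1 t s) <= K * (s `^ (- a) * (1 + s)^-1),
      n1 (G t s) <= K * (s `^ (- a) * (1 + s)^-1) &
      n1 (F2 t s) <= K * (s `^ (1 - a) * (1 + s)^-1)].
Proof.
have [c c0 hc] := bnd.
pose E := 2 * expR `|Re L|; have E0 : 0 < E by rewrite mulr_gt0 ?expR_gt0.
pose l := n1 L; have l0 : 0 <= l := n1_ge0 L.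
(* The three summands are the constants for [F1], [G] and [F2], in this order. *)
exists (E * c + l * E * (c + E * (c * c)) + l * E * c) => [|t s ht s0].
  by rewrite ltr_wpDr ?ltr_wpDr ?mulr_gt0 ?mulr_ge0 ?addr_ge0 ?mulr_ge0// ltW.
have [_ hi] := hc t s ht (ltW s0).
set i := (w t + s%:C)^-1 in hi *.
pose q := (1 + s)^-1; rewrite -/q in hi *.
have q0 : 0 < q by rewrite invr_gt0 ltr_wpDr// ltW.
have q1 : q <= 1 by rewrite invf_le1 ?lerDl ?ltW// ltr_wpDr// ltW.
have p0 b : 0 <= s `^ b := powR_ge0 _ _.
have nm (x y : R[i]) (z v : R) : n1 x <= z -> n1 y <= v -> n1 (x * y) <= z * v.
  by move=> h k; apply: le_trans (n1M _ _) _; rewrite ler_pM// n1_ge0.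
have np b : n1 (s `^ b)%:C <= s `^ b by rewrite n1_real ger0_norm.
have na : n1 a%:C <= 1.
  by move: a01 => /andP[/ltW a0 /ltW a1]; rewrite n1_real ger0_norm.
have cq0 : 0 <= c * q by rewrite mulr_ge0 ?ltW.
have hwa := n1wa ht; have hw := n1w ht; rewrite -/E in hwa hw.
have nii : n1 (i * i) <= c * c * q.
  apply: le_trans (nm _ _ _ _ hi hi) _.
  rewrite (_ : c * q * (c * q) = c * c * q * q); last by ring.
  by rewrite -[leRHS]mulr1 ler_wpM2l// !mulr_ge0 ?ltW.
have n3 : n1 (a%:C * i - w t * (i * i)) <= (c + E * (c * c)) * q.
  apply: le_trans (n1D _ _) _; rewrite n1N mulrDl; apply: lerD.
    by rewrite -[leRHS]mul1r; exact: (nm _ _ _ _).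
  by rewrite -mulrA; exact: (nm _ _ _ _).
have Ec : 0 <= E * c by rewrite mulr_ge0 ?ltW.
have X2 : 0 <= l * E * (c + E * (c * c)) by do ?[apply: mulr_ge0|apply: addr_ge0] => //; exact: ltW.
have X3 : 0 <= l * E * c by do ?[apply: mulr_ge0] => //; exact: ltW.
have fin k y : 0 <= y -> k <= E * c + l * E * (c + E * (c * c)) + l * E * c ->
    k * y <= (E * c + l * E * (c + E * (c * c)) + l * E * c) * y.
  by move=> y0 h; exact: ler_wpM2r.
have pq b : 0 <= s `^ b * q by apply: mulr_ge0 => //; exact: ltW.
split.
- have h : n1 (F1 t s) <= s `^ (- a) * (E * (c * q)) by apply: (nm _ _ _ _ (np _)); exact: (nm _ _ _ _).
  apply: le_trans h _; rewrite (_ : _ * _ = E * c * (s `^ (- a) * q)); last by ring.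
  by apply: fin => //; lra.
- have h : n1 (G t s) <= s `^ (- a) * (l * E * ((c + E * (c * c)) * q)).
    by apply: (nm _ _ _ _ (np _)); apply: (nm _ _ _ _) => //; exact: (nm _ _ _ _).
  apply: le_trans h _.
  rewrite (_ : _ * _ = l * E * (c + E * (c * c)) * (s `^ (- a) * q)); last by ring.
  by apply: fin => //; lra.
- have h : n1 (F2 t s) <= l * E * (s `^ (1 - a) * (c * q)).
    by apply: (nm _ _ _ _); [rewrite n1N; exact: (nm _ _ _ _)|exact: (nm _ _ _ _)].
  apply: le_trans h _; rewrite (_ : _ * _ = l * E * c * (s `^ (1 - a) * q)); last by ring.
  by apply: fin => //; lra.
Qed.

Let cmw t : cmeas (fun s : R => (w t + s%:C)^-1).
Proof. by apply: cmeasV; apply: cmeasD; [exact: cmeas_cst|exact: cmeas_real]. Qed.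

Let cmp : cmeas (fun s : R => (s `^ (- a))%:C).
Proof. by apply: cmeas_real; exact: measurable_powR. Qed.

Let F1_integrable t : 0 <= t <= 1 -> cintegrable mu D (F1 t).
Proof.
move=> ht; have [K K0 hK] := F1_bound.
apply: (@cintegrable_dom _ _ _ mu D _ (fun s => K * (s `^ (- a) * (1 + s)^-1))) => //.
- by apply: (cmeasM cmp); apply: (cmeasM _ (cmw t)); exact: cmeas_cst.
- exact: (@integrableZl _ _ _ mu _ mD K _ (stieltjes_weight_integrable a01)).
- by move=> s /in0y s0; have [] := hK t s ht s0.
Qed.

Let G_int0 t : 0 <= t <= 1 -> cint mu D (G t) = 0.
Proof.
move=> ht; have [K K0 hK] := F1_bound; have [c c0 hc] := bnd.
have a0 : 0 < a by move: a01 => /andP[].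
have b0 : 0 < 1 - a by move: a01 => /andP[_]; rewrite subr_gt0.
have mG : cmeas (G t).
  apply: (cmeasM cmp); apply: cmeasM; first exact: cmeas_cst.
  apply: cmeasB; first by apply: (cmeasM _ (cmw t)); exact: cmeas_cst.
  by apply: (cmeasM _ (cmeasM (cmw t) (cmw t))); exact: cmeas_cst.
have iG : cintegrable mu D (G t).
  apply: (@cintegrable_dom _ _ _ mu D _ (fun s => K * (s `^ (- a) * (1 + s)^-1))) => //.
  - exact: (@integrableZl _ _ _ mu _ mD K _ (stieltjes_weight_integrable a01)).
  - by move=> s /in0y s0; have [] := hK t s ht s0.
have dG s : 0 < s -> exists l, cder (G t) s l.
  move=> s0; have [h _] := hc t s ht (ltW s0).
  have di := cderV h (cderD (cder_cst (w t) s) (cder_real (der_id s))).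
  eexists; apply: (cderM (cder_real (der_powR _ s0)) (cderM (cder_cst _ s)
    (cderD (cderM (cder_cst _ s) di) (cderN (cderM (cder_cst _ s) (cderM di di)))))).
have d2 s : 0 < s -> cder (F2 t) s (G t s).
  by move=> s0; apply: dF2 => //; have [] := hc t s ht (ltW s0).
have c0r : K * (s `^ (1 - a) * (1 + s)^-1) @[s --> 0^'+] --> (0 : R).
  rewrite -[X in _ --> X](mulr0 K); apply: cvgM; first exact: cvg_cst.
  apply: (@squeeze_cvgr _ _ _ _ (fun=> 0) (fun s => s `^ (1 - a))); last 2 first.
  - exact: cvg_cst.
  - exact: powR_cvg0.
  near=> s; have s0 : 0 < s by near: s; exact: nbhs_right_gt.
  have s1 : 0 < 1 + s by rewrite ltr_wpDr// ltW.
  apply/andP; split; first by rewrite mulr_ge0 ?powR_ge0// invr_ge0 ltW.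
  rewrite -[leRHS]mulr1; apply: ler_wpM2l; first exact: powR_ge0.
  by rewrite invf_le1// lerDl ltW.
have cyr : K * (s `^ (1 - a) * (1 + s)^-1) @[s --> +oo] --> (0 : R).
  rewrite -[X in _ --> X](mulr0 K); apply: cvgM; first exact: cvg_cst.
  apply: (@squeeze_cvgr _ _ _ _ (fun=> 0) (fun s => (1 + s)^-1 `^ a)); last 2 first.
  - exact: cvg_cst.
  - apply: (@cvg_comp _ _ _ (fun s : R => (1 + s)^-1) (fun u => u `^ a) _ (0^'+)); last exact: powR_cvg0.
    move=> A [e /= e0 he]; have /cvgrPdist_lt /(_ e e0) := @cvg_inv1D R.
    move=> h; near=> s; apply: he => /=.
      by have : `|0 - (1 + s)^-1| < e by near: s.
    by rewrite invr_gt0 ltr_wpDr//; near: s; exact: nbhs_pinfty_ge.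
  near=> s; have s0 : 0 <= s by near: s; exact: nbhs_pinfty_ge.
  have s1 : 0 < 1 + s by rewrite ltr_wpDr.
  apply/andP; split; first by rewrite mulr_ge0 ?powR_ge0// invr_ge0 ltW.
  have h : s `^ (1 - a) <= (1 + s) `^ (1 - a).
    by apply: ge0_ler_powR; rewrite ?nnegrE ?lerDr//; exact: ltW.
  have -> : (1 + s)^-1 `^ a = (1 + s) `^ (1 - a) * (1 + s)^-1.
    rewrite -(powR_inv1 (ltW s1)) -powRrM -powRD; last by rewrite lt0r_neq0// implybT.
    by congr (_ `^ _); ring.
  by apply: ler_wpM2r; first by rewrite invr_ge0 ltW.
have near0 : \forall s \near 0^'+, n1 (F2 t s) <= K * (s `^ (1 - a) * (1 + s)^-1).
  by near=> s; have [] := hK t s ht _ => //; near: s; exact: nbhs_right_gt.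
have neary : \forall s \near +oo, n1 (F2 t s) <= K * (s `^ (1 - a) * (1 + s)^-1).
  by near=> s; have [] := hK t s ht _ => //; near: s; exact: nbhs_pinfty_gt.
have [r0 i0] := cvg_n1_0 _ near0 c0r.
have [ry iy] := cvg_n1_0 _ neary cyr.
have cr s : 0 < s -> {for s, continuous (fun s => Re (G t s))}.
  by move=> s0; have [l h] := dG s s0; exact: der_cont h.1.
have ci s : 0 < s -> {for s, continuous (fun s => Im (G t s))}.
  by move=> s0; have [l h] := dG s s0; exact: der_cont h.2.
have ER := half_line_FTC (fun s s0 => (d2 s s0).1) cr r0 ry iG.1.
have EI := half_line_FTC (fun s s0 => (d2 s s0).2) ci i0 iy iG.2.
by rewrite subrr in ER EI; apply: eqC; [exact: ER|exact: EI].
Unshelve. all: by end_near. Qed.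

Lemma sector_balakrishnan :
  cintegrable mu D (fun s => (s `^ (- a))%:C * (cexp L + s%:C)^-1) /\
  cint mu D (fun s => (s `^ (- a))%:C * (cexp L + s%:C)^-1) =
    (Gamma (1 - a) * Gamma a)%:C * cexp (- a%:C * L).
Proof.
have [K K0 hK] := F1_bound; have [c c0 hc] := bnd.
have h0 : 0 <= (0 : R) <= 1 by rewrite lexx ler01.
have h1 : 0 <= (1 : R) <= 1 by rewrite lexx ler01.
have mGst : cmeas (fun z : R * R => G z.2 z.1).
  have m1 : cmeas (fun z : R * R => (z.1)%:C) by apply: cmeas_real; exact: measurable_fst.
  have m2 : cmeas (fun z : R * R => (z.2)%:C) by apply: cmeas_real; exact: measurable_snd.
  have mp : cmeas (fun z : R * R => (z.1 `^ (- a))%:C).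
    exact: (cmeas_comp (@measurable_fst _ _ _ _) cmp).
  have mlin : cmeas (fun z : R * R => (z.2)%:C * L) by apply: cmeasM => //; exact: cmeas_cst.
  have mw : cmeas (fun z : R * R => w z.2) by exact: cmeas_exp.
  have mwa : cmeas (fun z : R * R => wa z.2).
    by apply: cmeas_exp; apply: cmeasM => //; exact: cmeas_cst.
  have mi : cmeas (fun z : R * R => (w z.2 + (z.1)%:C)^-1) by apply: cmeasV; exact: cmeasD.
  apply: (cmeasM mp); apply: cmeasM; first by apply: (cmeasM _ mwa); exact: cmeas_cst.
  apply: cmeasB; first by apply: (cmeasM _ mi); exact: cmeas_cst.
  exact: (cmeasM mw (cmeasM mi mi)).
have F := @cfubini _ _ _ _ _ mu mu D `[0, 1] (fun z : R * R => G z.2 z.1)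
  (fun s => K * (s `^ (- a) * (1 + s)^-1)) (fun=> 1) mD (measurable_itv _) mGst.
have {}F : cint mu D (fun s => cint mu `[0, 1] (fun t => G t s)) =
    cint mu `[0, 1] (fun t => cint mu D (fun s => G t s)).
  apply: F.
  - exact: (@integrableZl _ _ _ mu _ mD K _ (stieltjes_weight_integrable a01)).
  - by apply: integrable_cst => //; exact: lebesgue_itvcc_lty.
  - move=> s t /in0y s0; rewrite /= in_itv/= => ht; rewrite mulr1.
    by have [] := hK t s ht s0.
have Z : cint mu `[0, 1] (fun t => cint mu D (fun s => G t s)) = 0.
  rewrite (@eq_cint _ _ _ mu `[0, 1] _ (fun=> 0)).
    by rewrite (@cint_real _ _ _ mu _ (fun=> 0)) /Rintegral integral0.
  by move=> t; rewrite /= in_itv/= => ht; exact: G_int0.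
rewrite Z in F.
have E : cint mu D (fun s => cint mu `[0, 1] (fun t => G t s)) = cint mu D (F1 1) - cint mu D (F1 0).
  rewrite -cintB//; try exact: F1_integrable.
  apply: eq_cint => s /in0y s0.
  have off u : `[0, 1]%classic u -> w u + s%:C != 0.
    by rewrite /= in_itv/= => hu; have [] := hc u s hu (ltW s0).
  have di u : `[0, 1]%classic u -> cder (fun t => (w t + s%:C)^-1) u _ :=
    fun h => cderV (off u h) (cderD (dw u) (cder_cst s%:C u)).
  apply: (complex_FTC (h := fun t => F1 t s) ltr01).
  - by apply: cder_ccont => u hu; eexists; exact: dF1 (off u hu).
  - apply: cder_ccont => u hu; eexists.
    apply: (cderM (cder_cst _ u) (cderM (cderM (cder_cst L u) (dwa u))
      (cderD (cderM (cder_cst _ u) (di u hu)) (cderN (cderM (dw u) (cderM (di u hu) (di u hu))))))).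
  - move=> u /andP[u0 u1]; apply: dF1; apply: off; by rewrite /= in_itv/= !ltW.
rewrite E in F; move/eqP: F; rewrite subr_eq0 => /eqP F.
have w1 : w 1 = cexp L by rewrite /w mul1r.
have wa1 : wa 1 = cexp (a%:C * L) by rewrite /wa mul1r.
have F11 s : F1 1 s = cexp (a%:C * L) * ((s `^ (- a))%:C * (cexp L + s%:C)^-1).
  by rewrite /F1 w1 wa1 mulrCA.
have i1 : cintegrable mu D (fun s => (s `^ (- a))%:C * (cexp L + s%:C)^-1).
  have := cintegrableZ (cexp (a%:C * L))^-1 mD (F1_integrable h1).
  apply: (eq_cintegrable mD) => s _.
  by rewrite F11 mulrA (mulVf (cexp_neq0 _)) mul1r.
split=> //.
have {}F : cexp (a%:C * L) * cint mu D (fun s => (s `^ (- a))%:C * (cexp L + s%:C)^-1) = cint mu D (F1 0).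
  by rewrite -F -(cintZ _ mD i1); apply: eq_cint => s _; rewrite F11.
have F10 : cint mu D (F1 0) = (Gamma (1 - a) * Gamma a)%:C.
  rewrite (@eq_cint _ _ _ mu D _ (fun s => (s `^ (- a) * (1 + s)^-1)%:C)); last first.
    move=> s /in0y s0; rewrite /F1 /w /wa mul0r mulr0 cexp0 mul1r.
    rewrite (_ : 1 + s%:C = (1 + s)%:C); last by apply: eqC; rewrite !ReImE /= ?addr0.
    by rewrite rmorphM fmorphV.
  rewrite cint_real /Rintegral; congr (_%:C).
  by have /(congr1 fine) := beta_reflection a01.
by rewrite -F10 -F mulNr cexpN mulrAC mulfV ?mul1r ?cexp_neq0.
Qed.

End sector.
End balakrishnan.

(** At positive arguments [lap] is the resolvent, whose entries are continuous by Cramer's rule. *)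
Lemma measurable_lap {R : realType} (p : nat) (T : 'M[R]_p) S i j :
  semigroup_block T S -> stable T ->
  measurable_fun (`]0, +oo[%classic : set R) (fun s => lap S s i j).
Proof.
move=> hS sT.
have U s : 0 < s -> cmx (s%:M - T) \in unitmx.
  by move=> /ltW s0; rewrite map_unitmx; have [] := lapE hS sT s0.
have cc : ccont `]0, +oo[ (fun s => invmx (cmx (s%:M - T)) i j).
  apply: ccont_invmx => [k l|s /in0y]; last exact: U.
  under [X in ccont _ X]eq_fun do rewrite !mxE mulrb.
  split => /=; last by move=> s; exact: cvg_cst.
  apply: continuous_subspaceT => s.
  apply: cvgB; last exact: cvg_cst.
  by case: (k == l); [exact: cvg_id|exact: cvg_cst].
have := subspace_continuous_measurable_fun (measurable_itv _) cc.1.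
apply: eq_measurable_fun => s /set_mem /in0y s0.
have [E _] := lapE hS sT (ltW s0).
have EC : invmx (cmx (s%:M - T)) = cmx (lap S s) by rewrite E /cmx map_invmx.
transitivity (Re (cmx (lap S s) i j)); first by rewrite -EC.
by rewrite /cmx mxE.
Qed.

(** * The principal branch and the powers of [- T] *)

Section principal_branch.
Context {R : realType}.
Notation mu := (@lebesgue_measure R).
Local Notation I01 := (`[0%R, 1%R]%classic : set R).

Let D : set (measurableTypeR R) := `]0, +oo[%classic.
Let mD : measurable D. Proof. exact: measurable_itv. Qed.

Lemma slit_normc (z : R[i]) : slit_plane z ->
  0 < Normc.normc z /\ - Normc.normc z < Re z <= Normc.normc z.
Proof.
move=> hz; set r := Normc.normc z; have r0 : 0 <= r := normc_ge0' z.
have rE : r ^+ 2 = Re z ^+ 2 + Im z ^+ 2 := sqr_normc' z.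
have lo : - r < Re z.
  rewrite ltNge; apply/negP => h; apply: hz.
  have i2 := sqr_ge0 (Im z).
  have i0 : Im z ^+ 2 <= 0 by nra.
  split; first by lra.
  by apply/eqP; rewrite -sqrf_eq0 eq_le i0 i2.
have hi : Re z <= r.
  rewrite leNgt; apply/negP => h; have i2 := sqr_ge0 (Im z); nra.
split; last by rewrite lo hi.
rewrite lt_neqAle r0 andbT; apply/eqP => r1; rewrite -r1 in lo hi; lra.
Qed.

(** Off the cut [Re z / |z| > -1], so the arc cosine stays below [pi]. The strict bound on the
    argument is the form in which the cut enters the Stieltjes integral. *)
Lemma cLogK (z : R[i]) : slit_plane z -> cexp (cLog z) = z /\ `|Im (cLog z)| < pi.
Proof.
move=> /slit_normc; set r := Normc.normc z => -[r0 /andP[lo hi]].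
have rn : r != 0 by rewrite lt0r_neq0.
have x1 : -1 < Re z / r by rewrite ltr_pdivlMr// mulN1r.
have x2 : Re z / r <= 1 by rewrite ler_pdivrMr// mul1r.
have x12 : -1 <= Re z / r <= 1 by rewrite ltW.
have a0 := acos_ge0 x12.
have a1 : acos (Re z / r) < pi by apply: acos_ltpi; rewrite x1.
have ca : cos (acos (Re z / r)) = Re z / r by apply: acosK; rewrite in_itv.
have sa : sin (acos (Re z / r)) = `|Im z| / r.
  rewrite sin_acos// (_ : 1 - _ = (Im z / r) ^+ 2).
    by rewrite sqrtr_sqr normrM normfV (gtr0_norm r0).
  have rE : r ^+ 2 = Re z ^+ 2 + Im z ^+ 2 := sqr_normc' z.
  rewrite !expr_div_n rE -rE; apply: (mulIf (expf_neq0 2 rn)).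
  by rewrite mulrBl mul1r !mulfVK ?expf_neq0// rE addrC addKr.
split.
  rewrite /cexp /cLog /carg -/r [Re (_ +i* _)]/= [Im (_ +i* _)]/= lnK ?posrE//.
  case: ifPn => i0; apply: eqC => /=.
  - by rewrite ca mulrCA mulfV// mulr1.
  - by rewrite sa ger0_norm// mulrCA mulfV// mulr1.
  - by rewrite cosN ca mulrCA mulfV// mulr1.
  - by rewrite sinN sa ltr0_norm ?ltNge// mulNr opprK mulrCA mulfV// mulr1.
rewrite /cLog /= /carg -/r; case: ifPn => _; first by rewrite ger0_norm.
by rewrite normrN ger0_norm.
Qed.

(** Separates a rational factor, a pole of order [n] at 0, from a fractional power with exponent
    [a], to be written as a Stieltjes integral when [0 < a < 1]. *)
Lemma cpow_poles (n : nat) (a : R) (z : R[i]) : slit_plane z ->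
  cpow (- (n%:R + a)) z = poles (nseq n 0) z * cexp (- a%:C * cLog z).
Proof.
move=> hz; have [h _] := cLogK hz.
rewrite /cpow (_ : (- (n%:R + a))%:C * cLog z = - (cLog z *+ n) + - a%:C * cLog z); last first.
  rewrite (_ : (- (n%:R + a))%:C = - n%:R - a%:C); last by rewrite rmorphN rmorphD rmorph_nat opprD.
  by rewrite mulrDl mulNr mulr_natl.
rewrite cexpD cexpN cexpMn h; congr (_ * _).
rewrite /poles big_nseq subr0; elim: n => [|n ih]; first by rewrite expr0 invr1.
by rewrite iterS -ih exprS invfM.
Qed.

(* [|z + s|^2 >= k (|z|^2 + s^2)] with [k = (|z| + Re z) / (2 |z|)], the squared
   cosine of half the argument of [z]. *)
Lemma slit_bound (z : R[i]) (s : R) : slit_plane z -> 0 <= s ->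
  n1 ((z + s%:C)^-1) <= 8 * ((1 + Normc.normc z ^+ 2) /
    (Normc.normc z * (Normc.normc z + Re z))) * (1 + s)^-1.
Proof.
move=> hz s0; have := slit_normc hz; set r := Normc.normc z => -[r0 /andP[lo hi]].
have rE : r ^+ 2 = Re z ^+ 2 + Im z ^+ 2 := sqr_normc' z.
pose k := (r + Re z) / (2 * r).
have zE : Re z = r * (2 * k - 1) by rewrite /k; field; rewrite lt0r_neq0.
have k0 : 0 < k by rewrite divr_gt0 ?mulr_gt0//; lra.
have k1 : k <= 1 by rewrite ler_pdivrMr ?mulr_gt0//; lra.
(* The chain is [q^2 (1 + s)^2 <= 2 q (1 + s^2) <= k (r^2 + s^2)], where [q <= 1] absorbs one factor
   [q]. Then [2 / q] is the stated constant. *)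
pose q := k * r ^+ 2 / (2 * (1 + r ^+ 2)).
have r2 : 0 < 1 + r ^+ 2 by rewrite ltr_wpDr ?sqr_ge0.
have q0 : 0 < q by apply: divr_gt0; apply: mulr_gt0 => //; exact: exprn_gt0.
have q1 : q <= 1.
  rewrite /q ler_pdivrMr; last exact: mulr_gt0.
  by rewrite mul1r; have := sqr_ge0 r => h; nra.
have s1 : 0 < 1 + s by rewrite ltr_wpDr.
have E : Re (z + s%:C) ^+ 2 + Im (z + s%:C) ^+ 2 = r ^+ 2 + 2 * s * Re z + s ^+ 2.
  by rewrite !ReImE /= addr0 rE; ring.
have he : (q * (1 + s)) ^+ 2 <= Re (z + s%:C) ^+ 2 + Im (z + s%:C) ^+ 2.
  rewrite E zE.
  have h1 : k * (r ^+ 2 + s ^+ 2) <= r ^+ 2 + 2 * s * (r * (2 * k - 1)) + s ^+ 2.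
    have := sqr_ge0 (r - s) => h.
    have p0 : 0 <= s * r by rewrite mulr_ge0// ltW.
    have [hk|hk] := leP k 2^-1; nra.
  apply: le_trans h1.
  have h2 : r ^+ 2 / (1 + r ^+ 2) * (1 + s ^+ 2) <= r ^+ 2 + s ^+ 2.
    rewrite mulrAC ler_pdivrMr//.
    have := mulr_ge0 (sqr_ge0 r) (sqr_ge0 r); have := sqr_ge0 s; nra.
  have h3 : (1 + s) ^+ 2 <= 2 * (1 + s ^+ 2) by have := sqr_ge0 (1 - s); nra.
  apply: le_trans (ler_wpM2l (ltW k0) h2).
  apply: le_trans (_ : q * (1 + s) ^+ 2 <= _).
    by rewrite exprMn; apply: ler_wpM2r; [exact: sqr_ge0|rewrite expr2 -[leRHS]mul1r ler_wpM2r// ltW].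
  apply: le_trans (ler_wpM2l (ltW q0) h3) _.
  by rewrite le_eqVlt; apply/orP; left; apply/eqP; rewrite /q; field; rewrite lt0r_neq0.
apply: le_trans (n1V_le (mulr_gt0 q0 s1) he) _.
rewrite le_eqVlt; apply/orP; left; apply/eqP; rewrite /q /k; field.
by rewrite !lt0r_neq0//; lra.
Qed.

Section contour.
Variables (p : nat) (T : 'M[R]_p) (S : R -> 'M[R]_p) (gamma : R -> R[i]).
Hypotheses (hS : semigroup_block T S) (sT : stable T).
Let M := cmx (- T).
Hypothesis hadm : admissible_contour slit_plane M gamma.

Let hg : piecewise_C1 gamma. Proof. by case: hadm. Qed.
Let gc : gamma 0 = gamma 1. Proof. by case: hadm => _ []. Qed.
Let slit u : 0 <= u <= 1 -> slit_plane (gamma u).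
Proof. by case: hadm => _ _ off _ _ /off[]. Qed.
Let offM u : 0 <= u <= 1 -> ~~ eigenvalue M (gamma u).
Proof. by case: hadm => _ _ off _ _ /off[]. Qed.

Let out_pole (s : R) : 0 <= s -> off_path gamma (- s%:C) /\ winding_number gamma (- s%:C) = 0.
Proof.
move=> s0; have nD : ~ slit_plane (- s%:C : R[i]).
  by apply; split; rewrite ?ReN ?ImN /= ?oppr_le0 ?oppr0.
split; last by case: hadm => _ _ _ h _; exact: h.
by move=> u u01; apply/eqP => E; apply: nD; rewrite -E; exact: slit.
Qed.

(** Each additional pole at 0 multiplies by the inverse of [M]: in [contour_poles_cons] the scalar
    integral vanishes because all the poles lie outside the contour. *)
Let pow_poles n (l : seq R[i]) : (forall x, x \in l -> exists2 s : R, 0 <= s & x = - s%:C) ->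
  contour_mx gamma M (poles (nseq n 0 ++ l)) =
  iter n (fun X => X *m invmx M) (contour_mx gamma M (poles l)).
Proof.
move=> hl; have UM : M \in unitmx by rewrite map_unitmx (block_unit hS sT).
elim: n => [//|n ih]; rewrite iterS -ih.
have hl' x : x \in 0 :: (nseq n 0 ++ l) -> exists2 s : R, 0 <= s & x = - s%:C.
  have z0 : exists2 s : R, 0 <= s & 0 = - s%:C :> R[i] by exists 0 => //; rewrite oppr0.
  rewrite in_cons mem_cat => /orP[/eqP ->//|/orP[|/hl//]].
  by rewrite mem_nseq => /andP[_ /eqP ->].
have hoff x : x \in 0 :: (nseq n 0 ++ l) -> off_path gamma x.
  by move=> /hl' [s s0 ->]; have [] := out_pole s0.
have hw x : x \in 0 :: (nseq n 0 ++ l) -> winding_number gamma x = 0.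
  by move=> /hl' [s s0 ->]; have [] := out_pole s0.
have := contour_poles_cons hg offM hoff.
have -> : contour_integral gamma (poles (0 :: (nseq n 0 ++ l))) = 0.
  case E : (nseq n 0 ++ l) => [|y t]; last first.
    by apply: (contour_poles hg gc (w := 0)) => //; rewrite -E.
  rewrite (contour_poles1 (w := 0)) ?mulr0//; apply: hw; exact: mem_head.
have s0 : (0%:M : 'M[R[i]]_p) = 0 by exact: raddf0.
rewrite !s0 !subr0 => /(congr1 (mulmx^~ (invmx M))).
by rewrite -mulmxA mulmxV// mulmx1.
Qed.

Let poles0 : contour_mx gamma M (poles [::]) = two_pi_i%:M.
Proof.
rewrite -(contour_res hg gc offM); last by case: hadm.
by congr contour_mx; apply/funext => z; rewrite /poles big_nil.
Qed.

(** The power [- n] of [- T]. *)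
Let V n : 'M[R]_p := iter n (fun X => X *m invmx (- T)) 1%:M.

Let iterV (X : 'M[R]_p) n : iter n (fun X => X *m invmx (- T)) X = X *m V n.
Proof. by elim: n => [|n ih]; rewrite ?mulmx1// !iterS ih -mulmxA. Qed.

Let iterVC (X : 'M[R]_p) n : iter n (fun X => X *m invmx M) (two_pi_i *: cmx X) =
  two_pi_i *: cmx (X *m V n).
Proof.
elim: n => [|n ih]; first by rewrite /V /= mulmx1.
rewrite iterS ih -scalemxAl (erefl : V n.+1 = V n *m invmx (- T)) mulmxA; congr (_ *: _).
by rewrite /cmx [RHS]map_mxM /M /cmx map_invmx.
Qed.

(** The pole [- s], outside the contour, contributes the inverse of [M + s], that is of [s - T],
    which is [lap S s]; the pole at 0 contributes [V n]. *)
Let contour_stieltjes n (s : R) : 0 <= s ->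
  contour_mx gamma M (poles (nseq n 0 ++ [:: - s%:C])) = two_pi_i *: cmx (lap S s *m V n).
Proof.
move=> s0; rewrite pow_poles; last by move=> x; rewrite inE => /eqP ->; exists s.
rewrite -iterVC; congr iter.
have [offs wn] := out_pole s0.
have := @contour_poles_cons _ _ hg _ _ offM [::] (- s%:C).
have z0 : (0%:M : 'M[R[i]]_p) = 0 by exact: raddf0.
rewrite (contour_poles1 wn) mulr0 z0 subr0 poles0 => H.
have {}H : contour_mx gamma M (poles [:: - s%:C]) *m cmx (s%:M - T) = two_pi_i%:M.
  rewrite -H; last by move=> x; rewrite inE => /eqP ->.
  congr (_ *m _); apply/matrixP => i j; rewrite !mxE.
  by case: eqP => _; rewrite ?mulr1n ?mulr0n ?rmorphB ?rmorphN ?opprK ?raddf0 ?sub0r ?subr0 ?oppr0 ?addr0 1?addrC.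
have [E U] := lapE hS sT s0; have UC : cmx (s%:M - T) \in unitmx by rewrite map_unitmx.
by rewrite E -[LHS](mulmxK UC) H mul_scalar_mx /cmx map_invmx.
Qed.

(** The constant of [slit_bound] depends continuously on the point of the slit plane, so it is
    bounded on the path. *)
Let path_bound : exists2 B : R, 0 <= B & forall u s, 0 <= u <= 1 -> 0 <= s ->
  n1 ((gamma u + s%:C)^-1) <= B * (1 + s)^-1.
Proof.
have [cr ci] := ccont_path hg.
pose r u := Normc.normc (gamma u).
have cn : {within I01, continuous r}.
  rewrite (_ : r = fun u => Num.sqrt (Re (gamma u) * Re (gamma u) + Im (gamma u) * Im (gamma u))); last first.
    by apply/funext => u; rewrite /r; case: (gamma u) => a b; rewrite /= !expr2.
  apply: (@within_continuous_comp R I01 _ Num.sqrt); last by move=> x _; exact: sqrt_continuous.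
  by apply: within_continuousD; exact: within_continuousM.
pose f u := 8 * ((1 + r u ^+ 2) / (r u * (r u + Re (gamma u)))).
have cf : {within I01, continuous f}.
  rewrite (_ : f = fun u => 8 * ((1 + r u * r u) * (r u * (r u + Re (gamma u)))^-1)); last first.
    by apply/funext => u; rewrite /f expr2.
  have cc (c : R) : {within I01, continuous (fun=> c)} by move=> x; exact: cvg_cst.
  apply: within_continuousM; first exact: cc.
  apply: within_continuousM.
    by apply: within_continuousD; [exact: cc|exact: within_continuousM].
  apply: (@within_continuous_comp R I01 _ (fun x => x^-1)).
    by apply: within_continuousM => //; exact: within_continuousD.
  move=> u; rewrite /= in_itv/= => u01; apply: inv_continuous.
  have [r0 /andP[lo _]] := slit_normc (slit u01).
  by rewrite lt0r_neq0// mulr_gt0// -ltrBlDl sub0r.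
have cfc : ccont `[0, 1] (fun u => (f u)%:C).
  by split => //= x; exact: cvg_cst.
have [B B0 hB] := ccont_bounded ler01 cfc.
exists B => // u s u01 s0; apply: le_trans (slit_bound (slit u01) s0) _.
apply: ler_wpM2r; first by rewrite invr_ge0 addr_ge0.
by apply: le_trans (hB u u01); rewrite n1_real; exact: ler_norm.
Qed.

Let cauchy_pow_frac n a : 0 < a < 1 ->
  contour_mx gamma M (cpow (- (n%:R + a))) =
  two_pi_i *: cmx ((Gamma a)^-1 *: moment S a *m V n).
Proof.
move=> a01; have /andP[a0 a1] := a01.
have b0 : 0 < 1 - a by rewrite subr_gt0.
pose K : R := Gamma (1 - a) * Gamma a.
have K0 : 0 < K by rewrite mulr_gt0 ?Gamma_gt0.
have KC : K%:C != 0 by apply/eqP => -[] /eqP; rewrite gt_eqF.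
have [B B0 hB] := path_bound.
have off0 l : l \in nseq n (0 : R[i]) -> off_path gamma l.
  by rewrite mem_nseq => /andP[_ /eqP ->]; have [] := out_pole (lexx 0); rewrite oppr0.
have cps := ccont_poles hg off0.
have [B1 B10 hB1] := ccont_bounded ler01 cps.
apply/matrixP => i j; rewrite [LHS]mxE [RHS]mxE [X in _ * X]mxE.
have cr := ccont_res hg offM i j.
have [B2 B20 hB2] := ccont_bounded ler01 cr.
pose h (z : R[i]) := K%:C^-1 * (poles (nseq n 0) z * res M z i j).
pose f (s : R) (z : R[i]) := h z * ((s `^ (- a))%:C * (z + s%:C)^-1).
pose Kn := n1 (K%:C^-1).
have ch : ccont I01 (fun u => h (gamma u)) by apply: ccontM; [exact: ccont_cst|exact: ccontM].
have E1 : contour_integral gamma (fun z => cpow (- (n%:R + a)) z * res M z i j) =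
    contour_integral gamma (fun z => cint mu D (fun s => f s z)).
  apply: eq_contour => u u01; have sl := slit u01; have [lK lpi] := cLogK sl.
  have [ib bE] := sector_balakrishnan a01 lpi; rewrite lK -/K in ib bE.
  rewrite (cpow_poles n a sl) /f (cintZ _ mD ib) bE /h.
  by field.
have mf : cmeas (fun z : measurableTypeR R * R => f z.1 (path_ext gamma z.2)).
  apply: cmeasM; first exact: (cmeas_comp (g := snd) measurable_snd (cmeas_ccont (gamma := gamma) (f := h) ch)).
  apply: cmeasM.
    exact: (cmeas_comp (g := fst) measurable_fst (cmeas_real (measurable_powR (- a)))).
  apply: cmeasV; apply: cmeasD.
    exact: (cmeas_comp (g := snd) measurable_snd (cmeas_path_ext hg)).
  by apply: cmeas_real; exact: measurable_fst.
have ib : mu.-integrable D (EFin \o (fun s => Kn * (B1 * B2) * B * (s `^ (- a) * (1 + s)^-1))).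
  exact: (@integrableZl _ _ _ mu _ mD (Kn * (B1 * B2) * B) _ (stieltjes_weight_integrable a01)).
have fb s u : D s -> 0 <= u <= 1 ->
    n1 (f s (gamma u)) <= Kn * (B1 * B2) * B * (s `^ (- a) * (1 + s)^-1).
  move=> /in0y s0 u01; apply: le_trans (n1M _ _) _.
  rewrite -(mulrA (Kn * (B1 * B2))); apply: ler_pM; rewrite ?n1_ge0//.
    apply: le_trans (n1M _ _) _; apply: ler_pM; rewrite ?n1_ge0//.
    apply: le_trans (n1M _ _) _; apply: ler_pM; rewrite ?n1_ge0//; [exact: hB1|exact: hB2].
  apply: le_trans (n1M _ _) _; rewrite n1_real ger0_norm ?powR_ge0// mulrCA.
  by apply: ler_wpM2l; [exact: powR_ge0|apply: hB => //; exact: ltW].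
rewrite E1 (contour_fubini hg mD mf ib fb).
have cpp s : 0 <= s -> ccont I01 (fun u => poles (nseq n 0 ++ [:: - s%:C]) (gamma u)).
  move=> s0; apply: (ccont_poles hg) => l; rewrite mem_cat => /orP[/off0//|].
  by rewrite inE => /eqP ->; have [] := out_pole s0.
have E2 s : D s -> contour_integral gamma (f s) =
    (K%:C^-1 * two_pi_i) * (s `^ (- a) * (lap S s *m V n) i j)%:C.
  move=> /in0y s0; have /matrixP/(_ i j) := contour_stieltjes n (ltW s0).
  rewrite [LHS]mxE [RHS]mxE [X in _ * X]mxE => H.
  transitivity (K%:C^-1 * (s `^ (- a))%:C *
    contour_integral gamma (fun z => poles (nseq n 0 ++ [:: - s%:C]) z * res M z i j)).
    rewrite -(contourZ hg); last by apply: (ccontM (cpp _ (ltW s0)) cr).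
    apply: eq_contour => u u01.
    by rewrite /f /h /poles big_cat /= big_seq1 opprK; ring.
  have E : (s `^ (- a) * (lap S s *m V n) i j)%:C = (s `^ (- a))%:C * ((lap S s *m V n) i j)%:C.
    exact: rmorphM.
  by rewrite H E; ring.
pose wl s k := s `^ (- a) * lap S s i k.
have iwl k : mu.-integrable D (EFin \o (fun s => wl s k)) /\
    \int[mu]_(s in D) wl s k = Gamma (1 - a) * moment S a i k.
  have st := stieltjes hS sT i k a01.
  split; last by rewrite /Rintegral st.
  apply/integrableP; split.
    apply/measurable_EFinP; apply: measurable_funM; last exact: (measurable_lap i k hS sT).
    by apply: measurable_funTS; exact: measurable_powR.
  suff -> : (\int[mu]_(s in D) `|(EFin \o (fun s => wl s k)) s| =
     \int[mu]_(s in D) (wl s k)%:E)%E by rewrite st ltry.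
  apply: eq_integral => s /set_mem /in0y s0 /=.
  by rewrite ger0_norm// mulr_ge0 ?powR_ge0// (lap_ge0 hS).
have iwlV k : mu.-integrable D (EFin \o (fun s => V n k j * wl s k)).
  exact: (@integrableZl _ _ _ mu _ mD (V n k j) _ (iwl k).1).
have E3 s : s `^ (- a) * (lap S s *m V n) i j = \sum_k V n k j * wl s k.
  by rewrite mxE mulr_sumr; apply: eq_bigr => k _; rewrite /wl; ring.
have iE3 : mu.-integrable D (EFin \o (fun s => s `^ (- a) * (lap S s *m V n) i j)).
  rewrite (_ : EFin \o _ = fun s => \sum_k (V n k j * wl s k)%:E)%E; last first.
    by apply/funext => s /=; rewrite E3 sumEFin.
  by apply: integrable_sum => // k _; exact: iwlV.
rewrite (eq_cint _ E2) (cintZ _ mD); last first.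
  split; first exact: iE3.
  exact: (@integrable0 _ _ _ mu D).
rewrite cint_real.
have -> : \int[mu]_(s in D) (s `^ (- a) * (lap S s *m V n) i j) =
   Gamma (1 - a) * (moment S a *m V n) i j.
  under eq_Rintegral do rewrite E3.
  rewrite (@Rintegral_sum _ _ _ mu D _ (fun k s => V n k j * wl s k) mD iwlV).
  rewrite mxE mulr_sumr; apply: eq_bigr => k _.
  by rewrite (@RintegralZl _ _ _ mu D _ _ mD (iwl k).1) (iwl k).2; ring.
rewrite mulrC mulrA [RHS]mulrC; congr (_ * _).
have G0 : Gamma (1 - a) != 0 by rewrite gt_eqF// Gamma_gt0.
have Ga0 : Gamma a != 0 by rewrite gt_eqF// Gamma_gt0.
rewrite -scalemxAl [in RHS]mxE.
rewrite -[K%:C^-1]fmorphV -[LHS]rmorphM; congr (_%:C).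
rewrite /K; move: (_ i j) (Gamma a) (Gamma (1 - a)) Ga0 G0 => X g1 g2 h1 h2.
by field; rewrite h1 h2.
Qed.

(** The candidate for the power [- nu] of [- T]. The functional equations of [moment] and of Gamma
    have the same factor [nu], so raising the exponent by 1 is multiplication by the inverse of
    [- T]. *)
Let N (nu : R) : 'M[R]_p := (Gamma nu)^-1 *: moment S nu.

Let N_succ nu : 0 < nu -> N (nu + 1) = N nu *m invmx (- T).
Proof.
move=> n0; have U := block_unit hS sT.
have E : moment S (nu + 1) = nu *: moment S nu *m invmx (- T).
  by rewrite -(moment_mul hS sT n0) -mulmxA mulmxV// mulmx1.
rewrite /N E (Gamma_succ n0) -!scalemxAl scalerA; congr (_ *: _).
have G0 : Gamma nu != 0 by rewrite gt_eqF// Gamma_gt0.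
by rewrite invfM mulrAC mulVf ?mul1r// lt0r_neq0.
Qed.

Let N_add nu n : 0 < nu -> N (n%:R + nu) = N nu *m V n.
Proof.
move=> n0; elim: n => [|n ih]; first by rewrite add0r /V /= mulmx1.
by rewrite -natr1 addrAC N_succ ?ltr_wpDl// ih -mulmxA.
Qed.

Lemma cauchy_pow0 : cauchy_integral gamma (cpow (- 0)) M = 1%:M.
Proof.
have -> : cpow (- 0) = (fun=> 1) :> (R[i] -> R[i]).
  by apply/funext => z; rewrite /cpow oppr0 mul0r cexp0.
rewrite cauchy_integralE (contour_res hg gc offM); last by case: hadm.
by rewrite scale_scalar_mx mulVf// two_pi_i_neq0.
Qed.

Let cauchy_pow_nat n : contour_mx gamma M (cpow (- (n%:R + 0))) = two_pi_i *: cmx (V n).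
Proof.
have -> : contour_mx gamma M (cpow (- (n%:R + 0))) = contour_mx gamma M (poles (nseq n 0 ++ [::])).
  apply/matrixP => i j; rewrite [LHS]mxE [RHS]mxE; apply: eq_contour => u u01.
  by rewrite (cpow_poles n 0 (slit u01)) cats0 mulNr mul0r oppr0 cexp0 mulr1.
rewrite (@pow_poles n [::]) ?poles0; last by [].
rewrite (_ : two_pi_i%:M = two_pi_i *: cmx 1%:M) ?iterVC ?mul1mx//.
by rewrite /cmx map_mx1 scalemx1.
Qed.

Lemma cauchy_pow nu : 0 < nu ->
  cauchy_integral gamma (cpow (- nu)) M = cmx ((Gamma nu)^-1 *: moment S nu).
Proof.
move=> nu0; rewrite cauchy_integralE; apply: (canLR (scalerK _)).
  exact: two_pi_i_neq0.
rewrite -/(N nu).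
have [n [a [nE a0 a1]]] : exists n a, [/\ nu = n%:R + a, 0 <= a & a < 1].
  have /andP[h1 h2] := Num.Theory.truncn_itv (ltW nu0).
  exists (Num.truncn nu), (nu - (Num.truncn nu)%:R).
  by split; [rewrite addrC subrK|rewrite subr_ge0|rewrite ltrBlDl natr1].
rewrite nE; have [az|an0] := eqVneq a 0.
  rewrite az cauchy_pow_nat; case: n nE => [|n] nE.
    by exfalso; move: nu0; rewrite nE az add0r ltxx.
  (* Integral exponents are counted from [N 1], the inverse of [- T], since [N_add] starts from a
     positive exponent. *)
  rewrite addr0 -natr1 (N_add n ltr01) /N Gamma1 invr1 scale1r (moment1 hS sT).
  by congr (_ *: cmx _); rewrite -iterV /V iterSr mul1mx.
have ap : 0 < a by rewrite lt_neqAle eq_sym an0.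
by rewrite (N_add n ap); apply: cauchy_pow_frac; rewrite ap.
Qed.

End contour.
End principal_branch.

(** * The law of Y / Theta *)

Lemma measure_eq_rays {R : realType} (m1 m2 : {measure set R -> \bar R}) :
  (forall x : R, m1 `]-oo, x]%classic = m2 `]-oo, x]%classic) ->
  (forall x : R, (m1 `]-oo, x]%classic < +oo)%E) ->
  forall A, measurable A -> m1 A = m2 A.
Proof.
move=> e fin A mA.
(* The minimum of [a] and [b] keeps the formula valid when the interval is empty. *)
have E (m : {measure set R -> \bar R}) (a b : R) :
    (m `]-oo, b]%classic < +oo)%E ->
    m `]a, b]%classic = (m `]-oo, b]%classic - m `]-oo, (Num.min a b)%R]%classic)%E.
  move=> mfin.
  have -> : `]a, b]%classic = `]-oo, b]%classic `\` `]-oo, a]%classic :> set R.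
    apply/seteqP; split => x; rewrite /= !in_itv/=.
      by move=> /andP[h ->]; split => //; apply/negP; rewrite -ltNge.
    by move=> [-> /negP]; rewrite -ltNge => ->.
  rewrite measureD//; try exact: measurable_itv.
  congr (_ - m _)%E; apply/seteqP; split => x; rewrite /= !in_itv/= le_min.
    by move=> [-> ->].
  by move=> /andP[-> ->].
apply: (@measure_unique _ R R (@ocitv R) (fun n => `](- n%:R), n%:R]%classic)) mA => //.
- exact: ocitvI.
- by move=> i; exists (- i%:R, i%:R).
- apply/seteqP; split => // x _; exists (Num.truncn `|x|).+1 => //=.
  rewrite in_itv/=; have h := Num.Theory.truncnS_gt `|x|.
  by rewrite (lt_le_trans _ (lerNnormlW (lexx _))) ?ltrN2//= (le_trans (ler_norm x)) ?ltW.
- move=> _ [[a b] _ <-] /=; rewrite !E// -?e//; exact: fin.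
- move=> k; apply: le_lt_trans (fin k%:R); apply: le_measure; rewrite ?inE; try exact: measurable_itv.
  by move=> x; rewrite /= !in_itv/= => /andP[].
Qed.

Lemma interval_FTC {R : realType} (Phi g : R -> R) (c y : R) : 0 < y ->
  measurable_fun setT g -> (forall v, 0 < v -> der Phi v (g v)) ->
  (forall v, 0 < v -> {for v, continuous g}) -> (forall v, 0 < v -> 0 <= g v) ->
  Phi v @[v --> 0^'+] --> c ->
  (\int[@lebesgue_measure R]_(u in `]0%R, y]) (g u)%:E = (Phi y - c)%:E)%E.
Proof.
move=> y0 mg dP cg g0 Pc.
have [] := @improper_FTC_ge0 _ `]0, y]%classic g Phi
  (fun n => y / n.+2%:R) (fun=> y) c (Phi y) mg.
- by move=> n; rewrite ltr_pdivrMr// -[ltLHS]mulr1 ltr_pM2l// ltr1n.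
- by move=> n; rewrite ler_pM2l// lef_pV2 ?posrE ?ltr0n// ler_nat.
- by [].
- exact: itv0c_bigcup.
- by move=> x /=; rewrite in_itv/= => /andP[x0 _]; exact: dP.
- by move=> x /=; rewrite in_itv/= => /andP[x0 _]; exact: cg.
- apply: (@cvg_comp _ _ _ (fun n : nat => y / n.+2%:R : R) Phi _ (0^'+)) => //.
  move=> A [e /= e0 he].
  have : (y * n.+1%:R^-1 : R) @[n --> \oo] --> (y * 0 : R).
    by apply: cvgM; [exact: cvg_cst|exact: cvg_invS].
  rewrite mulr0 -(cvg_shiftS (fun n : nat => y * n.+1%:R^-1 : R)) => /cvgrPdist_lt /(_ e e0).
  apply: filterS => n hn; apply: he => /=; last by rewrite divr_gt0.
  by move: hn; rewrite sub0r.
- exact: cvg_cst.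
- by move=> x /=; rewrite in_itv/= => /andP[x0 _]; exact: g0.
by move=> i E; rewrite -E /Rintegral fineK// integrable_fin_num//.
Qed.

Section independence.
Context {R : realType} d (Omega : measurableType d) (P : probability Omega R).
Variables (Y Theta : {RV P >-> R}).
Hypothesis hindep : independent_RV Y Theta.

(** Independence is the statement that the law of the pair agrees with the product of the laws on
    rectangles, hence everywhere. Tonelli then integrates over [Y] with [Theta] frozen. *)
Lemma independent_tonelli (h : R * R -> \bar R) : measurable_fun setT h ->
  (forall z, 0 <= h z)%E ->
  (\int[P]_w h (Y w, Theta w) = \int[P]_w \int[P]_v h (Y v, Theta w))%E.
Proof.
move=> mh h0; pose phi w := (Y w, Theta w).
have mY : measurable_fun setT Y by [].
have mT : measurable_fun setT Theta by [].
have mphi : measurable_fun setT phi by exact: measurable_fun_pair.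
have L := @ge0_integral_pushforward _ _ _ _ _ _ mphi P setT h measurableT mh (fun x _ => h0 x).
rewrite preimage_setT in L; apply: etrans (esym L) _.
have U : forall A, measurable A ->
    (distribution P Y \x distribution P Theta)%E A = pushforward P phi A.
  have := @product_measure_unique _ _ _ _ _ (distribution P Y) (distribution P Theta)
    (pushforward P phi).
  move=> /(_ mphi); apply => A B mA mB.
  by rewrite /= /pushforward -hindep.
transitivity (\int[(distribution P Y \x distribution P Theta)%E]_z h z)%E.
  by apply: eq_measure_integral => A mA _; apply/esym; exact: (U A mA).
rewrite fubini_tonelli2//.
have mG : measurable_fun setT (fubini_G (distribution P Y) h).
  exact: measurable_fun_fubini_tonelli_G.
have G0 t : (0 <= fubini_G (distribution P Y) h t)%E.
  by apply: integral_ge0 => y _; exact: h0.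
have L2 := @ge0_integral_pushforward _ _ _ _ _ _ mT P setT _ measurableT mG (fun x _ => G0 x).
rewrite preimage_setT in L2; apply: etrans L2 _.
apply: eq_integral => w _; rewrite /= /fubini_G.
have mhw : measurable_fun setT (fun y => h (y, Theta w)).
  by apply: measurableT_comp => //; exact: measurable_pair2.
have L3 := @ge0_integral_pushforward _ _ _ _ _ _ mY P setT _ measurableT mhw (fun x _ => h0 _).
by rewrite preimage_setT in L3; exact: L3.
Qed.

End independence.

Section bilinear.
Context {R : realType} (p : nat) (a : 'rV[R]_p) (v : 'cV[R]_p).

(** Being linear in [A], it commutes with limits, derivatives and integrals taken entrywise; the
    lemmas below record this. *)
Definition bilin (A : 'M[R]_p) : R := (a *m A *m v) 0 0.

Lemma bilinE A : bilin A = \sum_j \sum_i (a 0 i * v j 0) * A i j.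
Proof.
rewrite /bilin mxE; apply: eq_bigr => j _; rewrite mxE mulr_suml.
by apply: eq_bigr => i _; rewrite mulrAC.
Qed.

Lemma bilin_ge0 (A : 'M[R]_p) : (forall i, 0 <= a 0 i) -> (forall j, 0 <= v j 0) ->
  (forall i j, 0 <= A i j) -> 0 <= bilin A.
Proof.
move=> a0 v0 A0; rewrite bilinE; apply: sumr_ge0 => j _; apply: sumr_ge0 => i _.
by apply: mulr_ge0 => //; exact: mulr_ge0.
Qed.

Lemma bilin_der (A : R -> 'M[R]_p) x (B : 'M[R]_p) : (forall i j, der (fun t => A t i j) x (B i j)) ->
  der (fun t => bilin (A t)) x (bilin B).
Proof.
move=> h; rewrite (_ : (fun t => _) = (fun t => \sum_j \sum_i (a 0 i * v j 0) * A t i j)); last first.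
  by apply/funext => t; exact: bilinE.
rewrite bilinE; apply: der_sum => j; apply: der_sum => i.
by apply: der_eq (derM (der_cst _ x) (h i j)) _; rewrite mul0r add0r.
Qed.

Lemma bilin_cvg (A : R -> 'M[R]_p) (F : set_system R) (B : 'M[R]_p) : Filter F ->
  (forall i j, A t i j @[t --> F] --> B i j) -> bilin (A t) @[t --> F] --> bilin B.
Proof.
move=> FF h; rewrite (_ : (fun t => _) = (fun t => \sum_j \sum_i (a 0 i * v j 0) * A t i j)); last first.
  by apply/funext => t; exact: bilinE.
rewrite bilinE; apply: cvg_sum => j; apply: cvg_sum => i.
by apply: cvgM; [exact: cvg_cst|exact: h].
Qed.

Lemma bilin_measurable d (O : measurableType d) (A : O -> 'M[R]_p) :
  (forall i j, measurable_fun setT (fun t => A t i j)) -> measurable_fun setT (fun t => bilin (A t)).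
Proof.
move=> h; rewrite (_ : (fun t => _) = (fun t => \sum_j \sum_i (a 0 i * v j 0) * A t i j)); last first.
  by apply/funext => t; exact: bilinE.
by apply: measurable_sum => j; apply: measurable_sum => i; exact: measurable_funM.
Qed.

Lemma bilin_integral d (O : measurableType d) (m : {measure set O -> \bar R}) (D : set O)
    (A : O -> 'M[R]_p) : measurable D ->
  (forall i j, m.-integrable D (EFin \o (fun t => A t i j))) ->
  (\int[m]_(t in D) (bilin (A t))%:E = (bilin (\matrix_(i, j) \int[m]_(t in D) A t i j))%:E)%E.
Proof.
move=> mD h.
have i1 i j : m.-integrable D (EFin \o (fun t => (a 0 i * v j 0) * A t i j)).
  exact: (@integrableZl _ _ _ m _ mD (a 0 i * v j 0) _ (h i j)).
have i2 j : m.-integrable D (EFin \o (fun t => \sum_i (a 0 i * v j 0) * A t i j)).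
  rewrite (_ : EFin \o _ = fun t => \sum_i ((a 0 i * v j 0) * A t i j)%:E)%E; last first.
    by apply/funext => t /=; rewrite sumEFin.
  by apply: integrable_sum => // i _; exact: i1.
have i3 : m.-integrable D (EFin \o (fun t => \sum_j \sum_i (a 0 i * v j 0) * A t i j)).
  rewrite (_ : EFin \o _ = fun t => \sum_j (\sum_i (a 0 i * v j 0) * A t i j)%:E)%E; last first.
    by apply/funext => t /=; rewrite sumEFin.
  by apply: integrable_sum => // j _; exact: i2.
transitivity ((\int[m]_(t in D) (\sum_j \sum_i (a 0 i * v j 0) * A t i j))%:E)%E.
  rewrite /Rintegral fineK; last exact: (integrable_fin_num mD i3).
  by apply: eq_integral => t _; rewrite bilinE.
congr EFin; rewrite (@Rintegral_sum _ _ _ m D _ _ mD i2) bilinE; apply: eq_bigr => j _.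
rewrite (@Rintegral_sum _ _ _ m D _ _ mD (fun i => i1 i j)); apply: eq_bigr => i _.
by rewrite (@RintegralZl _ _ _ m D _ _ mD (h i j)) mxE.
Qed.

End bilinear.

Lemma ge0_integralMl (R : realType) d (O : measurableType d) (m : {measure set O -> \bar R})
    (D : set O) (k : R) (f : O -> R) : measurable D -> measurable_fun setT f -> 0 <= k ->
  (forall x, D x -> 0 <= f x) ->
  (\int[m]_(x in D) (k * f x)%:E = k%:E * \int[m]_(x in D) (f x)%:E)%E.
Proof.
move=> mD mf k0 f0.
have mfD : measurable_fun D (EFin \o f) by apply: measurable_funTS; exact/measurable_EFinP.
have f0D x : D x -> (0 <= (EFin \o f) x)%E by move=> Dx; rewrite lee_fin; exact: f0.
have k0E : (0 <= k%:E)%E by rewrite lee_fin.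
exact: (ge0_integralZl m mD mfD f0D k0E).
Qed.

Lemma indic_pred (R : realType) (O : Type) (b : O -> bool) (x : O) :
  \1_[set x | b x] x = (b x)%:R :> R.
Proof.
rewrite indicE; congr (_%:R); congr nat_of_bool.
by apply/idP/idP => [/set_mem//|h]; exact: mem_set.
Qed.

(** * Moments and Laplace transform of [Y] from its survival function *)

Section law.
Context {R : realType} d (Omega : measurableType d) (P : probability Omega R).
Notation mu := (@lebesgue_measure R).
Variables (Y : {RV P >-> R}) (p : nat) (alpha : 'rV[R]_p) (T : 'M[R]_p) (S : R -> 'M[R]_p).
Hypotheses (hS : semigroup_block T S) (sT : stable T).
Hypotheses (alpha0 : forall i, 0 <= alpha 0 i) (alpha1 : \sum_i alpha 0 i = 1).
Let G t := bilin alpha (ones p) (S t).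
Hypothesis surv : forall t, 0 <= t -> P [set w | Y w <= t] = (1 - G t)%:E.

Let D : set (measurableTypeR R) := `]0, +oo[%classic.
Let mD : measurable D. Proof. exact: measurable_itv. Qed.
Let mY : measurable_fun setT Y. Proof. by []. Qed.

Let ones_ge0 j : 0 <= (ones p : 'cV[R]_p) j 0.
Proof. by rewrite mxE. Qed.

Lemma survival_ge0 t : 0 <= t -> 0 <= G t.
Proof. by move=> t0; apply: bilin_ge0 => // i j; exact: (block_ge0 hS). Qed.

Let measurable_le t : measurable [set w | Y w <= t].
Proof.
rewrite (_ : [set w | _] = Y @^-1` `]-oo, t]); last first.
  by apply/seteqP; split => w; rewrite /= in_itv.
by rewrite -[X in measurable X]setTI; apply: mY => //; exact: measurable_itv.
Qed.

Lemma survival t : 0 <= t -> P [set w | t < Y w] = (G t)%:E.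
Proof.
move=> t0; rewrite (_ : [set w | _] = ~` [set w | Y w <= t]); last first.
  by apply/seteqP; split => w /=; rewrite ltNge => /negP.
by rewrite probability_setC// surv// -EFinB opprB addrC subrK.
Qed.

Lemma layer_cake (g : R -> R) : measurable_fun setT g -> (forall u, 0 < u -> 0 <= g u) ->
  (\int[P]_w \int[mu]_(u in D) (g u * (u < Y w)%R%:R)%:E = \int[mu]_(u in D) (g u * G u)%:E)%E.
Proof.
move=> mg g0; pose f (z : Omega * R) := (g z.2 * (z.2 < Y z.1)%R%:R)%:E.
have mlt : measurable_fun setT (fun z : Omega * R => z.2 < Y z.1).
  apply: measurable_fun_ltr; first exact: measurable_snd.
  exact: (measurableT_comp mY (@measurable_fst _ _ _ _)).
have mf : measurable_fun setT f.
  apply/measurable_EFinP; apply: measurable_funM.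
    exact: (measurableT_comp mg (@measurable_snd _ _ _ _)).
  rewrite (_ : (fun z : Omega * R => _) = \1_[set z | z.2 < Y z.1]); last first.
    by apply/funext => z; rewrite (indic_pred _ (fun z : Omega * R => z.2 < Y z.1)).
  apply: measurable_indic; rewrite -[X in measurable X]setTI.
  exact: (mlt measurableT [set true]).
rewrite (@tonelli_on R _ _ _ _ P mu setT D f measurableT mD mf); last first.
  by move=> w u _ /in0y u0; rewrite lee_fin; apply: mulr_ge0 => //; exact: g0.
apply: eq_integral => u /set_mem /in0y u0.
have mA : measurable [set w | u < Y w].
  rewrite (_ : [set w | _] = ~` [set w | Y w <= u]); first exact: measurableC.
  by apply/seteqP; split => w /=; rewrite ltNge => /negP.
transitivity ((g u)%:E * \int[P]_w (\1_[set w | u < Y w] w)%:E)%E.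
  have m1 : measurable_fun setT (\1_[set w | u < Y w] : Omega -> R) by exact: measurable_indic.
  have i0 w : setT w -> 0 <= (\1_[set w | u < Y w] : Omega -> R) w by rewrite indicE.
  rewrite -(ge0_integralMl P measurableT m1 (g0 _ u0) i0).
  by apply: eq_integral => w _; rewrite /f /= (indic_pred _ (fun w => u < Y w)).
rewrite integral_indic// setIT EFinM; congr (_ * _)%E.
by apply: survival; exact: ltW.
Qed.

Lemma inner_cake (Phi g : R -> R) (c y : R) : measurable_fun setT g ->
  (forall v, 0 < v -> der Phi v (g v)) -> (forall v, 0 < v -> {for v, continuous g}) ->
  (forall v, 0 < v -> 0 <= g v) -> Phi v @[v --> 0^'+] --> c ->
  (\int[mu]_(u in D) (g u * (u < y)%R%:R)%:E = (if 0 < y then Phi y - c else 0)%:E)%E.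
Proof.
move=> mg dP cg g0 Pc; case: ifPn => [y0|]; last first.
  rewrite -leNgt => y0; rewrite (eq_integral (fun=> 0%E)) ?integral0// => u /set_mem /in0y u0.
  by rewrite (_ : (u < y) = false) ?mulr0//; apply/negbTE; rewrite -leNgt (le_trans y0) ?ltW.
rewrite -(interval_FTC y0 mg dP cg g0 Pc) -integral_itv_bndo_bndc; last first.
  by apply: measurable_funTS; exact/measurable_EFinP.
rewrite (_ : `]0, y[%classic = D `&` [set u | u < y]); last first.
  by apply/seteqP; split => u; rewrite /D /= !in_itv/= andbT => /andP.
rewrite integral_mkcondr; apply: eq_integral => u _; rewrite patchE.
case: ifPn => [/set_mem /= ->|]; first by rewrite mulr1.
by case: (u < y) / idP => h; rewrite ?mulr0// notin_setE => /(_ h).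
Qed.

(** The positive part is taken because [Y] is positive only almost surely, while the layer cake
    formula is applied pointwise. *)
Lemma phase_moment nu : 0 < nu ->
  (\int[P]_w ((Num.max (Y w) 0) `^ nu)%:E = (nu * bilin alpha (ones p) (moment S nu))%:E)%E.
Proof.
move=> nu0; pose g u : R := nu * u `^ (nu - 1).
have mg : measurable_fun setT g by apply: measurable_funM => //; exact: measurable_powR.
have g0 u : 0 < u -> 0 <= g u by move=> u0; apply: mulr_ge0; [exact: ltW|exact: powR_ge0].
transitivity (\int[P]_w \int[mu]_(u in D) (g u * (u < Y w)%R%:R)%:E)%E.
  apply: eq_integral => w _.
  rewrite (@inner_cake (fun u => u `^ nu) g 0 (Y w) mg)//; last 3 first.
  - by move=> v v0; exact: der_powR.
  - by move=> v v0; apply: cvgM; [exact: cvg_cst|exact: powR_cont].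
  - exact: powR_cvg0.
  rewrite subr0; congr EFin; case: ltP => // _.
  by rewrite powR0// gt_eqF.
rewrite (layer_cake mg g0).
have iN i j : mu.-integrable D (EFin \o (fun u => (u `^ (nu - 1) *: S u) i j)).
  by under [X in EFin \o X]funext => u do rewrite mxE; exact: (moment_integrable hS sT i j nu0).
have bE := bilin_integral alpha (ones p) mD iN.
have bI : (\int[mu]_(u in D) (u `^ (nu - 1) * G u)%:E = (bilin alpha (ones p) (moment S nu))%:E)%E.
  transitivity (\int[mu]_(u in D) (bilin alpha (ones p) (u `^ (nu - 1) *: S u))%:E)%E.
    by apply: eq_integral => u _; rewrite /G /bilin -scalemxAr -scalemxAl [in RHS]mxE.
  rewrite bE; congr (bilin _ _ _)%:E; apply/matrixP => i j; rewrite !mxE.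
  by apply: eq_Rintegral => u _; rewrite mxE.
rewrite EFinM -bI -(ge0_integralMl mu mD); last 3 first.
- apply: measurable_funM; first exact: measurable_powR.
  by apply: bilin_measurable => i j; exact: (measurable_block hS).
- exact: ltW.
- by move=> u /in0y /ltW u0; apply: mulr_ge0; [exact: powR_ge0|exact: survival_ge0].
by apply: eq_integral => u _; rewrite /g mulrA.
Qed.

(** The layer cake formula concerns functions vanishing at 0, hence gives the mean of
    [1 - expR (- (u Y))], namely [u * bilin alpha (ones p) (lap S u)]; the total mass 1 then yields
    the transform. *)
Lemma phase_laplace u : 0 < u ->
  (\int[P]_w (expR (- (u * Num.max (Y w) 0)))%:E = (bilin alpha (exit_vector T) (lap S u))%:E)%E.
Proof.
move=> u0; have u0' := ltW u0; pose g v : R := u * expR (- (u * v)).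
have me : measurable_fun setT (fun v : R => expR (- (u * v))).
  have := measurable_expRNM u; under eq_fun do rewrite mulrC; exact.
have mg : measurable_fun setT g by exact: measurable_funM.
have g0 v : 0 < v -> 0 <= g v by move=> v0; apply: mulr_ge0 => //; exact: expR_ge0.
have dg v : der (fun v => expR (- (u * v))) v (- g v).
  apply: der_eq (der_comp (derN (derM (der_cst u v) (der_id v))) (der_exp _)) _.
  by rewrite /g mul0r add0r mulr1 mulrN mulrC.
pose Phi v : R := - expR (- (u * v)).
have c0 : Phi v @[v --> 0^'+] --> (-1 : R).
  have -> : -1 = Phi 0 by rewrite /Phi mulr0 oppr0 expR0.
  by apply: cvg_at_right_filter; exact: der_cont (derN (dg 0)).
have E : (\int[P]_w (1 - expR (- (u * Num.max (Y w) 0)))%:E = (u * bilin alpha (ones p) (lap S u))%:E)%E.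
  transitivity (\int[P]_w \int[mu]_(v in D) (g v * (v < Y w)%R%:R)%:E)%E.
    apply: eq_integral => w _.
    rewrite (@inner_cake Phi g (-1) (Y w) mg _ _ _ c0)//; last 2 first.
    - by move=> v v0; apply: der_eq (derN (dg v)) _; rewrite opprK.
    - by move=> v v0; apply: cvgM; [exact: cvg_cst|exact: der_cont (dg v)].
    congr EFin; case: ltP => y0; first by rewrite /Phi opprK addrC.
    by rewrite mulr0 oppr0 expR0 subrr.
  rewrite (layer_cake mg g0).
  have iN i j : mu.-integrable D (EFin \o (fun v => (expR (- (u * v)) *: S v) i j)).
    by under [X in EFin \o X]funext => v do rewrite mxE; exact: (lap_integrable hS sT i j u0').
  have bE := bilin_integral alpha (ones p) mD iN.
  have bI : (\int[mu]_(v in D) (expR (- (u * v)) * G v)%:E = (bilin alpha (ones p) (lap S u))%:E)%E.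
    transitivity (\int[mu]_(v in D) (bilin alpha (ones p) (expR (- (u * v)) *: S v))%:E)%E.
      by apply: eq_integral => v _; rewrite /G /bilin -scalemxAr -scalemxAl [in RHS]mxE.
    rewrite bE; congr (bilin _ _ _)%:E; apply/matrixP => i j; rewrite !mxE.
    by apply: eq_Rintegral => v _; rewrite mxE.
  rewrite EFinM -bI -(ge0_integralMl mu mD) //; last 2 first.
  - apply: measurable_funM => //.
    by apply: bilin_measurable => i j; exact: (measurable_block hS).
  - by move=> v /in0y /ltW v0; apply: mulr_ge0; [exact: expR_ge0|exact: survival_ge0].
  by apply: eq_integral => v _; rewrite /g mulrA.
have mmax : measurable_fun setT (fun w => expR (- (u * Num.max (Y w) 0))).
  by apply: (measurableT_comp me); apply: measurable_maxr.
have e1 w : expR (- (u * Num.max (Y w) 0)) <= 1.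
  by rewrite -expR0 ler_expR oppr_le0 mulr_ge0// le_max lexx orbT.
have tot : (\int[P]_w (expR (- (u * Num.max (Y w) 0)))%:E +
    \int[P]_w (1 - expR (- (u * Num.max (Y w) 0)))%:E = 1)%E.
  have h1 w : setT w -> (0 <= (expR (- (u * Num.max (Y w) 0)))%:E)%E.
    by rewrite lee_fin expR_ge0.
  have h2 w : setT w -> (0 <= (1 - expR (- (u * Num.max (Y w) 0)))%:E)%E.
    by rewrite lee_fin subr_ge0.
  have h3 : measurable_fun setT (fun w => (expR (- (u * Num.max (Y w) 0)))%:E).
    exact/measurable_EFinP.
  have h4 : measurable_fun setT (fun w => (1 - expR (- (u * Num.max (Y w) 0)))%:E).
    by apply/measurable_EFinP; exact: measurable_funB.
  rewrite -ge0_integralD//.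
  transitivity (\int[P]_w (cst 1%E w))%E.
    by apply: eq_integral => w _; rewrite -EFinD addrC subrK.
  by rewrite integral_cst// mul1e; exact: probability_setT.
(* The exit vector is [(u - T) e - u e], [lap S u] inverts [u - T], and [alpha] has total mass 1. *)
have V : bilin alpha (exit_vector T) (lap S u) = 1 - u * bilin alpha (ones p) (lap S u).
  have h := lap_mul hS sT u0'.
  rewrite /bilin /exit_vector (_ : - T = (u%:M - T) - u%:M); last by rewrite addrAC subrr sub0r.
  rewrite mulmxBl mulmxBr mxE [in X in _ + X]mxE mul_scalar_mx -scalemxAr [in X in _ - X]mxE.
  congr (_ - _); rewrite mulmxA -(mulmxA alpha) h mulmx1 mxE -alpha1.
  by apply: eq_bigr => i _; rewrite mxE mulr1.
rewrite E in tot; rewrite V EFinB -tot addeK//.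
Qed.

End law.

(** * Distribution function, density, transform and moments of [X] *)

Section scaled_law.
Context {R : realType} d (Omega : measurableType d) (P : probability Omega R).
Notation mu := (@lebesgue_measure R).
Variables (p : nat) (alpha : 'rV[R]_p) (T : 'M[R]_p) (S : R -> 'M[R]_p).
Variables (Y Theta X : {RV P >-> R}).
Hypotheses (hS : semigroup_block T S) (sT : stable T).
Hypotheses (alpha0 : forall i, 0 <= alpha 0 i) (alpha1 : \sum_i alpha 0 i = 1).
Let G t := bilin alpha (ones p) (S t).
Hypothesis surv : forall t, 0 <= t -> P [set w | Y w <= t] = (1 - G t)%:E.
Hypothesis Ypos : P [set w | Y w <= 0] = 0%E.
Hypothesis hTheta : forall w, 0 < Theta w.
Hypothesis hindep : independent_RV Y Theta.
Hypothesis hX : forall w, X w = (Theta w)^-1 * Y w.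

Let mY : measurable_fun setT Y. Proof. by []. Qed.
Let mTheta : measurable_fun setT Theta. Proof. by []. Qed.
Let mX : measurable_fun setT X. Proof. by []. Qed.
Let PT : (P setT < +oo)%E. Proof. exact: probT_lty. Qed.

Let measurable_leY t : measurable [set w | Y w <= t].
Proof.
rewrite (_ : [set w | _] = Y @^-1` `]-oo, t]); last first.
  by apply/seteqP; split => w; rewrite /= in_itv.
by rewrite -[X in measurable X]setTI; apply: mY => //; exact: measurable_itv.
Qed.

Let aeY (f g : Omega -> R) : measurable_fun setT f -> measurable_fun setT g ->
  (forall w, 0 < Y w -> f w = g w) -> (\int[P]_w (f w)%:E = \int[P]_w (g w)%:E)%E.
Proof.
move=> mf mg fg; apply: ae_eq_integral => //; try exact/measurable_EFinP.
exists [set w | Y w <= 0]; split => //.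
move=> w /= h; rewrite leNgt; apply/negP => Yw; apply: h => _.
by rewrite fg.
Qed.

Let max1_measurable : measurable_fun setT (fun z : R * R => Num.max z.1 0).
Proof. by apply: measurable_maxr; [exact: measurable_fst|exact: measurable_cst]. Qed.

Let maxY_measurable : measurable_fun setT (fun w => Num.max (Y w) 0).
Proof. exact: measurable_maxr. Qed.

Let expect_integral (f : Omega -> R) : ('E_P[f] = \int[P]_w (f w)%:E)%E.
Proof. by rewrite unlock. Qed.

Let lap_Theta_measurable s i j : 0 < s -> measurable_fun setT (fun w => lap S (s / Theta w) i j).
Proof.
move=> s0; apply: (@measurable_comp _ _ _ _ _ _ (`]0, +oo[%classic : set R) (fun s => lap S s i j) setT
  (fun w => s / Theta w)).
- exact: measurable_itv.
- by move=> _ [w _ <-]; rewrite /= in_itv/= andbT divr_gt0.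
- exact: (measurable_lap i j hS sT).
- by apply: measurable_funM => //; exact: measurable_funV.
Qed.

Lemma laplace_scaled s : 0 < s -> laplace P X s =
  ((alpha *m expectation_mx P (fun w => invmx ((s / Theta w)%:M - T)) *m exit_vector T) 0 0)%:E.
Proof.
move=> s0; rewrite /laplace expect_integral.
have q0 w : 0 < s / Theta w by rewrite divr_gt0.
pose k (z : R * R) : R := expR (- (s / z.2 * Num.max z.1 0)).
have mk : measurable_fun setT k.
  apply: measurableT_comp; first exact: measurable_expR.
  apply: measurableT_comp => //; apply: measurable_funM => //.
  by apply: measurable_funM => //; apply: measurable_funV; exact: measurable_snd.
have mkw : measurable_fun setT (fun w => k (Y w, Theta w)).
  by apply: (measurableT_comp mk); exact: measurable_fun_pair.
rewrite (aeY _ mkw); last 2 first.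
- apply: measurableT_comp; first exact: measurable_expR.
  by apply: measurableT_comp => //; exact: measurable_funM.
- by move=> w Yw; rewrite /k /= max_l ?ltW// hX mulrA.
have mkE : measurable_fun setT (EFin \o k) by exact/measurable_EFinP.
have := independent_tonelli hindep mkE (fun z => _).
move=> /(_ _)/= ->; last by move=> z; rewrite lee_fin expR_ge0.
(* The entries of [lap] are nonnegative and largest at 0, so a constant dominates them. *)
have il i j : P.-integrable setT (EFin \o (fun w => lap S (s / Theta w) i j)).
  apply: (@integrable_bounded _ _ _ P setT _ (lap S 0 i j) measurableT PT).
    exact: lap_Theta_measurable.
  move=> w _; rewrite ger0_norm; first by apply: (lap_le hS sT); exact: ltW.
  exact: (lap_ge0 hS).
transitivity (\int[P]_w (bilin alpha (exit_vector T) (lap S (s / Theta w)))%:E)%E.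
  apply: eq_integral => w _.
  exact: (phase_laplace hS sT alpha0 alpha1 surv (q0 w)).
rewrite (bilin_integral alpha (exit_vector T) measurableT il).
congr (bilin _ _ _)%:E; apply/matrixP => i j; rewrite !mxE expect_integral.
apply: eq_Rintegral => w _.
by have [<- _] := lapE hS sT (ltW (q0 w)).
Qed.

Let powR_invM (nu a b : R) : 0 < a -> 0 <= b -> (a^-1 * b) `^ nu = (a `^ nu)^-1 * b `^ nu.
Proof.
move=> a0 b0; rewrite powRM ?invr_ge0 ?(ltW a0)//; congr (_ * _).
by rewrite -(powR_inv1 (ltW a0)) -powRrM mulN1r powRN.
Qed.

Lemma moment_scaled nu : 0 < nu ->
  ('E_P[fun w => (X w `^ nu)%R] =
   'E_P[fun w => ((Theta w `^ nu)^-1)%R] * (nu * bilin alpha (ones p) (moment S nu))%:E)%E.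
Proof.
move=> nu0; rewrite !expect_integral.
set c := nu * _.
have mV : measurable_fun setT (fun w => (Theta w `^ nu)^-1).
  by apply: measurable_funV; exact: (measurableT_comp (measurable_powR nu) mTheta).
pose k (z : R * R) : R := (z.2 `^ nu)^-1 * (Num.max z.1 0) `^ nu.
have mk : measurable_fun setT k.
  apply: measurable_funM.
    by apply: measurable_funV; exact: (measurableT_comp (measurable_powR nu) measurable_snd).
  exact: (measurableT_comp (measurable_powR nu) max1_measurable).
have mkw : measurable_fun setT (fun w => k (Y w, Theta w)).
  by apply: (measurableT_comp mk); exact: measurable_fun_pair.
rewrite (aeY _ mkw); last 2 first.
- exact: (measurableT_comp (measurable_powR nu) mX).
- by move=> w Yw; rewrite /k /= max_l ?ltW// hX powR_invM// ltW.
have mkE : measurable_fun setT (EFin \o k) by exact/measurable_EFinP.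
have k0 z : (0 <= (EFin \o k) z)%E.
  by rewrite lee_fin mulr_ge0 ?invr_ge0 ?powR_ge0.
rewrite [LHS](independent_tonelli hindep mkE k0).
have pm := phase_moment hS sT alpha0 surv nu0.
have mm : measurable_fun setT (fun w => Num.max (Y w) 0 `^ nu).
  exact: (measurableT_comp (measurable_powR nu) maxY_measurable).
have c0 : 0 <= c.
  by rewrite -lee_fin -pm; apply: integral_ge0 => w _; rewrite lee_fin powR_ge0.
transitivity (\int[P]_w (c * (Theta w `^ nu)^-1)%:E)%E.
  apply: eq_integral => w _; rewrite /k /=.
  rewrite (ge0_integralMl P measurableT mm); last 2 first.
  - by rewrite invr_ge0 powR_ge0.
  - by move=> v _; exact: powR_ge0.
  by rewrite pm -EFinM mulrC.
rewrite (ge0_integralMl P measurableT mV c0); last by move=> w _; rewrite invr_ge0 powR_ge0.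
by rewrite muleC.
Qed.

Lemma survival_le1 t : 0 <= t -> 0 <= G t <= 1.
Proof.
move=> t0; apply/andP; split.
  by apply: bilin_ge0 => // [j|i j]; [rewrite mxE|exact: (block_ge0 hS)].
by rewrite -subr_ge0 -lee_fin -surv.
Qed.

Let GT_measurable x : measurable_fun setT (fun w => G (x * Theta w)).
Proof.
apply: bilin_measurable => i j; apply: (measurableT_comp (measurable_block hS i j)).
exact: measurable_funM.
Qed.

(** The event is [Y <= x * Theta]; freezing [Theta] leaves the distribution function of [Y]. *)
Lemma prob_scaled_le x : 0 < x ->
  P (X @^-1` `]-oo, x]) = (\int[P]_w (1 - G (x * Theta w))%:E)%E.
Proof.
move=> x0; pose k (z : R * R) : R := (z.1 <= x * z.2)%R%:R.
have mk : measurable_fun setT k.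
  rewrite (_ : k = \1_[set z : R * R | z.1 <= x * z.2]); last first.
    by apply/funext => z; rewrite (indic_pred _ (fun z : R * R => z.1 <= x * z.2)).
  apply: measurable_indic; rewrite -[X in measurable X]setTI.
  have m : measurable_fun setT (fun z : R * R => z.1 <= x * z.2).
    apply: measurable_fun_ler; first exact: measurable_fst.
    by apply: measurable_funM => //; exact: measurable_snd.
  exact: (m measurableT [set true]).
have mA : measurable (X @^-1` `]-oo, x]).
  by rewrite -[X in measurable X]setTI; apply: mX => //; exact: measurable_itv.
have mkE : measurable_fun setT (EFin \o k) by exact/measurable_EFinP.
have k0 z : (0 <= (EFin \o k) z)%E by rewrite lee_fin.
transitivity (\int[P]_w (EFin \o k) (Y w, Theta w))%E.
  rewrite -[X in P X]setIT -(integral_indic P measurableT mA).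
  apply: eq_integral => w _; congr EFin.
  rewrite (_ : X @^-1` _ = [set w | X w <= x]); last first.
    by apply/seteqP; split => v; rewrite /= in_itv.
  rewrite (indic_pred _ (fun w => X w <= x)) /k /= hX.
  by rewrite mulrC ler_pdivrMr.
rewrite (independent_tonelli hindep mkE k0); apply: eq_integral => w _.
have t0 : 0 <= x * Theta w by rewrite mulr_ge0 ?ltW.
rewrite -(surv t0) -[X in P X]setIT -(integral_indic P measurableT (measurable_leY _)).
by apply: eq_integral => v _; rewrite (indic_pred _ (fun v => Y v <= x * Theta w)).
Qed.

Let block_Theta_integrable x i j : 0 < x ->
  P.-integrable setT (EFin \o (fun w => S (x * Theta w) i j)).
Proof.
move=> x0; apply: (@integrable_bounded _ _ _ P setT _ 1 measurableT PT).
  by apply: (measurableT_comp (measurable_block hS i j)); exact: measurable_funM.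
move=> w _; have t0 : 0 <= x * Theta w by rewrite mulr_ge0 ?ltW.
by rewrite ger0_norm; [exact: (block_le1 hS)|exact: (block_ge0 hS)].
Qed.

Lemma cdf_scaled x : 0 < x -> cdf X x =
  (1 - bilin alpha (ones p) (\matrix_(i, j) \int[P]_w S (x * Theta w) i j))%:E.
Proof.
move=> x0; have -> : cdf X x = P (X @^-1` `]-oo, x]) by [].
rewrite (prob_scaled_le x0).
have bI := bilin_integral alpha (ones p) measurableT (fun i j => block_Theta_integrable i j x0).
have b w : 0 <= G (x * Theta w) <= 1 by apply: survival_le1; rewrite mulr_ge0 ?ltW.
have h1 w : setT w -> (0 <= (G (x * Theta w))%:E)%E by rewrite lee_fin; have /andP[] := b w.
have h2 w : setT w -> (0 <= (1 - G (x * Theta w))%:E)%E.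
  by rewrite lee_fin subr_ge0; have /andP[] := b w.
have h3 : measurable_fun setT (fun w => (G (x * Theta w))%:E) by exact/measurable_EFinP.
have h4 : measurable_fun setT (fun w => (1 - G (x * Theta w))%:E).
  by apply/measurable_EFinP; exact: measurable_funB.
have tot : (\int[P]_w (G (x * Theta w))%:E + \int[P]_w (1 - G (x * Theta w))%:E = 1)%E.
  rewrite -ge0_integralD//.
  transitivity (\int[P]_w (cst 1%E w))%E.
    by apply: eq_integral => w _; rewrite -EFinD addrC subrK.
  by rewrite integral_cst// mul1e; exact: probability_setT.
by rewrite {1}/G bI in tot; rewrite EFinB -tot [X in (X - _)%E]addeC addeK.
Qed.

Hypothesis exit0 : forall j, 0 <= (exit_vector T) j 0.
(** The phase-type density of [Y], equal to minus the derivative of [G]. *)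
Let g y := bilin alpha (exit_vector T) (S y).

Let g_ge0 y : 0 <= y -> 0 <= g y.
Proof. by move=> y0; apply: bilin_ge0 => // i j; exact: (block_ge0 hS). Qed.

Let dG y : 0 < y -> der G y (- g y).
Proof.
move=> y0; apply: der_eq (bilin_der alpha (ones p) (fun i j => block_der hS i j y0)) _.
by rewrite /g /bilin /exit_vector mulNmx mulmxN [in RHS]mxE opprK !mulmxA.
Qed.

Let g_measurable : measurable_fun setT g.
Proof. by apply: bilin_measurable => i j; exact: (measurable_block hS). Qed.

Let g_cont y : {for y, continuous g}.
Proof. by apply: bilin_cvg => i j; exact: (block_cont hS). Qed.

Let G_cont y : {for y, continuous G}.
Proof. by apply: bilin_cvg => i j; exact: (block_cont hS). Qed.

Let G0 : G 0 = 1.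
Proof.
rewrite /G /bilin (block0 hS) mulmx1 mxE -alpha1.
by apply: eq_bigr => i _; rewrite mxE mulr1.
Qed.

(** The density of [X] at [z.2] when [Theta] is frozen, cut off at the nonpositive reals; the
    density [f] is its mean. *)
Let k (z : Omega * R) : R := (0 < z.2)%R%:R * (Theta z.1 * g (z.2 * Theta z.1)).

Let k_ge0 z : 0 <= k z.
Proof.
rewrite /k; case: ltP => z0; last by rewrite mul0r.
have h := hTheta z.1; rewrite mul1r; apply: mulr_ge0; first exact: ltW.
by apply: g_ge0; rewrite mulr_ge0 ?ltW.
Qed.

Let k_measurable : measurable_fun setT k.
Proof.
have m1 : measurable_fun setT (fun z : Omega * R => Theta z.1).
  exact: (measurableT_comp mTheta (@measurable_fst _ _ _ _)).
have m2 : measurable_fun setT (fun z : Omega * R => z.2) by exact: measurable_snd.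
apply: measurable_funM; last first.
  apply: measurable_funM => //; apply: (measurableT_comp g_measurable).
  exact: measurable_funM.
rewrite (_ : (fun z : Omega * R => _) = \1_[set z : Omega * R | 0 < z.2]); last first.
  by apply/funext => z; rewrite (indic_pred _ (fun z : Omega * R => 0 < z.2)).
apply: measurable_indic; rewrite -[X in measurable X]setTI.
have m : measurable_fun setT (fun z : Omega * R => 0 < z.2) by exact: measurable_fun_ltr.
exact: (m measurableT [set true]).
Qed.

(** The decay of [S] compensates the unbounded factor: [theta * expR (- (e x theta))] is at most
    [1 / (e x)] for every [theta > 0]. *)
Let weighted_integrable x i j : 0 < x ->
  P.-integrable setT (EFin \o (fun w => (Theta w *: S (x * Theta w)) i j)).
Proof.
move=> x0; have [C [e [C0 e0 hC]]] := S_decay hS sT.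
have ex : 0 < e * x by rewrite mulr_gt0.
apply: (@integrable_bounded _ _ _ P setT _ (C * (e * x)^-1) measurableT PT).
  under eq_fun do rewrite mxE; apply: measurable_funM => //.
  by apply: (measurableT_comp (measurable_block hS i j)); exact: measurable_funM.
move=> w _; have t0 : 0 <= x * Theta w by rewrite mulr_ge0 ?ltW.
have th := ltW (hTheta w).
rewrite mxE ger0_norm; last by apply: mulr_ge0 => //; exact: (block_ge0 hS).
apply: le_trans (ler_wpM2l th (hC _ i j t0)) _.
rewrite mulrCA; apply: ler_wpM2l => //.
by rewrite mulrA; exact: id_expN_le.
Qed.

Let f (x : R) : R := fine (\int[P]_w (k (w, x))%:E)%E.

Let fE x : ((f x)%:E = \int[P]_w (k (w, x))%:E)%E /\
  (0 < x -> f x = bilin alpha (exit_vector T) (\matrix_(i, j) \int[P]_w (Theta w *: S (x * Theta w)) i j)).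
Proof.
have [x0|x0] := ltP 0 x; last first.
  have E : (\int[P]_w (k (w, x))%:E = 0)%E.
    rewrite (eq_integral (fun=> 0%E)) ?integral0// => w _.
    by rewrite /k /= ltNge x0 mul0r.
  by split; [rewrite /f E|].
have bI := bilin_integral alpha (exit_vector T) measurableT (fun i j => weighted_integrable i j x0).
have E : (\int[P]_w (k (w, x))%:E = \int[P]_w (bilin alpha (exit_vector T) (Theta w *: S (x * Theta w)))%:E)%E.
  apply: eq_integral => w _; rewrite /k /= x0 mul1r /g /bilin.
  by rewrite -scalemxAr -scalemxAl [in RHS]mxE.
by split=> [|_]; rewrite /f E bI.
Qed.

Let f_measurable : measurable_fun setT f.
Proof.
have mkE : measurable_fun setT (EFin \o k) by exact/measurable_EFinP.
have k0 z : (0 <= (EFin \o k) z)%E by rewrite lee_fin k_ge0.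
have m := @measurable_fun_fubini_tonelli_G _ _ _ _ _ P _ mkE k0.
exact: (measurableT_comp (fine_measurable measurableT) m).
Qed.

Let f_ge0 x : 0 <= f x.
Proof. by apply: fine_ge0; apply: integral_ge0 => w _; rewrite lee_fin k_ge0. Qed.

Let f_npos x : x <= 0 -> f x = 0.
Proof.
move=> x0; rewrite /f (eq_integral (fun=> 0%E)) ?integral0// => w _.
by rewrite /k /= ltNge x0 mul0r.
Qed.

Let prob_scaled_npos x : x <= 0 -> P (X @^-1` `]-oo, x]) = 0%E.
Proof.
move=> x0; apply/eqP; rewrite eq_le measure_ge0 andbT -Ypos.
apply: le_measure; rewrite ?inE.
- by rewrite -[X in measurable X]setTI; apply: mX => //; exact: measurable_itv.
- exact: measurable_leY.
move=> w; rewrite /= in_itv/= hX => h.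
have := le_trans h x0; by rewrite mulrC pmulr_lle0// invr_gt0.
Qed.

(** For [x > 0], with [Theta] frozen, [k] integrates over the positive reals up to [x] to
    [1 - G (x Theta)]; Tonelli moves the expectation inside. For [x <= 0] both sides vanish, as [Y]
    is almost surely positive. *)
Let prob_integral x : (P (X @^-1` `]-oo, x]) = \int[mu]_(u in `]-oo, x]) (f u)%:E)%E.
Proof.
have [x0|x0] := ltP 0 x; last first.
  rewrite prob_scaled_npos// integral0_eq// => u; rewrite /= in_itv/= => ux.
  by rewrite f_npos// (le_trans ux).
transitivity (\int[mu]_(u in `]0%R, x]) (f u)%:E)%E; last first.
  rewrite (_ : `]0, x]%classic = `]-oo, x]%classic `&` [set u : R | 0 < u]); last first.
    apply/seteqP; split => u; rewrite /= !in_itv/=; first by move=> /andP[-> ->].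
    by move=> [-> ->].
  rewrite integral_mkcondr; apply: eq_integral => u _; rewrite patchE.
  case: ifPn => //; rewrite notin_setE => /negP; rewrite -leNgt => u0.
  by rewrite f_npos.
rewrite (prob_scaled_le x0).
have mI : measurable (`]0, x]%classic : set (measurableTypeR R)) by exact: measurable_itv.
transitivity (\int[P]_w \int[mu]_(u in `]0%R, x]) (k (w, u))%:E)%E.
  apply: eq_integral => w _; have th := hTheta w.
  have dP v : 0 < v -> der (fun u => - G (u * Theta w)) v (Theta w * g (v * Theta w)).
    move=> v0; have vt : 0 < v * Theta w by rewrite mulr_gt0.
    apply: der_eq (derN (der_comp (derM (der_id v) (der_cst (Theta w) v)) (dG vt))) _.
    by rewrite mul1r mulr0 addr0 mulNr opprK mulrC.
  have m : measurable_fun setT (fun v : R => v * Theta w) by exact: measurable_funM.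
  have mg : measurable_fun setT (fun v : R => Theta w * g (v * Theta w)).
    by apply: measurable_funM => //; exact: (measurableT_comp g_measurable m).
  have cmul (v : R) := der_cont (derM (der_id v) (der_cst (Theta w) v)).
  have c0 : - G (v * Theta w) @[v --> 0^'+] --> (-1 : R).
    have -> : -1 = - G (0 * Theta w) by rewrite mul0r G0.
    apply: cvg_at_right_filter; apply: cvgN.
    exact: (cvg_comp _ _ (cmul 0) (@G_cont (0 * Theta w))).
  have := interval_FTC x0 mg dP _ _ c0.
  move=> /(_ _ _)/esym H.
  transitivity ((- G (x * Theta w) - -1)%:E)%E; first by rewrite opprK addrC.
  apply: etrans (H _ _) _.
  - move=> v v0; apply: cvgM; first exact: cvg_cst.
    exact: (cvg_comp _ _ (cmul v) (@g_cont (v * Theta w))).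
  - by move=> v v0; apply: mulr_ge0; [exact: ltW|apply: g_ge0; rewrite mulr_ge0 ?ltW].
  apply: eq_integral => u; rewrite inE /= in_itv/= => /andP[u0 _].
  by rewrite /k /= u0 mul1r.
have mkE : measurable_fun setT (EFin \o k) by exact/measurable_EFinP.
rewrite (@tonelli_on R _ _ _ _ P mu setT _ (EFin \o k) measurableT mI mkE); last first.
  by move=> w u _ _; rewrite lee_fin k_ge0.
by apply: eq_integral => u _; have [-> _] := fE u.
Qed.

Lemma density_scaled : exists2 f : R -> R, has_density X f &
  forall x, 0 < x -> f x = - bilin alpha (exit_vector T)
    (\matrix_(i, j) \int[P]_w (- Theta w * S (x * Theta w) i j)).
Proof.
exists f; last first.
  move=> x x0; rewrite (fE x).2//.
  rewrite (_ : \matrix_(i, j) _ = - \matrix_(i, j) \int[P]_w (- Theta w * S (x * Theta w) i j)).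
    by rewrite /bilin mulmxN mulNmx [LHS]mxE.
  apply/matrixP => i j; rewrite !mxE -[LHS]opprK; congr (- _).
  rewrite -(RintegralN measurableT (weighted_integrable i j x0)).
  by apply: eq_Rintegral => w _; rewrite mxE mulNr.
split=> // A mA.
(* The set function with density [f] is made a measure, so that its agreement with the law of [X] on
   the rays extends to all Borel sets. *)
pose nu (B : set R) : \bar R := (\int[mu]_(x in B) (f x)%:E)%E.
have nu0 : nu set0 = 0%E by rewrite /nu integral_set0.
have nu_ge0 B : (0 <= nu B)%E by apply: integral_ge0 => x _; rewrite lee_fin f_ge0.
have nu_sa : semi_sigma_additive nu.
  move=> F mF tF mUF; rewrite /nu; apply: cvg_toP.
    apply: ereal_nondecreasing_is_cvgn => m n mn.
    by apply: lee_sum_nneg_natr => // i _ _; exact: nu_ge0.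
  rewrite ge0_integral_bigcup//=.
  - by apply: measurable_funTS; exact/measurable_EFinP.
  - by move=> x _; rewrite lee_fin f_ge0.
pose m : {measure set R -> \bar R} :=
  HB.pack nu (isMeasure.Build _ _ _ nu nu0 nu_ge0 nu_sa).
have fin x : (distribution P X `]-oo, x]%classic < +oo)%E.
  by apply: le_lt_trans (probability_le1 _ _) (ltry 1); exact: measurable_itv.
have e := @measure_eq_rays R (distribution P X) m prob_integral fin A mA.
exact: e.
Qed.

End scaled_law.

Lemma matrix_function_cpow {R : realType} (p : nat) (T : 'M[R]_p) S nu :
  semigroup_block T S -> stable T -> 0 <= nu ->
  matrix_function slit_plane (cpow (- nu)) (cmx (- T)) =
  cmx (if nu == 0 then 1%:M else (Gamma nu)^-1 *: moment S nu).
Proof.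
move=> hS sT nu0; apply: matrix_functionE; split.
  have sub (z : R[i]) : 0 < Re z -> slit_plane z by move=> z0 [] /le_lt_trans/(_ z0); rewrite ltxx.
  have [gamma [h _]] := admissible_stable sT ltr01 sub.
  by exists gamma; rewrite -scaleN1r.
move=> gamma hadm; case: eqVneq => [->|nun0].
  by rewrite (cauchy_pow0 hadm) /cmx map_mx1.
by apply: (cauchy_pow hS sT hadm); rewrite lt_neqAle eq_sym nun0.
Qed.

Lemma exit_vector_ge0 {R : realType} (p : nat) (T : 'M[R]_p) j :
  sub_intensity T -> 0 <= exit_vector T j 0.
Proof.
move=> [_ h]; rewrite /exit_vector mulNmx mxE oppr_ge0 mxE.
by under eq_bigr do rewrite mxE mulr1.
Qed.

Lemma cmx_bilin {R : realType} (p : nat) (a : 'rV[R]_p) (v : 'cV[R]_p) (A : 'M[R]_p) :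
  (cmx a *m cmx A *m cmx v) 0 0 = (bilin a v A)%:C.
Proof. by rewrite /cmx -!map_mxM mxE. Qed.

Theorem proposition3p1 (R : realType) (d : measure_display)
    (Omega : measurableType d) (P : probability Omega R)
    (p : nat) (alpha : 'rV[R]_p) (T : 'M[R]_p)
    (Y Theta X : {RV P >-> R})
    (hY : phase_type Y alpha T)
    (hTheta : forall w, 0 < Theta w)
    (hindep : independent_RV Y Theta)
    (hX : forall w, X w = (Theta w)^-1 * Y w) :
  (forall x : R, 0 < x ->
     (fine (cdf X x))%:C =
     1 - (cmx alpha
          *m matrix_function right_half_plane (claplace P Theta)
               (cmx (- x *: T))
          *m cmx (ones p)) 0 0)
  /\
  (exists2 f : R -> R, has_density X f &
     forall x : R, 0 < x ->
       (f x)%:C =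
       - (cmx alpha
          *m matrix_function right_half_plane (cderive (claplace P Theta))
               (cmx (- x *: T))
          *m cmx (exit_vector T)) 0 0)
  /\
  (forall s : R, 0 < s ->
     laplace P X s =
     ((alpha
       *m expectation_mx P (fun w => invmx ((s / Theta w)%:M - T))
       *m exit_vector T) 0 0)%:E)
  /\
  (forall nu : R, 0 <= nu ->
     ('E_P[fun w => (X w `^ nu)%R] < +oo)%E \/
     ('E_P[fun w => ((Theta w `^ nu)^-1)%R] < +oo)%E ->
     exists2 m : R,
       m%:C = (cmx alpha
               *m matrix_function slit_plane (cpow (- nu)) (cmx (- T))
               *m cmx (ones p)) 0 0
     & ('E_P[fun w => (X w `^ nu)%R] =
        'E_P[fun w => ((Theta w `^ nu)^-1)%R] * (Gamma (nu + 1) * m)%:E)%E).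
Proof.
have [S [[hS sT alpha0 alpha1] [surv Ypos]]] := phase_type_survival hY.
have exit0 j : 0 <= exit_vector T j 0 by apply: exit_vector_ge0; case: hY.
split; [|split; [|split]].
- move=> x x0; rewrite (matrix_function_claplace hTheta hS sT x0) cmx_bilin.
  rewrite (cdf_scaled hS alpha0 surv hTheta hindep hX x0).
  exact: rmorphB.
- have [f df fE] := density_scaled hS sT alpha0 alpha1 surv Ypos hTheta hindep hX exit0.
  exists f => // x x0; rewrite (matrix_function_cderive_claplace hTheta hS sT x0) cmx_bilin fE//.
  exact: rmorphN.
- by move=> s s0; exact: (laplace_scaled hS sT alpha0 alpha1 surv Ypos hTheta hindep hX s0).
- move=> nu nu0 _; rewrite (matrix_function_cpow hS sT nu0) cmx_bilin.
  (* For [nu = 0] the matrix function is the identity, treated apart because the integrand of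
     [moment S 0] has weight [1 / y]; all the expectations are 1. *)
  have [->|nun0] := eqVneq nu 0.
    exists 1.
      congr (_%:C); rewrite /bilin mulmx1 mxE -alpha1.
      by apply: eq_bigr => i _; rewrite mxE mulr1.
    have E (f : Omega -> R) : (forall w, f w = 1) -> ('E_P[f] = 1)%E.
      by move=> f1; rewrite (funext f1 : f = cst 1) expectation_cst.
    rewrite add0r Gamma1 mulr1 !E ?mule1// => w; first by rewrite powRr0 invr1.
    by rewrite powRr0.
  have nup : 0 < nu by rewrite lt_neqAle eq_sym nun0.
  (* Then [Gamma (nu + 1) * m] is [nu * bilin alpha (ones p) (moment S nu)], as
     [Gamma (nu + 1) = nu * Gamma nu]; this is the factor delivered by the layer cake formula. *)
  exists ((Gamma nu)^-1 * bilin alpha (ones p) (moment S nu)).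
    by congr (_%:C); rewrite /bilin -scalemxAr -scalemxAl [RHS]mxE.
  rewrite (moment_scaled hS sT alpha0 surv Ypos hTheta hindep hX nup); congr (_ * _%:E)%E.
  by rewrite (Gamma_succ nup) -mulrA mulVKf// gt_eqF// Gamma_gt0.
Qed.
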